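(* For every real $z\ne0$, \[ \frac{\cosh(\pi z)-1}{3z^2}=\cfrac{5}{3(1-z^2)+\cfrac{(1+4z^2)(1+9z^2)}{25+9z^2+\cfrac{(4+4z^2)(4+9z^2)}{69+9z^2+\cdots}}}, \] i.e. the continued fraction with $a(0)=0$, $a(1)=3(1-z^2)$, $a(n)=11n^2-11n+3+9z^2$ for $n\ge2$, $b(0)=5$, $b(n)=(n^2+4z^2)(n^2+9z^2)$ for $n\ge1$. Moreover, with $p(n)/q(n)$ its $n$-th convergent, as $n\to\infty$ \[ \frac{\cosh(\pi z)-1}{3z^2}-\frac{p(n)}{q(n)}\sim(-1)^n\frac{\frac{2}{3z^2}\sinh(2\pi z)\sinh(3\pi z)}{\big((1+\sqrt5)/2\big)^{10n+5}}. \]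
   Context: For sequences $a(n),b(n)$, the continued fraction is $a(0)+\cfrac{b(0)}{a(1)+\cfrac{b(1)}{a(2)+\cdots}}$ and its $n$-th convergent $p(n)/q(n)$ is the truncation ending with $b(n-1)/a(n)$. *)

(* Defs.v *)
From Stdlib Require Import Reals.
Open Scope R_scope.

(* Numerators / denominators of the convergents of
   a(0) + b(0)/(a(1) + b(1)/(a(2) + ...)), by the standard recurrences
   p(-1)=1, p(0)=a(0), q(-1)=0, q(0)=1,
   p(n) = a(n) p(n-1) + b(n-1) p(n-2), q(n) = a(n) q(n-1) + b(n-1) q(n-2). *)
Fixpoint cf_p (a b : nat -> R) (n : nat) : R :=
  match n with
  | O => a O
  | S m =>
      match m with
      | O => a 1%nat * a O + b O
      | S k => a n * cf_p a b m + b m * cf_p a b k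
      end
  end.

Fixpoint cf_q (a b : nat -> R) (n : nat) : R :=
  match n with
  | O => 1
  | S m =>
      match m with
      | O => a 1%nat
      | S k => a n * cf_q a b m + b m * cf_q a b k
      end
  end.

Definition a7 (z : R) (n : nat) : R :=
  match n with
  | O => 0
  | S O => 3 * (1 - z ^ 2)
  | _ => 11 * INR n ^ 2 - 11 * INR n + 3 + 9 * z ^ 2
  end.

Definition b7 (z : R) (n : nat) : R :=
  match n with
  | O => 5
  | _ => (INR n ^ 2 + 4 * z ^ 2) * (INR n ^ 2 + 9 * z ^ 2)
  end.

Definition golden : R := (1 + sqrt 5) / 2.

(* Main.v *)
Require Import Defs.
From Stdlib Require Import ZArith Arith Factorial Reals Lra Lia Psatz.
From Coquelicot Require Import Coquelicot.
Open Scope R_scope.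

(** Put [c = z^2], [P_m(c) = prod_{1<=j<=m} (j^2 + c)], and
      [U(n,m) = binom(m,n) P_m(c) / P_{m+n+1}(4c)],   [E_n = cosh(pi z) * sum_m U(n,m)].
    Creative telescoping in [m] gives [b(n) E_n + a(n) E_{n-1} = E_{n-2}], and [E_0] itself telescopes
    to the value [L] of the continued fraction because [P_m(c) / P_m(4c) -> 1 / cosh(pi z)].
    Hence [L q(n) - p(n) = (-1)^n D_n] with [D_n = b(1)...b(n) E_n > 0].

    The Casoratian identity [D_{n+1} q(n) + D_n q(n+1) = 5 b(1)...b(n)] turns the asymptotics of [E_n]
    into those of [q(n) / D_n], the inverse of the signed error. The factor [cosh(pi z)] cancels the
    limiting [z]-dependence of the summand, so [E_n] has the same asymptotics for every [z]: by Laplace's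
    method at [m ~ phi n], [n n!^2 phi^(5n) E_n] tends to a constant with square
    [4 pi^2 / (phi^5 sqrt 5)].

    The Gaussian sums of Laplace's method are compared with rows of Pascal's triangle, and
    [int_0^{pi/2} cosh(2zt) cos(t)^n dt] provides both Wallis' formula (hence Stirling's constant) and
    Euler's product for [sinh]. *)

(** * Creative telescoping *)

(** After division by [n!^2] the recurrence of [p] and [q] has, to leading order, the characteristic
    equation [x^2 = 11 x + 1] with roots [phi^5] and [- phi^(-5)]. So [q(n)] is a dominant and
    [(-1)^n D_n] a minimal solution, and the error has rate [phi^(-10 n)]. Perron-type arguments
    stop at the rate; the constant needs an explicit formula, and a positive series is at hand for
    the minimal solution. Hence the series is analysed and [q(n)] is recovered from the Casoratian,
    which controls a sum of two consecutive terms instead of a single one. The point [phi n] is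
    where [U(n,m+1) / U(n,m)], close to [m^3 / ((m-n) (m+n)^2)], crosses 1, that is where
    [m^2 = m n + n^2]. The limit of the normalised [E_n] enters only through [E_n E_{n+1}], so only
    its square has to be simplified. The exceptional [a(1)] and the value [b(0) = 5] come from
    telescoping at [n = 1]: there is no [U(-1,m)], and the certificate leaves a nonzero boundary
    term at infinity. *)

Fixpoint falling (n m : nat) : R :=
  match n with
  | O => 1
  | S k => falling k m * (INR m - INR k)
  end.

Fixpoint prod_sq (c : R) (m : nat) : R :=
  match m with
  | O => 1
  | S k => prod_sq c k * (INR (S k) ^ 2 + c)
  end.

(** Absorption identity: the recursion peels off the last factor of the falling factorial, this
    peels off the first. *)
Lemma falling_S_S (n m : nat) : falling (S n) (S m) = (INR m + 1) * falling n m.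
Proof.
  induction n as [|n IH].
  - cbn [falling]. rewrite S_INR. change (INR 0) with 0. ring.
  - change (falling (S (S n)) (S m)) with (falling (S n) (S m) * (INR (S m) - INR (S n))).
    rewrite IH. cbn [falling]. rewrite !S_INR. ring.
Qed.

Lemma falling_0 (n m : nat) : (m < n)%nat -> falling n m = 0.
Proof.
  induction n as [|n IH]; intros H; [lia|]. simpl.
  destruct (Nat.eq_dec m n) as [->|Hne]; [ring|].
  rewrite IH by lia. ring.
Qed.

Lemma falling_pos (n m : nat) : (n <= m)%nat -> 0 < falling n m.
Proof.
  induction n as [|n IH]; intros H; simpl; [lra|].
  apply Rmult_lt_0_compat; [apply IH; lia|].
  apply lt_INR in H. lra.
Qed.

Lemma falling_nonneg (n m : nat) : 0 <= falling n m.
Proof.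
  destruct (Nat.lt_ge_cases m n) as [H|H].
  - rewrite falling_0 by exact H. lra.
  - left; apply falling_pos, H.
Qed.

Lemma falling_fact (n m : nat) :
  falling n (n + m) = INR (fact (n + m)) / INR (fact m).
Proof.
  revert m; induction n as [|n IH]; intros m.
  - simpl. field. apply INR_fact_neq_0.
  - change (S n + m)%nat with (S (n + m)). rewrite falling_S_S, IH, fact_simpl, mult_INR, S_INR.
    field. apply INR_fact_neq_0.
Qed.

Lemma prod_sq_pos (c : R) (m : nat) : 0 <= c -> 0 < prod_sq c m.
Proof.
  intros Hc; induction m as [|m IH]; cbn [prod_sq]; [lra|].
  apply Rmult_lt_0_compat; [exact IH|].
  pose proof (pos_INR m). rewrite S_INR. nra.
Qed.

(** The [U(n,m)] of the overview. The binomial coefficient is a real falling factorial over [n!], so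
    it vanishes by itself for [m < n] and the series can run over all [m]. *)
Definition summand (c : R) (n m : nat) : R :=
  falling n m / INR (fact n) * prod_sq c m / prod_sq (4 * c) (S (n + m)).

(** Polynomial part of a Zeilberger certificate for the recurrence in [n]. It is only quadratic in
    [m], which is what makes the boundary term at infinity vanish. *)
Definition cert_poly (c n m : R) : R :=
  n * m ^ 2 - (6 * n ^ 2 - 5 * n + 12 * c) * m
  - (11 * n ^ 3 - 7 * n ^ 2 + (4 * n + 12) * c).

(** The recurrence index is [n + 2], which avoids subtraction on naturals; the factor
    [falling (S n) m] kills the boundary term at [m = 0]. *)
Definition cert (c : R) (n m : nat) : R :=
  falling (S n) m / INR (fact (S (S n))) * prod_sq c m / prod_sq (4 * c) (S (S (n + m)))
  * cert_poly c (INR n + 2) (INR m).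

Lemma sq_plus_pos (x c : R) : 0 < x -> 0 <= c -> 0 < x ^ 2 + c.
Proof. intros; nra. Qed.

Lemma prod_sq_S (c : R) (m : nat) :
  prod_sq c (S m) = prod_sq c m * ((INR m + 1) ^ 2 + c).
Proof. rewrite <- S_INR. reflexivity. Qed.

Lemma fact_S (n : nat) : INR (fact (S n)) = (INR n + 1) * INR (fact n).
Proof. rewrite fact_simpl, mult_INR, S_INR. reflexivity. Qed.

(** All terms are rational multiples of [falling k m / k! * prod_sq c m / prod_sq (4 * c) (S (k +
    m))]; after dividing by it a polynomial identity remains. *)
Lemma summand_rec (c : R) (k m : nat) : 0 <= c ->
  let n := INR k + 2 in
  (n ^ 2 + 4 * c) * (n ^ 2 + 9 * c) * summand c (S (S k)) m
  + (11 * n ^ 2 - 11 * n + 3 + 9 * c) * summand c (S k) m - summand c k m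
  = cert c k (S m) - cert c k m.
Proof.
  intros Hc n. unfold summand, cert.
  rewrite falling_S_S.
  replace (S (S k) + m)%nat with (S (S (k + m))) by lia.
  replace (S k + m)%nat with (S (k + m)) by lia.
  replace (k + S m)%nat with (S (k + m)) by lia.
  cbn [falling].
  rewrite !prod_sq_S, !fact_S, !S_INR, !plus_INR.
  pose proof (pos_INR k); pose proof (pos_INR m).
  pose proof (prod_sq_pos (4 * c) (k + m) ltac:(lra)).
  pose proof (INR_fact_lt_0 k).
  unfold cert_poly, n.
  field.
  repeat split; try apply Rgt_not_eq; try lra;
   apply Rlt_gt; repeat (apply Rplus_lt_le_0_compat || apply sq_plus_pos); try lra; try nra.
Qed.

(** The generic coefficient at [n = 1] would be [3 + 9 c]; with no term of index -1 available,
    [3 (1 - c)] is the one that telescopes. Here [w] does not vanish at infinity: it tends to 5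
    times the limit of [prod_sq c m / prod_sq (4 * c) m], whence [b(0) = 5]. *)
Lemma summand_rec_1 (c : R) (m : nat) : 0 <= c ->
  let w m := prod_sq c m / prod_sq (4 * c) (S m) * (5 * INR m ^ 2 + (7 - 12 * c) * INR m) in
  (1 + 4 * c) * (1 + 9 * c) * summand c 1 m + 3 * (1 - c) * summand c 0 m
  = w (S m) - w m.
Proof.
  intros Hc w. unfold summand, w. cbn [falling plus]. change (fact 0) with 1%nat. change (fact 1) with 1%nat.
  change (INR 0) with 0. change (INR 1) with 1. change (0 + m)%nat with m.
  rewrite !prod_sq_S, !S_INR.
  pose proof (pos_INR m).
  pose proof (prod_sq_pos (4 * c) m ltac:(lra)).
  field. repeat split; try apply Rgt_not_eq; try lra;
   apply Rlt_gt; nra.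
Qed.

Lemma summand_0 (c : R) (m : nat) : 0 <= c ->
  3 * c * summand c 0 m
  = prod_sq c m / prod_sq (4 * c) m - prod_sq c (S m) / prod_sq (4 * c) (S m).
Proof.
  intros Hc. unfold summand. cbn [falling plus]. change (fact 0) with 1%nat. change (INR 1) with 1.
  change (0 + m)%nat with m.
  rewrite !prod_sq_S.
  pose proof (pos_INR m).
  pose proof (prod_sq_pos (4 * c) m ltac:(lra)).
  field. repeat split; try apply Rgt_not_eq; try lra;
   apply Rlt_gt; nra.
Qed.

(** Factor by factor, [(m - k) (m + 1) <= (m + k + 1)^2 + c]. *)
Lemma falling_prod_sq_le (c : R) (n m : nat) : 0 <= c ->
  falling n m * (INR m + 1) ^ n * prod_sq c m <= prod_sq c (n + m).
Proof.
  intros Hc. induction n as [|n IH].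
  - cbn [falling pow]. change (0 + m)%nat with m. lra.
  - change (S n + m)%nat with (S (n + m)). rewrite prod_sq_S, plus_INR.
    cbn [falling pow].
    pose proof (prod_sq_pos c (n + m) Hc). pose proof (prod_sq_pos c m Hc).
    pose proof (pos_INR m). pose proof (pos_INR n).
    pose proof (falling_nonneg n m).
    assert (0 < (INR m + 1) ^ n) by (apply pow_lt; lra).
    destruct (Nat.lt_ge_cases m n) as [Hmn|Hmn].
    { rewrite falling_0 by exact Hmn.
      apply Rle_trans with 0; [right; ring | apply Rmult_le_pos; nra]. }
    apply le_INR in Hmn.
    apply Rle_trans with ((falling n m * (INR m + 1) ^ n * prod_sq c m)
                          * ((INR m - INR n) * (INR m + 1))); [right; ring|].
    apply Rmult_le_compat; [| nra | exact IH | nra].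
    repeat apply Rmult_le_pos; lra.
Qed.

Lemma prod_sq_le (c d : R) (m : nat) : 0 <= c -> c <= d -> prod_sq c m <= prod_sq d m.
Proof.
  intros Hc Hd. induction m as [|m IH]; [simpl; lra|].
  rewrite !prod_sq_S. pose proof (prod_sq_pos c m Hc). pose proof (pos_INR m).
  apply Rmult_le_compat; [lra | nra | exact IH | lra].
Qed.

(** Of the exponent [n + 2], [n] comes from [falling_prod_sq_le] and 2 from the last factor of the
    denominator. The bound serves twice: inverse squares make every series converge, and order
    [k + 1] gives the certificate a decay of at least power three. *)
Lemma falling_ratio_le (c : R) (n m : nat) : 0 <= c ->
  0 <= falling n m * prod_sq c m / prod_sq (4 * c) (S (n + m)) <= / (INR m + 1) ^ (n + 2).
Proof.
  intros Hc.
  pose proof (prod_sq_pos c m Hc). pose proof (falling_nonneg n m).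
  pose proof (prod_sq_pos (4 * c) (n + m) ltac:(lra)).
  pose proof (prod_sq_pos (4 * c) (S (n + m)) ltac:(lra)).
  pose proof (pos_INR m). pose proof (pos_INR n).
  pose proof (falling_prod_sq_le (4 * c) n m ltac:(lra)) as Hle.
  pose proof (prod_sq_le c (4 * c) m Hc ltac:(lra)) as Hle2.
  split.
  - apply Rmult_le_pos; [nra | left; apply Rinv_0_lt_compat; assumption].
  - assert (Hp : 0 < (INR m + 1) ^ n) by (apply pow_lt; lra).
    assert (Hp2 : 0 < (INR m + 1) ^ (n + 2)) by (apply pow_lt; lra).
    apply Rmult_le_reg_r with (prod_sq (4 * c) (S (n + m)) * (INR m + 1) ^ (n + 2));
      [apply Rmult_lt_0_compat; assumption|].
    field_simplify; [| lra | lra].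
    rewrite prod_sq_S, plus_INR, pow_add.
    apply Rle_trans with ((falling n m * (INR m + 1) ^ n * prod_sq (4 * c) m) * (INR m + 1) ^ 2).
    + replace (falling n m * prod_sq c m * ((INR m + 1) ^ n * (INR m + 1) ^ 2))
        with ((falling n m * (INR m + 1) ^ n) * (INR m + 1) ^ 2 * prod_sq c m) by ring.
      replace (falling n m * (INR m + 1) ^ n * prod_sq (4 * c) m * (INR m + 1) ^ 2)
        with ((falling n m * (INR m + 1) ^ n) * (INR m + 1) ^ 2 * prod_sq (4 * c) m) by ring.
      apply Rmult_le_compat_l; [| exact Hle2].
      repeat apply Rmult_le_pos; try lra; try nra.
    + apply Rmult_le_compat; [| nra | exact Hle | nra].
      pose proof (prod_sq_pos (4 * c) m ltac:(lra)).
      repeat apply Rmult_le_pos; lra.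
Qed.

Lemma INR_fact_ge_1 (n : nat) : 1 <= INR (fact n).
Proof. change 1 with (INR 1). apply le_INR, lt_O_fact. Qed.

Lemma summand_bounds (c : R) (n m : nat) : 0 <= c ->
  0 <= summand c n m <= / (INR m + 1) ^ 2.
Proof.
  intros Hc. unfold summand.
  pose proof (falling_ratio_le c n m Hc) as [H0 H1].
  pose proof (INR_fact_ge_1 n) as Hf. pose proof (pos_INR m).
  replace (falling n m / INR (fact n) * prod_sq c m / prod_sq (4 * c) (S (n + m)))
    with (falling n m * prod_sq c m / prod_sq (4 * c) (S (n + m)) * / INR (fact n)).
  2:{ pose proof (prod_sq_pos (4 * c) (S (n + m)) ltac:(lra)). field. split; lra. }
  assert (0 < / INR (fact n)) by (apply Rinv_0_lt_compat; lra).
  assert (/ INR (fact n) <= 1) by (rewrite <- Rinv_1; apply Rinv_le_contravar; lra).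
  split; [nra|].
  apply Rle_trans with (/ (INR m + 1) ^ (n + 2)); [nra|].
  apply Rinv_le_contravar; [nra|].
  apply Rle_pow; [lra | lia].
Qed.

Lemma is_lim_seq_O_inv (u : nat -> R) (l K : R) :
  (forall m, Rabs (u m - l) <= K / (INR m + 1)) -> is_lim_seq u l.
Proof.
  intros H.
  assert (Hz : is_lim_seq (fun m => K / (INR m + 1)) 0).
  { replace (Finite 0) with (Rbar_mult K 0) by (simpl; f_equal; ring).
    apply is_lim_seq_scal_l.
    apply is_lim_seq_ext with (fun m => / INR (S m)).
    - intros m. rewrite S_INR. reflexivity.
    - apply (is_lim_seq_incr_1 (fun m => / INR m)).
      replace (Finite 0) with (Rbar_inv p_infty) by reflexivity.
      apply is_lim_seq_inv; [apply is_lim_seq_INR | discriminate]. }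
  apply is_lim_seq_ext with (fun m => l + (u m - l)); [intros; ring|].
  replace (Finite l) with (Finite (l + 0)) by (f_equal; ring).
  apply is_lim_seq_plus'; [apply is_lim_seq_const|].
  apply is_lim_seq_abs_0.
  apply is_lim_seq_le_le with (fun _ => 0) (fun m => K / (INR m + 1)).
  - intros m. split; [apply Rabs_pos | apply H].
  - apply is_lim_seq_const.
  - exact Hz.
Qed.

Lemma sum_n_telescope (w : nat -> R) (n : nat) :
  sum_n (fun m => w (S m) - w m) n = w (S n) - w O.
Proof.
  induction n as [|n IH]; [rewrite sum_O; reflexivity|].
  rewrite sum_Sn, IH. unfold plus; simpl. ring.
Qed.

Lemma is_series_telescope (w : nat -> R) (l : R) :
  is_lim_seq w l -> is_series (fun m => w (S m) - w m) (l - w O).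
Proof.
  intros H. change (is_lim_seq (sum_n (fun m => w (S m) - w m)) (l - w O)).
  apply (is_lim_seq_ext (fun n => w (S n) - w O)).
  - intros n. symmetry. apply sum_n_telescope.
  - apply is_lim_seq_minus'; [| apply is_lim_seq_const].
    apply -> is_lim_seq_incr_1. exact H.
Qed.

Lemma ex_series_inv_sq : ex_series (fun m => / (INR m + 1) ^ 2).
Proof.
  apply (ex_series_le (fun m => / (INR m + 1) ^ 2)
          (fun m => 2 * ((- / (INR (S m) + 1)) - (- / (INR m + 1))))).
  - intros m. pose proof (pos_INR m).
    change (norm (/ (INR m + 1) ^ 2)) with (Rabs (/ (INR m + 1) ^ 2)).
    rewrite Rabs_pos_eq by (left; apply Rinv_0_lt_compat; nra).
    rewrite S_INR.
    apply Rmult_le_reg_r with ((INR m + 1) ^ 2 * (INR m + 1 + 1)); [nra|].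
    field_simplify; [nra | lra | lra].
  - apply (ex_series_scal 2 (fun m => (- / (INR (S m) + 1)) - (- / (INR m + 1)))).
    eexists. apply (is_series_telescope (fun m => - / (INR m + 1)) 0).
    apply is_lim_seq_O_inv with 1. intros m. pose proof (pos_INR m).
    rewrite Rminus_0_r, Rabs_Ropp, Rabs_pos_eq; [lra|].
    left; apply Rinv_0_lt_compat; lra.
Qed.

Lemma ex_series_summand (c : R) (n : nat) : 0 <= c -> ex_series (summand c n).
Proof.
  intros Hc. apply (ex_series_le (summand c n) (fun m => / (INR m + 1) ^ 2)).
  - intros m. destruct (summand_bounds c n m Hc) as [H0 H1].
    change (norm (summand c n m)) with (Rabs (summand c n m)).
    rewrite Rabs_pos_eq; assumption.
  - apply ex_series_inv_sq.
Qed.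

Definition remainder (c : R) (n : nat) : R := Series (summand c n).

Lemma is_series_remainder (c : R) (n : nat) : 0 <= c -> is_series (summand c n) (remainder c n).
Proof. intros Hc. apply Series_correct, ex_series_summand, Hc. Qed.

Lemma cert_0 (c : R) (k : nat) : cert c k 0 = 0.
Proof. unfold cert. rewrite falling_0 by lia. unfold Rdiv. ring. Qed.

(** A quadratic polynomial in [m] against a ratio of size at most [1 / (m + 1)^3]. *)
Lemma cert_lim (c : R) (k : nat) : 0 <= c -> is_lim_seq (cert c k) 0.
Proof.
  intros Hc.
  set (n := INR k + 2).
  (* The coefficients of [cert_poly] with every sign made positive. *)
  set (K := n + (6 * n ^ 2 + 5 * n + 12 * c) + (11 * n ^ 3 + 7 * n ^ 2 + (4 * n + 12) * c)).
  apply is_lim_seq_O_inv with K. intros m.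
  rewrite Rminus_0_r. unfold cert. fold n.
  pose proof (falling_ratio_le c (S k) m Hc) as [H0 H1].
  change (S k + m)%nat with (S (k + m)) in H0, H1.
  pose proof (INR_fact_ge_1 (S (S k))) as Hf. pose proof (pos_INR m). pose proof (pos_INR k).
  set (r := falling (S k) m * prod_sq c m / prod_sq (4 * c) (S (S (k + m)))) in *.
  replace (falling (S k) m / INR (fact (S (S k))) * prod_sq c m / prod_sq (4 * c) (S (S (k + m))))
    with (r * / INR (fact (S (S k)))).
  2:{ unfold r. pose proof (prod_sq_pos (4 * c) (S (S (k + m))) ltac:(lra)). field. split; lra. }
  assert (0 < / INR (fact (S (S k)))) by (apply Rinv_0_lt_compat; lra).
  assert (/ INR (fact (S (S k))) <= 1) by (rewrite <- Rinv_1; apply Rinv_le_contravar; lra).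
  assert (Hr : r <= / (INR m + 1) ^ 3).
  { apply Rle_trans with (1 := H1). apply Rinv_le_contravar; [nra|].
    apply Rle_pow; [lra|lia]. }
  assert (Hn : 2 <= n) by (unfold n; lra).
  assert (HK : Rabs (cert_poly c n (INR m)) <= K * (INR m + 1) ^ 2).
  { unfold cert_poly, K. set (x := INR m) in *.
    assert (0 <= n ^ 2) by nra. assert (0 <= n ^ 3) by (apply pow_le; lra).
    assert (0 <= n * c) by nra.
    set (A := 6 * n ^ 2 - 5 * n + 12 * c). set (A' := 6 * n ^ 2 + 5 * n + 12 * c).
    set (B := 11 * n ^ 3 - 7 * n ^ 2 + (4 * n + 12) * c).
    set (B' := 11 * n ^ 3 + 7 * n ^ 2 + (4 * n + 12) * c).
    assert (- A' <= A <= A') by (unfold A, A'; split; nra).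
    assert (- B' <= B <= B') by (unfold B, B'; split; nra).
    assert (0 <= A') by lra. assert (0 <= B') by lra.
    assert (x <= (x + 1) ^ 2) by nra. assert (1 <= (x + 1) ^ 2) by nra.
    assert (x ^ 2 <= (x + 1) ^ 2) by nra. assert (0 <= x ^ 2) by nra.
    set (y := (x + 1) ^ 2) in *.
    assert (n * x ^ 2 <= n * y) by nra. assert (0 <= n * x ^ 2) by nra.
    assert (HA : Rabs (A * x) <= A' * y).
    { apply Rabs_le. split; nra. }
    assert (HB : Rabs B <= B' * y) by (apply Rabs_le; split; nra).
    apply Rabs_le. apply Rabs_le_between in HA, HB. split; nra. }
  rewrite Rabs_mult, (Rabs_pos_eq (r * _)) by nra.
  apply Rle_trans with (/ (INR m + 1) ^ 3 * (K * (INR m + 1) ^ 2)).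
  - apply Rmult_le_compat; [nra | apply Rabs_pos | nra | exact HK].
  - right. field. lra.
Qed.

(** * Recurrences for the summed series *)

Lemma is_series_opp_R (u : nat -> R) (l : R) :
  is_series u l -> is_series (fun n => - u n) (- l).
Proof. intros H. apply (is_series_opp u l H). Qed.

Lemma remainder_rec (c : R) (k : nat) : 0 <= c ->
  let n := INR k + 2 in
  (n ^ 2 + 4 * c) * (n ^ 2 + 9 * c) * remainder c (S (S k))
  + (11 * n ^ 2 - 11 * n + 3 + 9 * c) * remainder c (S k) - remainder c k = 0.
Proof.
  intros Hc n.
  assert (H : is_series (fun m => cert c k (S m) - cert c k m)
     ((n ^ 2 + 4 * c) * (n ^ 2 + 9 * c) * remainder c (S (S k))
      + (11 * n ^ 2 - 11 * n + 3 + 9 * c) * remainder c (S k) - remainder c k)).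
  { eapply is_series_ext; [intros m; apply (summand_rec c k m Hc)|].
    apply (is_series_minus (fun m => (n ^ 2 + 4 * c) * (n ^ 2 + 9 * c) * summand c (S (S k)) m
            + (11 * n ^ 2 - 11 * n + 3 + 9 * c) * summand c (S k) m) (summand c k)).
    - apply (is_series_plus (fun m => (n ^ 2 + 4 * c) * (n ^ 2 + 9 * c) * summand c (S (S k)) m)
        (fun m => (11 * n ^ 2 - 11 * n + 3 + 9 * c) * summand c (S k) m)).
      + apply (is_series_scal _ (summand c (S (S k)))), is_series_remainder, Hc.
      + apply (is_series_scal _ (summand c (S k))), is_series_remainder, Hc.
    - apply is_series_remainder, Hc. }
  pose proof (is_series_telescope (cert c k) 0 (cert_lim c k Hc)) as H'.
  rewrite cert_0 in H'.
  apply is_series_unique in H. apply is_series_unique in H'. lra.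
Qed.

(** The limit [t] stays abstract, so that telescoping does not depend on the product for [sinh]; it
    is identified with [1 / cosh (PI z)] in [cosh_ratio_lim]. *)
Lemma remainder_rec_1 (c t : R) : 0 <= c ->
  is_lim_seq (fun m => prod_sq c m / prod_sq (4 * c) m) t ->
  (1 + 4 * c) * (1 + 9 * c) * remainder c 1 + 3 * (1 - c) * remainder c 0 = 5 * t.
Proof.
  intros Hc Ht.
  set (w := fun m => prod_sq c m / prod_sq (4 * c) (S m) * (5 * INR m ^ 2 + (7 - 12 * c) * INR m)).
  assert (H : is_series (fun m => w (S m) - w m)
     ((1 + 4 * c) * (1 + 9 * c) * remainder c 1 + 3 * (1 - c) * remainder c 0)).
  { eapply is_series_ext; [intros m; apply (summand_rec_1 c m Hc)|].
    apply (is_series_plus (fun m => (1 + 4 * c) * (1 + 9 * c) * summand c 1 m)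
        (fun m => 3 * (1 - c) * summand c 0 m)).
    - apply (is_series_scal _ (summand c 1)), is_series_remainder, Hc.
    - apply (is_series_scal _ (summand c 0)), is_series_remainder, Hc. }
  assert (Hw : is_lim_seq w (5 * t)).
  { apply is_lim_seq_ext with
      (fun m => ((5 * INR m ^ 2 + (7 - 12 * c) * INR m) / ((INR m + 1) ^ 2 + 4 * c))
                * (prod_sq c m / prod_sq (4 * c) m)).
    - intros m. unfold w. rewrite prod_sq_S. pose proof (pos_INR m).
      pose proof (prod_sq_pos (4 * c) m ltac:(lra)). field. split; nra.
    - apply is_lim_seq_mult'; [| exact Ht].
      apply is_lim_seq_O_inv with (8 + 32 * c). intros m. pose proof (pos_INR m).
      set (x := INR m) in *.
      replace ((5 * x ^ 2 + (7 - 12 * c) * x) / ((x + 1) ^ 2 + 4 * c) - 5)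
        with (- (((3 + 12 * c) * x + 5 + 20 * c) / ((x + 1) ^ 2 + 4 * c))) by (field; nra).
      assert (0 < (x + 1) ^ 2 + 4 * c) by nra.
      assert (0 <= c * x) by nra.
      rewrite Rabs_Ropp, Rabs_pos_eq
        by (apply Rmult_le_pos; [nra | left; apply Rinv_0_lt_compat; assumption]).
      apply Rmult_le_reg_r with (((x + 1) ^ 2 + 4 * c) * (x + 1)); [nra|].
      field_simplify; [nra | lra | nra]. }
  pose proof (is_series_telescope w (5 * t) Hw) as H'.
  assert (Hw0 : w O = 0) by (unfold w; simpl INR; ring).
  rewrite Hw0 in H'.
  apply is_series_unique in H. apply is_series_unique in H'. lra.
Qed.

Lemma remainder_0 (c t : R) : 0 <= c ->
  is_lim_seq (fun m => prod_sq c m / prod_sq (4 * c) m) t ->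
  3 * c * remainder c 0 = 1 - t.
Proof.
  intros Hc Ht.
  set (w := fun m => prod_sq c m / prod_sq (4 * c) m) in *.
  pose proof (is_series_opp_R _ _ (is_series_telescope w t Ht)) as H.
  assert (H' : is_series (fun m => - (w (S m) - w m)) (3 * c * remainder c 0)).
  { eapply is_series_ext;
      [| apply (is_series_scal (3 * c) (summand c 0)), is_series_remainder, Hc].
    intros m. change (3 * c * summand c 0 m = - (w (S m) - w m)).
    rewrite summand_0 by exact Hc. unfold w. ring. }
  apply is_series_unique in H. apply is_series_unique in H'.
  assert (Hw0 : w O = 1) by (unfold w; simpl; field).
  rewrite Hw0 in H. lra.
Qed.

(** * The product for sinh, Wallis and Stirling *)

Lemma exp_le (x y : R) : x <= y -> exp x <= exp y.
Proof. intros [H|H]; [left; apply exp_increasing, H | right; rewrite H; reflexivity]. Qed.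

(** For [y >= 0], applying [1 + u <= exp u] at [y], [-y] and [-2 y] gives
    [cosh y - 1 <= y sinh y <= y^2 exp y]; evenness does the rest. *)
Lemma cosh_1_le (x : R) : 0 <= cosh x - 1 <= x ^ 2 * exp (Rabs x).
Proof.
  assert (Hpos : forall y, 0 <= y -> 0 <= cosh y - 1 <= y ^ 2 * exp y).
  { intros y Hy. unfold cosh.
    pose proof (exp_ineq1_le y) as H1. pose proof (exp_ineq1_le (- y)) as H2.
    pose proof (exp_ineq1_le (- (2 * y))) as H3.
    pose proof (exp_pos y) as P1. pose proof (exp_pos (- y)) as P2.
    assert (E1 : exp y * exp (- y) = 1) by (rewrite <- exp_plus, <- exp_0; f_equal; ring).
    assert (E3 : exp (- (2 * y)) = exp (- y) * exp (- y))
      by (rewrite <- exp_plus; f_equal; ring).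
    split; [lra|].
    assert (F1 : exp y - 1 <= y * exp y) by nra.
    assert (F2 : exp (- y) - 1 <= - (y * exp (- y))) by nra.
    assert (F3 : exp y - exp (- y) <= 2 * y * exp y).
    { rewrite E3 in H3.
      assert (exp y * (1 - 2 * y) <= exp y * (exp (- y) * exp (- y)))
        by (apply Rmult_le_compat_l; lra).
      replace (exp y * (exp (- y) * exp (- y))) with ((exp y * exp (- y)) * exp (- y)) in H by ring.
      rewrite E1 in H. lra. }
    nra. }
  destruct (Rle_dec 0 x) as [H|H].
  - rewrite Rabs_pos_eq by exact H. apply Hpos, H.
  - rewrite Rabs_left by lra.
    replace (cosh x) with (cosh (- x)) by (unfold cosh; rewrite Ropp_involutive; lra).
    replace (x ^ 2) with ((- x) ^ 2) by ring. apply Hpos. lra.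
Qed.

Lemma x_cos_le_sin (x : R) : 0 <= x <= PI / 2 -> x * cos x <= sin x.
Proof.
  intros [H0 H1]. pose proof PI_RGT_0.
  destruct (MVT_gen (fun t => sin t - t * cos t) 0 x (fun t => t * sin t)) as [c [Hc E]].
  - intros t _. auto_derive; [exact I | ring].
  - intros t _. apply continuity_pt_filterlim, (ex_derive_continuous (fun t => sin t - t * cos t)).
    auto_derive; exact I.
  - rewrite Rmin_left, Rmax_right in Hc by lra.
    rewrite sin_0 in E.
    assert (0 <= sin c) by (apply sin_ge_0; lra).
    assert (0 <= c * sin c * (x - 0)) by (repeat apply Rmult_le_pos; lra). lra.
Qed.

(** * Cosine integrals and Euler's product for sinh *)

Definition wint (z : R) (n : nat) : R :=
  RInt (fun t => cosh (2 * z * t) * cos t ^ n) 0 (PI / 2).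

Lemma wint_continuous (z : R) (n : nat) (t : R) :
  continuous (fun t => cosh (2 * z * t) * cos t ^ n) t.
Proof.
  apply (ex_derive_continuous (fun t => cosh (2 * z * t) * cos t ^ n)).
  unfold cosh. auto_derive. exact I.
Qed.

Lemma is_RInt_wint (z : R) (n : nat) :
  is_RInt (fun t => cosh (2 * z * t) * cos t ^ n) 0 (PI / 2) (wint z n).
Proof.
  apply (RInt_correct (fun t => cosh (2 * z * t) * cos t ^ n)).
  apply (ex_RInt_continuous (fun t => cosh (2 * z * t) * cos t ^ n)).
  intros t _. apply wint_continuous.
Qed.

(** Two integrations by parts, packed into the antiderivative [F]. Its boundary values vanish
    because [cos (PI / 2)], [sin 0] and [sinh 0] do. *)
Lemma wint_rec (z : R) (n : nat) :
  ((INR n + 2) ^ 2 + 4 * z ^ 2) * wint z (S (S n)) = (INR n + 2) * (INR n + 1) * wint z n.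
Proof.
  set (F := fun t => (INR n + 2) * cosh (2 * z * t) * cos t ^ (S n) * sin t
                     + 2 * z * sinh (2 * z * t) * cos t ^ (S (S n))).
  assert (H1 : is_RInt (fun t => ((INR n + 2) ^ 2 + 4 * z ^ 2) * (cosh (2 * z * t) * cos t ^ (S (S n)))
                     - (INR n + 2) * (INR n + 1) * (cosh (2 * z * t) * cos t ^ n)) 0 (PI / 2)
                 (F (PI / 2) - F 0)).
  { apply (is_RInt_derive F).
    - intros t _. unfold F, cosh, sinh. auto_derive; [exact I|].
      assert (Hs : sin t * sin t = 1 - cos t * cos t)
        by (pose proof (sin2_cos2 t) as E; unfold Rsqr in E; lra).
      replace (match n with O => 1 | S _ => INR n + 1 end) with (INR n + 1)
        by (destruct n; simpl; ring).
      change (Init.Nat.pred (S n)) with n. change (Init.Nat.pred (S (S n))) with (S n).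
      cbn [pow].
      set (C := cos t) in *. set (S' := sin t) in *.
      transitivity ((INR n + 2) * C * C ^ n * S' * (2 * z * (exp (2 * z * t) - exp (- (2 * z * t))) / 2)
        - (INR n + 2) * (INR n + 1) * C ^ n * (S' * S') * ((exp (2 * z * t) + exp (- (2 * z * t))) / 2)
        + ((INR n + 2) + 4 * z ^ 2) * C * C * C ^ n * ((exp (2 * z * t) + exp (- (2 * z * t))) / 2)
        - 2 * z * (INR n + 2) * C * C ^ n * S' * ((exp (2 * z * t) - exp (- (2 * z * t))) / 2)).
      + field.
      + rewrite Hs. field.
    - intros t _.
      apply (continuous_minus (V := R_NormedModule)
        (fun t => ((INR n + 2) ^ 2 + 4 * z ^ 2) * (cosh (2 * z * t) * cos t ^ (S (S n))))
        (fun t => (INR n + 2) * (INR n + 1) * (cosh (2 * z * t) * cos t ^ n)));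
        apply (continuous_scal_r (V := R_NormedModule) _ (fun t => cosh (2 * z * t) * _));
        apply wint_continuous. }
  assert (H2 := is_RInt_minus (V := R_NormedModule) _ _ _ _ _ _
    (is_RInt_scal (V := R_NormedModule) _ _ _ ((INR n + 2) ^ 2 + 4 * z ^ 2) _ (is_RInt_wint z (S (S n))))
    (is_RInt_scal (V := R_NormedModule) _ _ _ ((INR n + 2) * (INR n + 1)) _ (is_RInt_wint z n))).
  apply (is_RInt_unique (V := R_CompleteNormedModule)) in H1.
  apply (is_RInt_unique (V := R_CompleteNormedModule)) in H2.
  assert (E : F (PI / 2) - F 0 = 0).
  { unfold F. rewrite cos_PI2, sin_0. replace (2 * z * 0) with 0 by ring. rewrite sinh_0.
    simpl pow. ring. }
  rewrite E in H1.
  change (RInt (fun t => ((INR n + 2) ^ 2 + 4 * z ^ 2) * (cosh (2 * z * t) * cos t ^ (S (S n)))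
    - (INR n + 2) * (INR n + 1) * (cosh (2 * z * t) * cos t ^ n)) 0 (PI / 2) =
    ((INR n + 2) ^ 2 + 4 * z ^ 2) * wint z (S (S n)) - (INR n + 2) * (INR n + 1) * wint z n) in H2.
  lra.
Qed.

Lemma wint_0 (z : R) : z <> 0 -> wint z 0 = sinh (PI * z) / (2 * z).
Proof.
  intros Hz. unfold wint.
  rewrite (RInt_ext _ (fun t => cosh (2 * z * t))) by (intros; simpl; ring).
  apply is_RInt_unique.
  replace (sinh (PI * z) / (2 * z))
    with (sinh (2 * z * (PI / 2)) / (2 * z) - sinh (2 * z * 0) / (2 * z)).
  2:{ rewrite Rmult_0_r, sinh_0. replace (2 * z * (PI / 2)) with (PI * z) by field. field. exact Hz. }
  apply (is_RInt_derive (fun t => sinh (2 * z * t) / (2 * z))).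
  - intros t _. unfold sinh, cosh. auto_derive; [exact I | field; exact Hz].
  - intros t _. apply (ex_derive_continuous (fun t => cosh (2 * z * t))). unfold cosh. auto_derive. exact I.
Qed.

Lemma wint_0_0 : wint 0 0 = PI / 2.
Proof.
  unfold wint. rewrite (RInt_ext _ (fun _ => 1)).
  - rewrite RInt_const. unfold scal; simpl; unfold mult; simpl. field.
  - intros. rewrite Rmult_0_r, Rmult_0_l, cosh_0. simpl. ring.
Qed.

Lemma wint_0_1 : wint 0 1 = 1.
Proof.
  assert (H : is_RInt (fun t => cosh (2 * 0 * t) * cos t ^ 1) 0 (PI / 2) (sin (PI / 2) - sin 0)).
  { apply (is_RInt_derive sin).
    - intros t _. rewrite Rmult_0_r, Rmult_0_l, cosh_0. auto_derive; [exact I | ring].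
    - intros t _. apply wint_continuous. }
  rewrite sin_PI2, sin_0, Rminus_0_r in H. apply is_RInt_unique, H.
Qed.

Lemma wint_le (z y : R) (n m : nat) :
  (forall t, 0 < t < PI / 2 -> cosh (2 * z * t) * cos t ^ n <= cosh (2 * y * t) * cos t ^ m) ->
  wint z n <= wint y m.
Proof.
  intros H. pose proof PI_RGT_0.
  refine (is_RInt_le _ _ _ _ _ _ _ (is_RInt_wint z n) (is_RInt_wint y m) _); [lra | exact H].
Qed.

Lemma wint_even (z : R) (m : nat) :
  wint z (2 * m) * prod_sq (z ^ 2) m * 4 ^ m = wint z 0 * INR (fact (2 * m)).
Proof.
  induction m as [|m IH].
  - change (2 * 0)%nat with 0%nat. cbn [prod_sq pow]. change (INR (fact 0)) with 1. ring.
  - replace (2 * S m)%nat with (S (S (2 * m))) by lia.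
    pose proof (wint_rec z (2 * m)) as E.
    rewrite mult_INR in E. change (INR 2) with 2 in E.
    rewrite !fact_S, prod_sq_S, S_INR, mult_INR. change (INR 2) with 2.
    change (4 ^ S m) with (4 * 4 ^ m).
    replace (wint z (S (S (2 * m))) * (prod_sq (z ^ 2) m * ((INR m + 1) ^ 2 + z ^ 2)) * (4 * 4 ^ m))
      with (((2 * INR m + 2) ^ 2 + 4 * z ^ 2) * wint z (S (S (2 * m))) * (prod_sq (z ^ 2) m * 4 ^ m)) by ring.
    rewrite E.
    replace (wint z 0 * ((2 * INR m + 1 + 1) * ((2 * INR m + 1) * INR (fact (2 * m)))))
      with ((2 * INR m + 1 + 1) * (2 * INR m + 1) * (wint z 0 * INR (fact (2 * m)))) by ring.
    rewrite <- IH. ring.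
Qed.

Lemma prod_sq_0 (m : nat) : prod_sq 0 m = INR (fact m) ^ 2.
Proof.
  induction m as [|m IH]; [simpl; ring|]. rewrite prod_sq_S, IH, fact_S. ring.
Qed.

Lemma wint_pos (z : R) (m : nat) : 0 < wint 0 (2 * m) <= wint z (2 * m).
Proof.
  pose proof PI_RGT_0. split.
  - pose proof (wint_even 0 m) as E. rewrite wint_0_0 in E.
    pose proof (INR_fact_lt_0 (2 * m)).
    assert (0 < prod_sq (0 ^ 2) m * 4 ^ m)
      by (apply Rmult_lt_0_compat; [apply prod_sq_pos; simpl; lra | apply pow_lt; lra]).
    destruct (Rle_dec (wint 0 (2 * m)) 0) as [Hn|Hn]; [exfalso; nra | lra].
  - apply wint_le. intros t Ht. rewrite Rmult_0_r, Rmult_0_l, cosh_0.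
    apply Rmult_le_compat_r.
    + apply pow_le, cos_ge_0; lra.
    + pose proof (cosh_1_le (2 * z * t)). lra.
Qed.

(** The weight [cos t ^ n] concentrates at [t = 0], where [cosh] is 1. Quantitatively
    [cosh (2 z t) - 1 <= K t^2], and [t cos t <= sin t] turns [t^2 cos^(n+2)] into at most
    [cos^n - cos^(n+2)]; by the recurrence that difference of integrals is smaller than the integral
    by a factor of order [1 / n]. *)
Lemma wint_ratio (z : R) :
  is_lim_seq (fun m => wint z (2 * m) / wint 0 (2 * m)) 1.
Proof.
  pose proof PI_RGT_0.
  (* From [(2 z t)^2 exp |2 z t|] with [t <= PI / 2]. *)
  set (K := 4 * z ^ 2 * exp (PI * Rabs z)).
  apply is_lim_seq_incr_1.
  apply is_lim_seq_O_inv with K. intros m.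
  replace (2 * S m)%nat with (S (S (2 * m))) by lia.
  set (n := (2 * m)%nat).
  assert (HJ : 0 < wint 0 (S (S n)) <= wint z (S (S n))).
  { pose proof (wint_pos z (S m)) as Hp. replace (2 * S m)%nat with (S (S n)) in Hp by (unfold n; lia). exact Hp. }
  assert (Hup : wint z (S (S n)) - wint 0 (S (S n)) <= K * (wint 0 n - wint 0 (S (S n)))).
  { assert (H1 := is_RInt_minus (V := R_NormedModule) _ _ _ _ _ _ (is_RInt_wint z (S (S n))) (is_RInt_wint 0 (S (S n)))).
    assert (H2 := is_RInt_scal (V := R_NormedModule) _ _ _ K _
      (is_RInt_minus (V := R_NormedModule) _ _ _ _ _ _ (is_RInt_wint 0 n) (is_RInt_wint 0 (S (S n))))).
    refine (is_RInt_le _ _ _ _ _ _ _ H1 H2 _); [lra|].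
    intros t Ht.
    change (cosh (2 * z * t) * cos t ^ (S (S n)) - cosh (2 * 0 * t) * cos t ^ (S (S n))
      <= K * (cosh (2 * 0 * t) * cos t ^ n - cosh (2 * 0 * t) * cos t ^ (S (S n)))).
    rewrite !Rmult_0_r, !Rmult_0_l, cosh_0.
    assert (Hc : 0 <= cos t ^ n) by (apply pow_le, cos_ge_0; lra).
    assert (Hc1 : 0 <= cos t) by (apply cos_ge_0; lra).
    pose proof (x_cos_le_sin t ltac:(lra)) as Htc.
    assert (Hs2 : sin t * sin t = 1 - cos t * cos t)
      by (pose proof (sin2_cos2 t) as E; unfold Rsqr in E; lra).
    destruct (cosh_1_le (2 * z * t)) as [_ Hk].
    assert (Hk2 : cosh (2 * z * t) - 1 <= K * t ^ 2).
    { apply Rle_trans with (1 := Hk).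
      replace ((2 * z * t) ^ 2) with (4 * z ^ 2 * t ^ 2) by ring.
      unfold K. replace (4 * z ^ 2 * exp (PI * Rabs z) * t ^ 2) with (4 * z ^ 2 * t ^ 2 * exp (PI * Rabs z)) by ring.
      apply Rmult_le_compat_l; [nra|].
      apply exp_le. rewrite !Rabs_mult, (Rabs_pos_eq 2), (Rabs_pos_eq t) by lra.
      pose proof (Rabs_pos z). nra. }
    assert (HK : 0 <= K) by (unfold K; pose proof (exp_pos (PI * Rabs z)); nra).
    cbn [pow].
    replace (cosh (2 * z * t) * (cos t * (cos t * cos t ^ n)) - 1 * (cos t * (cos t * cos t ^ n)))
      with ((cosh (2 * z * t) - 1) * (cos t * (cos t * cos t ^ n))) by ring.
    apply Rle_trans with ((K * t ^ 2) * (cos t * (cos t * cos t ^ n))).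
    - apply Rmult_le_compat_r; [repeat apply Rmult_le_pos; assumption | exact Hk2].
    - replace ((K * t ^ 2) * (cos t * (cos t * cos t ^ n))) with (K * cos t ^ n * ((t * cos t) * (t * cos t))) by ring.
      replace (K * (1 * cos t ^ n - 1 * (cos t * (cos t * cos t ^ n))))
        with (K * cos t ^ n * (sin t * sin t)) by (rewrite Hs2; ring).
      apply Rmult_le_compat_l; [nra|].
      apply Rmult_le_compat; nra. }
  pose proof (wint_rec 0 n) as Hr.
  pose proof (pos_INR m). assert (Hn : INR n = 2 * INR m) by (unfold n; rewrite mult_INR; reflexivity).
  assert (HK : 0 <= K) by (unfold K; pose proof (exp_pos (PI * Rabs z)); nra).
  set (J := wint 0 (S (S n))) in *. set (I := wint z (S (S n))) in *. set (J0 := wint 0 n) in *.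
  assert (Hr' : J0 * (INR n + 1) = (INR n + 2) * J).
  { apply Rmult_eq_reg_l with (INR n + 2); [|lra]. lra. }
  replace (I / J - 1) with ((I - J) / J) by (field; lra).
  rewrite Rabs_pos_eq by (apply Rmult_le_pos; [lra | left; apply Rinv_0_lt_compat; lra]).
  apply Rmult_le_reg_r with (J * (INR m + 1) * (INR n + 1));
    [repeat apply Rmult_lt_0_compat; lra|].
  replace ((I - J) / J * (J * (INR m + 1) * (INR n + 1))) with ((I - J) * (INR n + 1) * (INR m + 1)) by (field; lra).
  replace (K / (INR m + 1) * (J * (INR m + 1) * (INR n + 1))) with (K * J * (INR n + 1)) by (field; lra).
  apply Rle_trans with (K * J * (INR m + 1)).
  - apply Rmult_le_compat_r; [lra|].
    apply Rle_trans with (K * (J0 - J) * (INR n + 1)); [apply Rmult_le_compat_r; lra|].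
    right. replace (K * (J0 - J) * (INR n + 1)) with (K * (J0 * (INR n + 1)) - K * J * (INR n + 1)) by ring.
    rewrite Hr'. ring.
  - apply Rmult_le_compat_l; [apply Rmult_le_pos; lra | lra].
Qed.

Lemma is_lim_seq_inv_R (u : nat -> R) (l : R) :
  l <> 0 -> is_lim_seq u l -> is_lim_seq (fun n => / u n) (/ l).
Proof. intros Hl H. apply (is_lim_seq_inv u l H). intros E. injection E. exact Hl. Qed.

(** Dividing [wint_even] at [z] by [wint_even] at 0 cancels [4^m] and [(2m)!]; what remains is
    [wint z 0 / wint 0 0] times a ratio that tends to 1. *)
Lemma sinh_prod (z : R) : z <> 0 ->
  is_lim_seq (fun m => prod_sq (z ^ 2) m / INR (fact m) ^ 2) (sinh (PI * z) / (PI * z)).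
Proof.
  intros Hz. pose proof PI_RGT_0 as HPI.
  assert (H := is_lim_seq_mult' _ _ _ _ (is_lim_seq_const (sinh (PI * z) / (PI * z)))
    (is_lim_seq_inv_R _ _ R1_neq_R0 (wint_ratio z))).
  rewrite Rinv_1, Rmult_1_r in H.
  apply is_lim_seq_ext with (2 := H). intros m.
  pose proof (wint_pos z m) as [H1 H2].
  pose proof (wint_even z m) as E. pose proof (wint_even 0 m) as E0.
  rewrite wint_0_0 in E0. rewrite (wint_0 z Hz) in E.
  replace (0 ^ 2) with 0 in E0 by ring. rewrite prod_sq_0 in E0.
  pose proof (INR_fact_lt_0 m). pose proof (INR_fact_lt_0 (2 * m)).
  assert (H4 : 0 < 4 ^ m) by (apply pow_lt; lra).
  assert (Hp : 0 < prod_sq (z ^ 2) m) by (apply prod_sq_pos; nra).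
  set (I := wint z (2 * m)) in *. set (J := wint 0 (2 * m)) in *.
  set (f := INR (fact m)) in *. set (g := INR (fact (2 * m))) in *. set (p := prod_sq (z ^ 2) m) in *.
  replace J with (PI / 2 * g / (f ^ 2 * 4 ^ m)) by (rewrite <- E0; field; split; lra).
  replace I with (sinh (PI * z) / (2 * z) * g / (p * 4 ^ m)) by (rewrite <- E; field; split; lra).
  assert (Hsh : sinh (PI * z) <> 0).
  { intros Es. rewrite Es in E. assert (I * p * 4 ^ m > 0) by (repeat apply Rmult_lt_0_compat; lra).
    unfold Rdiv in E. rewrite !Rmult_0_l in E. lra. }
  field. repeat split; try lra; assumption.
Qed.

(** * Wallis' formula *)

Definition central (m : nat) : R := 4 ^ m * INR (fact m) ^ 2 / INR (fact (2 * m)).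

Lemma central_wint (m : nat) : central m * wint 0 (2 * m) = PI / 2.
Proof.
  pose proof (wint_even 0 m) as E. rewrite wint_0_0 in E.
  replace (0 ^ 2) with 0 in E by ring. rewrite prod_sq_0 in E.
  unfold central. pose proof (INR_fact_lt_0 (2 * m)).
  apply Rmult_eq_reg_r with (INR (fact (2 * m))); [|lra].
  rewrite <- E. field. lra.
Qed.

Lemma wint_prod (n : nat) : (INR n + 1) * wint 0 n * wint 0 (S n) = PI / 2.
Proof.
  induction n as [|n IH].
  - rewrite wint_0_0, wint_0_1. change (INR 0) with 0. ring.
  - rewrite <- IH, S_INR. pose proof (wint_rec 0 n) as E. pose proof (pos_INR n).
    assert (E' : (INR n + 2) * wint 0 (S (S n)) = (INR n + 1) * wint 0 n).
    { apply Rmult_eq_reg_l with (INR n + 2); [|lra]. lra. }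
    replace ((INR n + 1 + 1) * wint 0 (S n) * wint 0 (S (S n)))
      with ((INR n + 2) * wint 0 (S (S n)) * wint 0 (S n)) by ring.
    rewrite E'. ring.
Qed.

Lemma wint_decr (n : nat) : wint 0 (S n) <= wint 0 n.
Proof.
  apply wint_le. intros t Ht. rewrite Rmult_0_r, Rmult_0_l, cosh_0. cbn [pow].
  assert (0 <= cos t ^ n) by (apply pow_le, cos_ge_0; lra).
  pose proof (COS_bound t). nra.
Qed.

(** With [J = wint 0 (2 m)] one has [central m = (PI / 2) / J]. Monotonicity in the exponent,
    applied to the invariant [wint_prod], squeezes [(2m+1) J^2] between [PI / 2] and
    [PI / 2 * (2m+2) / (2m+1)]. *)
Lemma wallis : is_lim_seq (fun m => central m ^ 2 / INR m) PI.
Proof.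
  pose proof PI_RGT_0 as HPI.
  assert (H : is_lim_seq (fun m => central m ^ 2 / (INR (2 * m) + 1)) (PI / 2)).
  { apply is_lim_seq_O_inv with (PI / 2). intros m.
    pose proof (wint_pos 0 m) as [Hp _].
    pose proof (wint_prod (2 * m)) as E1. pose proof (wint_decr (2 * m)) as D1.
    pose proof (wint_decr (S (2 * m))) as D2.
    pose proof (wint_rec 0 (2 * m)) as R1. pose proof (central_wint m) as Ec.
    rewrite mult_INR in *. change (INR 2) with 2 in *. pose proof (pos_INR m).
    set (J := wint 0 (2 * m)) in *. set (J1 := wint 0 (S (2 * m))) in *.
    set (J2 := wint 0 (S (S (2 * m)))) in *. set (x := INR m) in *.
    assert (R2 : (2 * x + 2) * J2 = (2 * x + 1) * J).
    { apply Rmult_eq_reg_l with (2 * x + 2); [|lra]. lra. }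
    assert (L1 : PI / 2 <= (2 * x + 1) * J ^ 2).
    { rewrite <- E1. replace ((2 * x + 1) * J ^ 2) with ((2 * x + 1) * J * J) by ring.
      apply Rmult_le_compat_l; [nra | exact D1]. }
    assert (L2 : (2 * x + 1) ^ 2 * J ^ 2 <= PI / 2 * (2 * x + 2)).
    { apply Rle_trans with ((2 * x + 1) * J * ((2 * x + 2) * J2)); [right; rewrite R2; ring|].
      rewrite <- E1.
      replace ((2 * x + 1) * J * J1 * (2 * x + 2)) with ((2 * x + 1) * J * ((2 * x + 2) * J1)) by ring.
      apply Rmult_le_compat_l; [nra|]. apply Rmult_le_compat_l; lra. }
    replace (central m) with (PI / 2 / J) by (rewrite <- Ec; field; lra).
    set (A := (2 * x + 1) * J ^ 2) in *.
    assert (HA : 0 < A) by (unfold A; apply Rmult_lt_0_compat; nra).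
    replace ((PI / 2 / J) ^ 2 / (2 * x + 1) - PI / 2) with (- (PI / 2 * ((A - PI / 2) / A)))
      by (unfold A; field; split; lra).
    assert (HA2 : (A - PI / 2) * (x + 1) <= A).
    { apply Rmult_le_reg_r with (2 * x + 1); [lra|].
      assert (A * (2 * x + 1) <= PI / 2 * (2 * x + 2)) by (unfold A; lra). nra. }
    rewrite Rabs_Ropp, Rabs_mult, (Rabs_pos_eq (PI / 2)) by lra.
    rewrite Rabs_pos_eq by (apply Rmult_le_pos; [lra | left; apply Rinv_0_lt_compat, HA]).
    apply Rmult_le_compat_l; [lra|].
    apply Rmult_le_reg_r with (A * (x + 1)); [nra|].
    field_simplify; nra. }
  (* Exchanges the denominator [2m + 1] for [m], since [(2m + 1) / m = 2 + 1 / m]. *)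
  assert (H2 : is_lim_seq (fun m => 2 + / INR (S m)) 2).
  { apply is_lim_seq_O_inv with 1. intros m. pose proof (pos_INR m). rewrite S_INR.
    replace (2 + / (INR m + 1) - 2) with (1 / (INR m + 1)) by (field; lra).
    rewrite Rabs_pos_eq; [lra|]. apply Rmult_le_pos; [lra | left; apply Rinv_0_lt_compat; lra]. }
  apply is_lim_seq_incr_1 in H. apply is_lim_seq_incr_1.
  replace PI with (PI / 2 * 2) by field.
  apply is_lim_seq_ext with (2 := is_lim_seq_mult' _ _ _ _ H H2).
  intros m. rewrite mult_INR. change (INR 2) with 2. rewrite S_INR. pose proof (pos_INR m). field. split; lra.
Qed.

Lemma central_pos (m : nat) : 0 < central m.
Proof.
  unfold central. pose proof (INR_fact_lt_0 m). pose proof (INR_fact_lt_0 (2 * m)).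
  apply Rdiv_lt_0_compat; [|assumption].
  apply Rmult_lt_0_compat; [apply pow_lt; lra | apply pow_lt; assumption].
Qed.

Lemma central_sqrt : is_lim_seq (fun m => central m / sqrt (INR m)) (sqrt PI).
Proof.
  apply is_lim_seq_incr_1.
  apply is_lim_seq_ext with (fun m => sqrt (central (S m) ^ 2 / INR (S m))).
  - intros m. pose proof (central_pos (S m)).
    rewrite sqrt_div_alt by (apply lt_0_INR; lia). rewrite sqrt_pow2 by lra. reflexivity.
  - apply (is_lim_seq_continuous sqrt (fun m => central (S m) ^ 2 / INR (S m)) PI).
    + apply continuity_pt_sqrt. pose proof PI_RGT_0; lra.
    + apply -> (is_lim_seq_incr_1 (fun m => central m ^ 2 / INR m)). apply wallis.
Qed.

(** * Stirling's formula *)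

Lemma ln_half_step (x : R) : 0 < x ->
  0 <= (/ x + 1 / 2) * ln (1 + x) - 1 <= x ^ 2 / (4 * (1 + x)).
Proof.
  intros Hx.
  (* This Padé bound and the upper bound [H2] both compare derivatives whose difference is a square
     times a positive factor. *)
  assert (H1 : 2 * x / (2 + x) <= ln (1 + x)).
  { destruct (MVT_gen (fun t => ln (1 + t) - 2 * t / (2 + t)) 0 x
      (fun t => t ^ 2 / ((1 + t) * (2 + t) ^ 2))) as [c [Hc E]].
    - intros t Ht. rewrite Rmin_left, Rmax_right in Ht by lra.
      auto_derive; [repeat split; lra | field; lra].
    - intros t Ht. rewrite Rmin_left, Rmax_right in Ht by lra.
      apply continuity_pt_filterlim, (ex_derive_continuous (fun t => ln (1 + t) - 2 * t / (2 + t))).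
      auto_derive; repeat split; lra.
    - rewrite Rmin_left, Rmax_right in Hc by lra.
      rewrite Rplus_0_r, ln_1 in E. replace (2 * 0 / (2 + 0)) with 0 in E by field.
      assert (0 <= c ^ 2 / ((1 + c) * (2 + c) ^ 2) * (x - 0)).
      { apply Rmult_le_pos; [|lra]. apply Rmult_le_pos; [nra|].
        left; apply Rinv_0_lt_compat. nra. }
      lra. }
  assert (H2 : ln (1 + x) <= ((1 + x) - / (1 + x)) / 2).
  { destruct (MVT_gen (fun t => ((1 + t) - / (1 + t)) / 2 - ln (1 + t)) 0 x
      (fun t => (1 - / (1 + t)) ^ 2 / 2)) as [c [Hc E]].
    - intros t Ht. rewrite Rmin_left, Rmax_right in Ht by lra.
      auto_derive; [repeat split; lra | field; lra].
    - intros t Ht. rewrite Rmin_left, Rmax_right in Ht by lra.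
      apply continuity_pt_filterlim, (ex_derive_continuous (fun t => ((1 + t) - / (1 + t)) / 2 - ln (1 + t))).
      auto_derive; repeat split; lra.
    - rewrite Rplus_0_r, ln_1, Rinv_1 in E.
      pose proof (pow2_ge_0 (1 - / (1 + c))).
      assert (0 <= (1 - / (1 + c)) ^ 2 / 2 * (x - 0)) by (apply Rmult_le_pos; lra). lra. }
  assert (Hix : 0 < / x) by (apply Rinv_0_lt_compat; lra).
  split.
  - apply Rmult_le_compat_l with (r := / x + 1 / 2) in H1; [|lra].
    replace ((/ x + 1 / 2) * (2 * x / (2 + x))) with 1 in H1 by (field; lra). lra.
  - apply Rmult_le_compat_l with (r := / x + 1 / 2) in H2; [|lra].
    replace ((/ x + 1 / 2) * ((1 + x - / (1 + x)) / 2)) with (1 + x ^ 2 / (4 * (1 + x))) in H2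
      by (field; lra). lra.
Qed.

(** [n! / (sqrt n (n/e)^n)], with the power written as an exponential so that the exponents of
    several factorials can be added in [scaled_summand_eq]. *)
Definition stirling_ratio (n : nat) : R :=
  INR (fact n) / (sqrt (INR n) * exp (INR n * ln (INR n) - INR n)).

Lemma stirling_ratio_exp (n : nat) : (0 < n)%nat ->
  stirling_ratio n = exp (ln (INR (fact n)) - (INR n + 1 / 2) * ln (INR n) + INR n).
Proof.
  intros Hn. unfold stirling_ratio. apply lt_0_INR in Hn.
  rewrite <- (exp_ln (INR (fact n))) at 1 by apply INR_fact_lt_0.
  replace (sqrt (INR n)) with (exp (1 / 2 * ln (INR n))).
  2:{ rewrite <- (sqrt_pow2 (exp (1 / 2 * ln (INR n)))) by (left; apply exp_pos).
      f_equal. cbn [pow]. rewrite Rmult_1_r, <- exp_plus.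
      replace (1 / 2 * ln (INR n) + 1 / 2 * ln (INR n)) with (ln (INR n)) by field.
      apply exp_ln, Hn. }
  rewrite <- exp_plus. unfold Rdiv. rewrite <- exp_Ropp, <- exp_plus. f_equal. ring.
Qed.

(** At [x = 1 / (n + 1)] the bound of [ln_half_step] is [1 / (4 (n+1)) - 1 / (4 (n+2))]. So the
    logarithm [d] decreases while [d n - 1 / (4 (n+1))] increases, and [d] has a finite limit; the
    index is shifted to avoid [ln 0]. *)
Lemma stirling_ratio_cv : exists s, 0 < s /\ is_lim_seq stirling_ratio s.
Proof.
  set (d := fun n => ln (INR (fact (S n))) - (INR (S n) + 1 / 2) * ln (INR (S n)) + INR (S n)).
  assert (Hd : forall n, 0 <= d n - d (S n) <= / (4 * (INR n + 1)) - / (4 * (INR n + 2))).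
  { intros n. unfold d. rewrite (fact_S (S n)).
    pose proof (INR_fact_lt_0 (S n)). pose proof (pos_INR n). rewrite !S_INR.
    rewrite ln_mult by lra.
    pose proof (ln_half_step (/ (INR n + 1)) ltac:(apply Rinv_0_lt_compat; lra)) as [A B].
    rewrite Rinv_inv in A, B.
    assert (E : 1 + / (INR n + 1) = (INR n + 1 + 1) * / (INR n + 1)) by (field; lra).
    assert (El : ln (1 + / (INR n + 1)) = ln (INR n + 1 + 1) - ln (INR n + 1)).
    { rewrite E, ln_mult, ln_Rinv; try lra. apply Rinv_0_lt_compat; lra. }
    rewrite El in A, B.
    replace ((/ (INR n + 1)) ^ 2 / (4 * (1 + / (INR n + 1))))
      with (/ (4 * (INR n + 1)) - / (4 * (INR n + 2))) in B by (field; lra).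
    split; lra. }
  assert (Hb : forall n, d O - / 4 <= d n - / (4 * (INR n + 1))).
  { induction n as [|n IH].
    - simpl INR. replace (4 * (0 + 1)) with 4 by ring. lra.
    - pose proof (Hd n) as [_ B]. rewrite S_INR. replace (INR n + 1 + 1) with (INR n + 2) by ring. lra. }
  destruct (ex_finite_lim_seq_decr d (d O - / 4)) as [l Hl].
  - intros n. pose proof (Hd n). lra.
  - intros n. pose proof (Hb n). pose proof (pos_INR n).
    assert (0 < / (4 * (INR n + 1))) by (apply Rinv_0_lt_compat; lra). lra.
  - exists (exp l). split; [apply exp_pos|].
    apply is_lim_seq_incr_1.
    apply is_lim_seq_ext with (fun n => exp (d n)).
    + intros n. rewrite stirling_ratio_exp by lia. reflexivity.
    + apply (is_lim_seq_continuous exp d l); [|exact Hl].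
      apply derivable_continuous_pt, derivable_pt_exp.
Qed.

(** If [s] is the limit, [stirling_ratio m ^ 2 / stirling_ratio (2 * m)] tends to [s^2 / s = s]; but
    it equals [sqrt 2 * central m / sqrt m], whose limit is Wallis' constant. *)
Lemma stirling : is_lim_seq stirling_ratio (sqrt (2 * PI)).
Proof.
  destruct stirling_ratio_cv as [s [Hs H]].
  assert (H2 : is_lim_seq (fun m => stirling_ratio (2 * m)) s).
  { apply (is_lim_seq_subseq stirling_ratio s (fun m => (2 * m)%nat)); [|exact H].
    apply eventually_subseq. intros n. lia. }
  assert (Hq : is_lim_seq (fun m => stirling_ratio m ^ 2 / stirling_ratio (2 * m)) s).
  { replace s with (s * s * / s) by (field; lra).
    apply is_lim_seq_ext with (fun m => stirling_ratio m * stirling_ratio m * / stirling_ratio (2 * m)).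
    - intros m. unfold Rdiv. ring.
    - apply is_lim_seq_mult'; [apply is_lim_seq_mult'; exact H|].
      apply is_lim_seq_inv_R; [lra | exact H2]. }
  assert (Hw : is_lim_seq (fun m => stirling_ratio m ^ 2 / stirling_ratio (2 * m)) (sqrt 2 * sqrt PI)).
  { assert (Hc := is_lim_seq_mult' _ _ _ _ (is_lim_seq_const (sqrt 2)) central_sqrt).
    apply is_lim_seq_incr_1. apply is_lim_seq_incr_1 in Hc.
    apply is_lim_seq_ext with (2 := Hc). intros m.
    set (n := S m). assert (Hn : 0 < INR n) by (apply lt_0_INR; unfold n; lia).
    unfold stirling_ratio, central. rewrite mult_INR. change (INR 2) with 2.
    rewrite sqrt_mult by lra. rewrite ln_mult by lra.
    pose proof (INR_fact_lt_0 n). pose proof (INR_fact_lt_0 (2 * n)).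
    set (f := INR (fact n)) in *. set (g := INR (fact (2 * n))) in *.
    set (x := INR n) in *. set (L := ln x).
    assert (Hx : 0 < sqrt x) by (apply sqrt_lt_R0; exact Hn).
    assert (H2s : 0 < sqrt 2) by (apply sqrt_lt_R0; lra).
    assert (E4 : 4 ^ n = exp (2 * x * ln 2)).
    { replace (2 * x * ln 2) with (x * ln 4).
      - fold (Rpower 4 x). unfold x. rewrite Rpower_pow by lra. reflexivity.
      - replace 4 with (2 * 2) by ring. rewrite ln_mult by lra. ring. }
    rewrite E4.
    replace (exp (2 * x * (ln 2 + L) - 2 * x)) with (exp (x * L - x) * exp (x * L - x) * exp (2 * x * ln 2))
      by (rewrite <- !exp_plus; f_equal; ring).
    pose proof (exp_pos (x * L - x)). pose proof (exp_pos (2 * x * ln 2)).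
    field. repeat split; lra. }
  apply is_lim_seq_unique in Hq. apply is_lim_seq_unique in Hw.
  rewrite Hq in Hw. injection Hw as Hw. rewrite sqrt_mult by (pose proof PI_RGT_0; lra).
  rewrite <- Hw. exact H.
Qed.

(** * Gaussian sums and a one-sided Laplace method *)

Lemma sum_f_R0_rev (f : nat -> R) (n : nat) :
  sum_f_R0 (fun j => f (n - j)%nat) n = sum_f_R0 f n.
Proof.
  induction n as [|n IH]; [reflexivity|].
  rewrite (decomp_sum _ (S n)) by lia. rewrite Nat.sub_0_r.
  change (pred (S n)) with n.
  rewrite (sum_eq _ (fun j => f (n - j)%nat)) by (intros i Hi; f_equal; lia).
  rewrite IH. simpl. ring.
Qed.

Lemma sum_f_R0_split (f : nat -> R) (m k : nat) :
  sum_f_R0 f (m + k) = sum_f_R0 (fun j => f (m - j)%nat) m + sum_f_R0 (fun j => f (m + j)%nat) k - f m.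
Proof.
  rewrite sum_f_R0_rev. induction k as [|k IH].
  - rewrite Nat.add_0_r. simpl. rewrite Nat.add_0_r. ring.
  - rewrite <- plus_n_Sm. simpl sum_f_R0. rewrite IH, <- plus_n_Sm. ring.
Qed.

(** For [j <= M], the entry of row [2M] of Pascal's triangle at distance [j] from the centre,
    divided by the central entry. *)
Definition binom_ratio (M j : nat) : R :=
  INR (fact M) ^ 2 / (INR (fact (M + j)) * INR (fact (M - j))).

(** The row sums to [4^M] and is symmetric; doubling one half counts the centre twice, hence the
    [+ 1]. *)
Lemma sum_binom_ratio (M : nat) :
  2 * sum_f_R0 (binom_ratio M) M = central M + 1.
Proof.
  pose proof (binomial 1 1 (2 * M)) as Hb.
  replace ((1 + 1) ^ (2 * M)) with (4 ^ M) in Hb by (rewrite pow_mult; f_equal; ring).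
  pose proof (sum_f_R0_split
    (fun i => Binomial.C (2 * M) i * 1 ^ i * 1 ^ (2 * M - i)) M M) as Hsp.
  replace (M + M)%nat with (2 * M)%nat in Hsp by lia.
  rewrite Hsp in Hb. clear Hsp.
  pose proof (INR_fact_lt_0 M) as HM. pose proof (INR_fact_lt_0 (2 * M)) as H2M.
  set (K := INR (fact (2 * M)) / INR (fact M) ^ 2).
  assert (HK : central M * K = 4 ^ M) by (unfold central, K; field; split; lra).
  assert (HK0 : 0 < K) by (apply Rdiv_lt_0_compat; [lra | apply pow_lt, HM]).
  assert (E1 : forall j, (j <= M)%nat ->
    Binomial.C (2 * M) (M + j) * 1 ^ (M + j) * 1 ^ (2 * M - (M + j)) = binom_ratio M j * K).
  { intros j Hj. rewrite !pow1. unfold Binomial.C, binom_ratio, K.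
    replace (2 * M - (M + j))%nat with (M - j)%nat by lia.
    pose proof (INR_fact_lt_0 (M + j)). pose proof (INR_fact_lt_0 (M - j)).
    field. repeat split; lra. }
  assert (E2 : forall j, (j <= M)%nat ->
    Binomial.C (2 * M) (M - j) * 1 ^ (M - j) * 1 ^ (2 * M - (M - j)) = binom_ratio M j * K).
  { intros j Hj. rewrite !pow1. unfold Binomial.C, binom_ratio, K.
    replace (2 * M - (M - j))%nat with (M + j)%nat by lia.
    pose proof (INR_fact_lt_0 (M + j)). pose proof (INR_fact_lt_0 (M - j)).
    field. repeat split; lra. }
  rewrite (sum_eq _ _ M E1) in Hb.
  rewrite (sum_eq _ (fun j => binom_ratio M j * K) M) in Hb by (intros j Hj; apply E2, Hj).
  rewrite <- scal_sum in Hb.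
  assert (E0 : Binomial.C (2 * M) M * 1 ^ M * 1 ^ (2 * M - M) = K).
  { rewrite !pow1. unfold Binomial.C, K. replace (2 * M - M)%nat with M by lia. field. lra. }
  rewrite E0 in Hb. rewrite <- HK in Hb.
  apply Rmult_eq_reg_r with K; [|lra]. lra.
Qed.

Lemma binom_ratio_pos (M j : nat) : 0 < binom_ratio M j.
Proof.
  unfold binom_ratio. pose proof (INR_fact_lt_0 M).
  pose proof (INR_fact_lt_0 (M + j)). pose proof (INR_fact_lt_0 (M - j)).
  apply Rdiv_lt_0_compat; [apply pow_lt; lra | apply Rmult_lt_0_compat; lra].
Qed.

Lemma binom_ratio_0 (M : nat) : binom_ratio M 0 = 1.
Proof.
  unfold binom_ratio. rewrite Nat.add_0_r, Nat.sub_0_r. field. apply INR_fact_neq_0.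
Qed.

Lemma binom_ratio_S (M j : nat) : (j < M)%nat ->
  binom_ratio M (S j) * (INR M + INR j + 1) = binom_ratio M j * (INR M - INR j).
Proof.
  intros Hj. unfold binom_ratio.
  replace (M - j)%nat with (S (M - S j)) by lia. rewrite <- plus_n_Sm, !fact_S.
  rewrite minus_INR, plus_INR, S_INR by lia.
  pose proof (INR_fact_lt_0 (M + j)). pose proof (INR_fact_lt_0 (M - S j)).
  apply lt_INR in Hj. pose proof (pos_INR j).
  field. repeat split; lra.
Qed.

Lemma exp_opp_mul (x : R) : exp (- x) * exp x = 1.
Proof. rewrite <- exp_plus, <- exp_0. f_equal. ring. Qed.

(** Consecutive entries have ratio [(M - j) / (M + j + 1)], at least [exp (- (2 j + 1) / (M - w))]
    as long as [j < w]; the odd numbers add up to [j^2]. The upper bound below is the same argument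
    with [M + w]. *)
Lemma binom_ratio_ge (M w j : nat) : (w < M)%nat -> (j <= w)%nat ->
  exp (- (INR j ^ 2 / (INR M - INR w))) <= binom_ratio M j.
Proof.
  intros Hw. apply lt_INR in Hw as HwR.
  induction j as [|j IH]; intros Hj.
  - rewrite binom_ratio_0, <- exp_0. change (INR 0) with 0. right. f_equal. field. lra.
  - specialize (IH ltac:(lia)).
    pose proof (binom_ratio_S M j ltac:(lia)) as E.
    apply le_INR in Hj. rewrite S_INR in Hj. pose proof (pos_INR j).
    set (x := (2 * INR j + 1) / (INR M - INR w)).
    assert (Hx : INR M + INR j + 1 <= (INR M - INR j) * exp x).
    { pose proof (exp_ineq1_le x) as Hx1.
      apply Rle_trans with ((INR M - INR j) * (1 + x)); [|apply Rmult_le_compat_l; lra].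
      assert (2 * INR j + 1 <= (INR M - INR j) * x).
      { apply Rle_trans with ((INR M - INR w) * x); [right; unfold x; field; lra|].
        apply Rmult_le_compat_r; [|lra]. apply Rmult_le_pos; [lra|].
        left; apply Rinv_0_lt_compat; lra. }
      lra. }
    replace (- (INR (S j) ^ 2 / (INR M - INR w))) with (- (INR j ^ 2 / (INR M - INR w)) + - x)
      by (rewrite S_INR; unfold x; field; lra).
    rewrite exp_plus.
    apply Rmult_le_reg_r with (INR M + INR j + 1); [lra|]. rewrite E.
    pose proof (exp_opp_mul x) as Ex. pose proof (exp_pos x). pose proof (exp_pos (- x)).
    apply Rle_trans with (exp (- (INR j ^ 2 / (INR M - INR w))) * (exp (- x) * ((INR M - INR j) * exp x))).
    + rewrite Rmult_assoc. apply Rmult_le_compat_l; [left; apply exp_pos|].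
      apply Rmult_le_compat_l; lra.
    + replace (exp (- x) * ((INR M - INR j) * exp x)) with ((INR M - INR j) * (exp (- x) * exp x)) by ring.
      rewrite Ex, Rmult_1_r. apply Rmult_le_compat_r; lra.
Qed.

Lemma binom_ratio_le (M w j : nat) : (w <= M)%nat -> (j <= w)%nat ->
  binom_ratio M j <= exp (- (INR j ^ 2 / (INR M + INR w))).
Proof.
  intros Hw. apply le_INR in Hw as HwR.
  induction j as [|j IH]; intros Hj.
  - rewrite binom_ratio_0, <- exp_0. change (INR 0) with 0. right. f_equal.
    unfold Rdiv. ring.
  - specialize (IH ltac:(lia)).
    pose proof (binom_ratio_S M j ltac:(lia)) as E.
    apply le_INR in Hj. rewrite S_INR in Hj. pose proof (pos_INR j).
    set (x := (2 * INR j + 1) / (INR M + INR w)).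
    assert (Hx : INR M - INR j <= (INR M + INR j + 1) * exp (- x)).
    { pose proof (exp_ineq1_le (- x)) as Hx1.
      apply Rle_trans with ((INR M + INR j + 1) * (1 - x)); [|apply Rmult_le_compat_l; lra].
      assert ((INR M + INR j + 1) * x <= 2 * INR j + 1).
      { apply Rle_trans with ((INR M + INR w) * x); [|right; unfold x; field; lra].
        apply Rmult_le_compat_r; [|lra]. apply Rmult_le_pos; [lra|].
        left; apply Rinv_0_lt_compat; lra. }
      lra. }
    replace (- (INR (S j) ^ 2 / (INR M + INR w))) with (- (INR j ^ 2 / (INR M + INR w)) + - x)
      by (rewrite S_INR; unfold x; field; lra).
    rewrite exp_plus.
    apply Rmult_le_reg_r with (INR M + INR j + 1); [lra|]. rewrite E.
    rewrite Rmult_assoc, (Rmult_comm (exp (- x))).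
    pose proof (binom_ratio_pos M j).
    apply Rmult_le_compat; lra.
Qed.

Lemma binom_ratio_decr (M w j : nat) : (w <= j <= M)%nat -> binom_ratio M j <= binom_ratio M w.
Proof.
  intros [Hw Hj]. induction Hw as [|j Hw IH]; [lra|].
  specialize (IH ltac:(lia)). apply Rle_trans with (2 := IH).
  pose proof (binom_ratio_S M j ltac:(lia)) as E.
  pose proof (pos_INR j). pose proof (pos_INR M). pose proof (binom_ratio_pos M j).
  apply Rmult_le_reg_r with (INR M + INR j + 1); [lra|]. rewrite E.
  apply Rmult_le_compat_l; lra.
Qed.

(** * Truncated Gaussian sums *)

Definition gauss_sum (a : R) (w : nat) : R := sum_f_R0 (fun j => exp (- (a * INR j ^ 2))) w.

Lemma sum_f_R0_le_extend (f : nat -> R) (w M : nat) :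
  (forall j, 0 <= f j) -> (w <= M)%nat -> sum_f_R0 f w <= sum_f_R0 f M.
Proof.
  intros Hf HwM. induction HwM as [|M _ IH]; [lra|]. simpl. pose proof (Hf (S M)). lra.
Qed.

Lemma sum_f_R0_extend_le (f : nat -> R) (w M : nat) (b : R) :
  (forall j, (w < j <= M)%nat -> f j <= b) -> (w <= M)%nat ->
  sum_f_R0 f M <= sum_f_R0 f w + (INR M - INR w) * b.
Proof.
  intros Hf HwM. induction HwM as [|M HwM IH]; [lra|].
  simpl sum_f_R0. rewrite S_INR. pose proof (Hf (S M) ltac:(lia)).
  assert (IH' : sum_f_R0 f M <= sum_f_R0 f w + (INR M - INR w) * b)
    by (apply IH; intros; apply Hf; lia). lra.
Qed.

Lemma gauss_sum_le (a : R) (w M : nat) : (w < M)%nat -> 1 <= a * (INR M - INR w) ->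
  gauss_sum a w <= (central M + 1) / 2.
Proof.
  intros Hw Ha. rewrite <- sum_binom_ratio.
  apply lt_INR in Hw as HwR.
  apply Rle_trans with (sum_f_R0 (binom_ratio M) w).
  - apply sum_Rle. intros j Hj. apply Rle_trans with (2 := binom_ratio_ge M w j Hw Hj).
    apply exp_le, Ropp_le_contravar.
    apply Rmult_le_reg_r with (INR M - INR w); [lra|].
    replace (INR j ^ 2 / (INR M - INR w) * (INR M - INR w)) with (1 * INR j ^ 2) by (field; lra).
    replace (a * INR j ^ 2 * (INR M - INR w)) with (a * (INR M - INR w) * INR j ^ 2) by ring.
    apply Rmult_le_compat_r; [apply pow2_ge_0 | exact Ha].
  - pose proof (sum_f_R0_le_extend (binom_ratio M) w M
      (fun j => Rlt_le _ _ (binom_ratio_pos M j)) ltac:(lia)). lra.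
Qed.

(** Here the part of the row beyond [w] must be discarded: at most [M] entries, each bounded by the
    entry at [w]. *)
Lemma gauss_sum_ge (a : R) (w M : nat) : (w <= M)%nat -> (0 < M)%nat -> a * (INR M + INR w) <= 1 ->
  (central M + 1) / 2 - INR M * exp (- (INR w ^ 2 / (INR M + INR w))) <= gauss_sum a w.
Proof.
  intros Hw HM Ha. rewrite <- sum_binom_ratio.
  apply lt_0_INR in HM. apply le_INR in Hw as HwR. pose proof (pos_INR w).
  assert (H1 : sum_f_R0 (binom_ratio M) w <= gauss_sum a w).
  { apply sum_Rle. intros j Hj. apply Rle_trans with (1 := binom_ratio_le M w j Hw Hj).
    apply exp_le, Ropp_le_contravar.
    apply Rmult_le_reg_r with (INR M + INR w); [lra|].
    replace (INR j ^ 2 / (INR M + INR w) * (INR M + INR w)) with (1 * INR j ^ 2) by (field; lra).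
    replace (a * INR j ^ 2 * (INR M + INR w)) with (a * (INR M + INR w) * INR j ^ 2) by ring.
    apply Rmult_le_compat_r; [apply pow2_ge_0 | exact Ha]. }
  pose proof (sum_f_R0_extend_le (binom_ratio M) w M (exp (- (INR w ^ 2 / (INR M + INR w))))) as H2.
  assert (H3 : sum_f_R0 (binom_ratio M) M <= sum_f_R0 (binom_ratio M) w
     + (INR M - INR w) * exp (- (INR w ^ 2 / (INR M + INR w)))).
  { apply H2; [|exact Hw]. intros j Hj. apply Rle_trans with (binom_ratio M w).
    - apply binom_ratio_decr; lia.
    - apply binom_ratio_le; lia. }
  assert (0 <= INR w * exp (- (INR w ^ 2 / (INR M + INR w))))
    by (apply Rmult_le_pos; [assumption | left; apply exp_pos]).
  lra.
Qed.

Definition nat_floor (x : R) : nat := Z.to_nat (up x - 1).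

Lemma nat_floor_spec (x : R) : 0 <= x -> INR (nat_floor x) <= x < INR (nat_floor x) + 1.
Proof.
  intros Hx. unfold nat_floor. destruct (archimed x) as [H1 H2].
  assert (0 < up x)%Z by (apply lt_IZR; lra).
  rewrite INR_IZR_INZ, Z2Nat.id by lia. rewrite minus_IZR. lra.
Qed.

Lemma eventually_ge (A : R) : eventually (fun n => A <= INR n).
Proof.
  exists (S (nat_floor (Rmax A 0))). intros n Hn. apply le_INR in Hn. rewrite S_INR in Hn.
  pose proof (nat_floor_spec (Rmax A 0) (Rmax_r _ _)). pose proof (Rmax_l A 0). lra.
Qed.

Lemma is_lim_seq_div_INR (K : R) : is_lim_seq (fun n => K / INR n) 0.
Proof.
  apply is_lim_seq_incr_1. apply is_lim_seq_O_inv with (Rabs K).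
  intros m. rewrite S_INR, Rminus_0_r. pose proof (pos_INR m).
  unfold Rdiv. rewrite Rabs_mult, (Rabs_pos_eq (/ (INR m + 1))); [lra|].
  left; apply Rinv_0_lt_compat; lra.
Qed.

Lemma nat_floor_lim (b : R) : 0 < b -> is_lim_seq (fun n => INR (nat_floor (b * INR n)) / INR n) b.
Proof.
  intros Hb. apply is_lim_seq_incr_1. apply is_lim_seq_O_inv with 1. intros m.
  pose proof (pos_INR m).
  pose proof (nat_floor_spec (b * INR (S m)) ltac:(apply Rmult_le_pos; [lra | apply pos_INR])) as Hf.
  rewrite S_INR in *. set (x := INR (nat_floor (b * (INR m + 1)))) in *.
  replace (x / (INR m + 1) - b) with ((x - b * (INR m + 1)) / (INR m + 1)) by (field; lra).
  unfold Rdiv. rewrite Rabs_mult, (Rabs_pos_eq (/ (INR m + 1))) by (left; apply Rinv_0_lt_compat; lra).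
  apply Rmult_le_compat_r; [left; apply Rinv_0_lt_compat; lra|].
  apply Rabs_le. lra.
Qed.

Lemma is_lim_seq_sqrt (u : nat -> R) (l : R) : 0 <= l ->
  is_lim_seq u l -> is_lim_seq (fun n => sqrt (u n)) (sqrt l).
Proof.
  intros Hl H. apply (is_lim_seq_continuous sqrt u l); [|exact H].
  apply continuity_pt_sqrt, Hl.
Qed.

Lemma nat_floor_to_infty (b : R) : 0 < b -> filterlim (fun n => nat_floor (b * INR n)) eventually eventually.
Proof.
  intros Hb P [N HN].
  destruct (eventually_ge ((INR N + 1) / b)) as [N' HN']. exists N'. intros n Hn. apply HN.
  specialize (HN' n Hn).
  assert (INR N + 1 <= b * INR n).
  { apply Rmult_le_compat_l with (r := b) in HN'; [|lra].
    replace (b * ((INR N + 1) / b)) with (INR N + 1) in HN' by (field; lra). exact HN'. }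
  pose proof (nat_floor_spec (b * INR n) ltac:(pose proof (pos_INR N); lra)).
  apply INR_le. lra.
Qed.

Lemma central_scaled (b : R) : 0 < b ->
  is_lim_seq (fun n => (central (nat_floor (b * INR n)) + 1) / 2 / sqrt (INR n)) (sqrt (PI * b) / 2).
Proof.
  intros Hb. pose proof PI_RGT_0.
  assert (H1 : is_lim_seq (fun n => central (nat_floor (b * INR n)) / sqrt (INR (nat_floor (b * INR n)))) (sqrt PI)).
  { apply (filterlim_comp _ _ _ (fun n => nat_floor (b * INR n)) (fun m => central m / sqrt (INR m)) _ eventually _
      (nat_floor_to_infty b Hb)). exact central_sqrt. }
  pose proof (is_lim_seq_sqrt _ _ (Rlt_le _ _ Hb) (nat_floor_lim b Hb)) as H2.
  pose proof (is_lim_seq_sqrt _ _ (Rle_refl 0) (is_lim_seq_div_INR 1)) as H3. rewrite sqrt_0 in H3.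
  assert (H4 := is_lim_seq_mult' _ _ _ _ (is_lim_seq_plus' _ _ _ _ (is_lim_seq_mult' _ _ _ _ H1 H2) H3)
     (is_lim_seq_const (/ 2))).
  replace (sqrt (PI * b) / 2) with ((sqrt PI * sqrt b + 0) * / 2) by (rewrite sqrt_mult by lra; field).
  apply is_lim_seq_ext_loc with (2 := H4).
  destruct (eventually_ge (1 + 1 / b)) as [N HN]. exists N. intros n Hn. specialize (HN n Hn).
  assert (0 < 1 / b) by (apply Rdiv_lt_0_compat; lra).
  assert (1 <= b * INR n).
  { apply Rle_trans with (b * (1 / b)); [right; field; lra | apply Rmult_le_compat_l; lra]. }
  pose proof (nat_floor_spec (b * INR n) ltac:(lra)) as [_ Hf].
  set (m := nat_floor (b * INR n)) in *.
  assert (0 < INR m).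
  { apply lt_0_INR. destruct m; [simpl INR in Hf; lra | lia]. }
  rewrite !sqrt_div_alt by lra. rewrite sqrt_1.
  assert (0 < sqrt (INR n)) by (apply sqrt_lt_R0; lra).
  assert (0 < sqrt (INR m)) by (apply sqrt_lt_R0; lra).
  field. lra.
Qed.

Lemma n_exp_lim (c : R) : 0 < c -> is_lim_seq (fun n => INR n * exp (- (c * INR n))) 0.
Proof.
  intros Hc. apply is_lim_seq_le_le_loc with (fun _ => 0) (fun n => 4 / c ^ 2 / INR n).
  - exists 1%nat. intros n Hn. apply le_INR in Hn. change (INR 1) with 1 in Hn.
    pose proof (exp_pos (- (c * INR n))). split; [apply Rmult_le_pos; lra|].
    set (x := INR n) in *.
    pose proof (exp_ineq1_le (c * x / 2)) as H1. assert (0 < c * x) by (apply Rmult_lt_0_compat; lra).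
    assert (E : exp (- (c * x)) * (exp (c * x / 2) * exp (c * x / 2)) = 1).
    { rewrite <- !exp_plus, <- exp_0. f_equal. field. }
    assert (Hsq : c ^ 2 * x ^ 2 / 4 <= exp (c * x / 2) * exp (c * x / 2)) by nra.
    assert (Hm : exp (- (c * x)) * (c ^ 2 * x ^ 2 / 4) <= 1).
    { rewrite <- E. apply Rmult_le_compat_l; lra. }
    assert (0 < c ^ 2) by nra.
    apply Rmult_le_reg_r with (c ^ 2 * x / 4); [nra|].
    replace (4 / c ^ 2 / x * (c ^ 2 * x / 4)) with 1 by (field; split; lra).
    nra.
  - apply is_lim_seq_const.
  - apply is_lim_seq_div_INR.
Qed.

Lemma is_lim_seq_lt (u : nat -> R) (l b : R) : is_lim_seq u l -> l < b -> eventually (fun n => u n <= b).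
Proof.
  intros H Hb. apply is_lim_seq_spec in H.
  destruct (H (mkposreal (b - l) ltac:(lra))) as [N HN]. exists N. intros n Hn.
  specialize (HN n Hn). simpl in HN. apply Rabs_def2 in HN. lra.
Qed.

Lemma is_lim_seq_gt (u : nat -> R) (l b : R) : is_lim_seq u l -> b < l -> eventually (fun n => b <= u n).
Proof.
  intros H Hb. apply is_lim_seq_spec in H.
  destruct (H (mkposreal (l - b) ltac:(lra))) as [N HN]. exists N. intros n Hn.
  specialize (HN n Hn). simpl in HN. apply Rabs_def2 in HN. lra.
Qed.

(** Lets a whole error budget be written as one continuous function of a tolerance and then be
    compared with its value at 0. *)
Lemma exists_pos_near (f : R -> R) (e : R) : 0 < e -> continuous f 0 ->
  exists d0, 0 < d0 /\ forall d, 0 < d <= d0 -> f 0 - e < f d < f 0 + e.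
Proof.
  intros He Hf.
  assert (Hl : locally (f 0) (fun y => f 0 - e < y < f 0 + e)).
  { exists (mkposreal e He). intros y Hy.
    change (Rabs (y - f 0) < e) in Hy. apply Rabs_def2 in Hy. lra. }
  destruct (Hf _ Hl) as [d Hd]. exists (d / 2). pose proof (cond_pos d). split; [lra|].
  intros y Hy. apply Hd. change (Rabs (y - 0) < d). rewrite Rminus_0_r, Rabs_pos_eq; lra.
Qed.

(** The Gaussian of width [n / a] is squeezed between rows with [M] near [n / a + 2 d n] and
    [n / a - 2 d n]. For fixed [d] these rows have different limits, so the squeeze reaches
    precision [e] only after [d] is taken small. *)
Lemma gauss_sum_lim (a e : R) : 0 < a -> 0 < e ->
  exists d0, 0 < d0 /\ forall d, 0 < d <= d0 -> eventually (fun n =>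
    sqrt (PI / a) / 2 - e <= gauss_sum (a / INR n) (nat_floor (d * INR n)) / sqrt (INR n)
      <= sqrt (PI / a) / 2 + e).
Proof.
  intros Ha He. pose proof PI_RGT_0 as HPI.
  assert (Hia : 0 < / a) by (apply Rinv_0_lt_compat, Ha).
  destruct (exists_pos_near (fun d => sqrt (PI * (/ a + 2 * d)) / 2) (e / 2) ltac:(lra)) as [d1 [Hd1 B1]].
  { apply (ex_derive_continuous (fun d => sqrt (PI * (/ a + 2 * d)) / 2)). auto_derive.
    apply Rmult_lt_0_compat; lra. }
  destruct (exists_pos_near (fun d => sqrt (PI * (/ a - 2 * d)) / 2) (e / 3) ltac:(lra)) as [d2 [Hd2 B2]].
  { apply (ex_derive_continuous (fun d => sqrt (PI * (/ a - 2 * d)) / 2)). auto_derive.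
    apply Rmult_lt_0_compat; lra. }
  exists (Rmin (Rmin d1 d2) (/ a / 4)). split; [repeat apply Rmin_pos; lra|].
  intros d [Hd Hdm].
  assert (Hda : d <= d1) by (eapply Rle_trans; [exact Hdm|]; eapply Rle_trans; [apply Rmin_l | apply Rmin_l]).
  assert (Hdb : d <= d2) by (eapply Rle_trans; [exact Hdm|]; eapply Rle_trans; [apply Rmin_l | apply Rmin_r]).
  assert (Hdc : d <= / a / 4) by (eapply Rle_trans; [exact Hdm | apply Rmin_r]).
  specialize (B1 d (conj Hd Hda)). specialize (B2 d (conj Hd Hdb)). cbv beta in B1, B2.
  rewrite Rmult_0_r, Rplus_0_r in B1. rewrite Rmult_0_r, Rminus_0_r in B2. fold (PI / a) in B1, B2.
  (* Of the shift [2 d n], one [d n] compensates the cutoff [w], the other covers the rounding of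
     the integer parts. *)
  set (b1 := / a + 2 * d) in *. set (b2 := / a - 2 * d) in *.
  assert (Hb1 : 0 < b1) by (unfold b1; lra). assert (Hb2 : 0 < b2) by (unfold b2; lra).
  pose proof (is_lim_seq_lt _ _ (sqrt (PI / a) / 2 + e) (central_scaled b1 Hb1) ltac:(lra)) as U.
  pose proof (is_lim_seq_gt _ _ (sqrt (PI / a) / 2 - 2 * e / 3) (central_scaled b2 Hb2) ltac:(lra)) as L.
  (* With [w >= d n / 2] and [M2 + w <= n / a], the tail exponent [w^2 / (M2 + w)] is at least
     [d^2 a n / 4], which leaves a factor 2 to spare. *)
  set (c := d ^ 2 * a / 8).
  assert (Hc : 0 < c) 
    by (unfold c; apply Rdiv_lt_0_compat; [apply Rmult_lt_0_compat; [apply pow_lt|]; lra | lra]).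
  pose proof (is_lim_seq_lt _ _ (e / 3 / / a) (n_exp_lim c Hc)
    ltac:(apply Rdiv_lt_0_compat; lra)) as T.
  pose proof (eventually_ge (1 + 2 / d + 2 / b2)) as G.
  generalize (filter_and _ _ (filter_and _ _ U L) (filter_and _ _ T G)).
  apply filter_imp. intros n [[Un Ln] [Tn Gn]].
  assert (0 < 2 / d) by (apply Rdiv_lt_0_compat; lra).
  assert (0 < 2 / b2) by (apply Rdiv_lt_0_compat; lra).
  set (x := INR n) in *.
  assert (Hdx : 2 <= d * x).
  { apply Rle_trans with (d * (2 / d)); [right; field; lra | apply Rmult_le_compat_l; lra]. }
  assert (Hbx : 2 <= b2 * x).
  { apply Rle_trans with (b2 * (2 / b2)); [right; field; lra | apply Rmult_le_compat_l; lra]. }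
  assert (Hbx1 : b1 * x = / a * x + 2 * (d * x)) by (unfold b1; ring).
  assert (Hbx2 : b2 * x = / a * x - 2 * (d * x)) by (unfold b2; ring).
  assert (Hax : 0 < / a * x) by (apply Rmult_lt_0_compat; lra).
  pose proof (nat_floor_spec (d * x) ltac:(lra)) as Fw.
  pose proof (nat_floor_spec (b1 * x) ltac:(lra)) as F1.
  pose proof (nat_floor_spec (b2 * x) ltac:(lra)) as F2.
  set (w := nat_floor (d * x)) in *. set (M1 := nat_floor (b1 * x)) in *.
  set (M2 := nat_floor (b2 * x)) in *.
  assert (Hs : 1 <= sqrt x) by (rewrite <- sqrt_1; apply sqrt_le_1_alt; lra).
  assert (Hdiv : forall u v, u <= v -> u / sqrt x <= v / sqrt x).
  { intros u v Huv. apply Rmult_le_compat_r; [left; apply Rinv_0_lt_compat; lra | exact Huv]. }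
  assert (Hae : a * / a = 1) by (field; lra).
  split.
  - assert (Hge : (central M2 + 1) / 2 - INR M2 * exp (- (INR w ^ 2 / (INR M2 + INR w))) <= gauss_sum (a / x) w).
    { apply gauss_sum_ge.
      - apply INR_le. unfold b2 in *. assert (d * x <= / a / 4 * x) by (apply Rmult_le_compat_r; lra). lra.
      - apply INR_lt. change (INR 0) with 0. lra.
      - apply Rmult_le_reg_r with x; [lra|].
        replace (a / x * (INR M2 + INR w) * x) with (a * (INR M2 + INR w)) by (field; lra).
        apply Rle_trans with (a * (/ a * x)); [apply Rmult_le_compat_l; lra | nra]. }
    apply Hdiv in Hge. apply Rle_trans with (2 := Hge).
    assert (Htail : INR M2 * exp (- (INR w ^ 2 / (INR M2 + INR w))) / sqrt x <= e / 3).
    { apply Rle_trans with (INR M2 * exp (- (INR w ^ 2 / (INR M2 + INR w)))).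
      - pose proof (exp_pos (- (INR w ^ 2 / (INR M2 + INR w)))). pose proof (pos_INR M2).
        assert (0 <= INR M2 * exp (- (INR w ^ 2 / (INR M2 + INR w)))) by (apply Rmult_le_pos; lra).
        assert (/ sqrt x <= 1) by (rewrite <- Rinv_1; apply Rinv_le_contravar; lra).
        unfold Rdiv at 1. nra.
      - apply Rle_trans with ((/ a * x) * exp (- (c * x))).
        + apply Rmult_le_compat; [apply pos_INR | left; apply exp_pos | lra |].
          apply exp_le, Ropp_le_contravar.
          assert (Hw2 : d * x / 2 <= INR w) by lra.
          assert (0 < INR M2 + INR w) by lra.
          apply Rmult_le_reg_r with (INR M2 + INR w); [lra|].
          replace (INR w ^ 2 / (INR M2 + INR w) * (INR M2 + INR w)) with (INR w ^ 2) by (field; lra).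
          apply Rle_trans with (c * x * (/ a * x)).
          * apply Rmult_le_compat_l; [apply Rmult_le_pos; lra | lra].
          * replace (c * x * (/ a * x)) with ((d * x) ^ 2 / 8) by (unfold c; field; lra).
            assert ((d * x / 2) ^ 2 <= INR w ^ 2) by (apply pow_incr; lra).
            pose proof (pow2_ge_0 (d * x)). lra.
        + apply Rle_trans with (/ a * (e / 3 / / a)); [|right; field; lra].
          rewrite Rmult_assoc. apply Rmult_le_compat_l; [lra | exact Tn]. }
    unfold Rdiv at 3. rewrite Rmult_minus_distr_r. unfold Rdiv in Ln, Htail |- *. lra.
  - apply Rle_trans with (2 := Un). apply Hdiv. apply gauss_sum_le.
    + apply INR_lt. lra.
    + apply Rmult_le_reg_r with x; [lra|].
      replace (a / x * (INR M1 - INR w) * x) with (a * (INR M1 - INR w)) by (field; lra).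
      apply Rle_trans with (a * (/ a * x)); [nra | apply Rmult_le_compat_l; lra].
Qed.

(** One-sided Laplace method with the order of choices made explicit: a relative tolerance [e], then
    a window of width [d n], then [n]. The limit is half of the Gaussian integral. [S] is arbitrary
    so that both an infinite series (right of the peak) and a finite sum (left of it) fit. *)
Lemma half_laplace (a : R) (f : nat -> nat -> R) (S : nat -> R) : 0 < a ->
  (forall e, 0 < e <= / 2 -> exists d, 0 < d /\ eventually (fun n => forall j, INR j <= d * INR n ->
     (1 - e) * exp (- ((1 + e) * a / INR n * INR j ^ 2)) <= sqrt (INR n) * f n j
       <= (1 + e) * exp (- ((1 - e) * a / INR n * INR j ^ 2)))) ->
  (forall d e, 0 < d <= 1 -> 0 < e ->
     eventually (fun n => Rabs (S n - sum_f_R0 (f n) (nat_floor (d * INR n))) <= e)) ->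
  is_lim_seq S (sqrt (PI / a) / 2).
Proof.
  intros Ha Hwin Htail. pose proof PI_RGT_0 as HPI.
  apply is_lim_seq_spec. intros eta. pose proof (cond_pos eta) as Heta.
  assert (HaP : 0 < PI * / a) by (apply Rmult_lt_0_compat; [lra | apply Rinv_0_lt_compat, Ha]).
  (* The function collects all losses of the upper estimate: the factor of the summand, the
     perturbed width, the error of the Gaussian sum and the tail. *)
  destruct (exists_pos_near (fun e => (1 + e) * (sqrt (PI / ((1 - e) * a)) / 2 + e) + e) eta Heta) as [e1 [He1 B1]].
  { apply (ex_derive_continuous (fun e => (1 + e) * (sqrt (PI / ((1 - e) * a)) / 2 + e) + e)). auto_derive.
    repeat split; try (apply Rgt_not_eq; nra).
    replace ((1 + - 0) * a) with a by ring. exact HaP. }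
  destruct (exists_pos_near (fun e => (1 - e) * (sqrt (PI / ((1 + e) * a)) / 2 - e) - e) eta Heta) as [e2 [He2 B2]].
  { apply (ex_derive_continuous (fun e => (1 - e) * (sqrt (PI / ((1 + e) * a)) / 2 - e) - e)). auto_derive.
    repeat split; try (apply Rgt_not_eq; nra).
    replace ((1 + 0) * a) with a by ring. exact HaP. }
  set (e := Rmin (/ 2) (Rmin e1 e2)).
  assert (He : 0 < e) by (unfold e; repeat apply Rmin_pos; lra).
  assert (Hes : e <= / 2) by apply Rmin_l.
  assert (Hea : e <= e1) by (eapply Rle_trans; [apply Rmin_r | apply Rmin_l]).
  assert (Heb : e <= e2) by (eapply Rle_trans; [apply Rmin_r | apply Rmin_r]).
  specialize (B1 e (conj He Hea)). specialize (B2 e (conj He Heb)). cbv beta in B1, B2.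
  rewrite Rminus_0_r, !Rplus_0_r, !Rmult_1_l in B1.
  rewrite !Rminus_0_r, !Rplus_0_r, !Rmult_1_l in B2.
  destruct (Hwin e (conj He Hes)) as [d1 [Hd1 W]].
  destruct (gauss_sum_lim ((1 - e) * a) e ltac:(nra) He) as [d2 [Hd2 G2]].
  destruct (gauss_sum_lim ((1 + e) * a) e ltac:(nra) He) as [d3 [Hd3 G3]].
  set (d := Rmin 1 (Rmin d1 (Rmin d2 d3))).
  assert (Hd : 0 < d) by (unfold d; repeat apply Rmin_pos; lra).
  assert (Hd1' : d <= 1) by apply Rmin_l.
  assert (Hdm : d <= Rmin d1 (Rmin d2 d3)) by apply Rmin_r.
  assert (Hda : d <= d1) by (eapply Rle_trans; [exact Hdm | apply Rmin_l]).
  assert (Hdb : d <= d2) by (eapply Rle_trans; [exact Hdm | eapply Rle_trans; [apply Rmin_r | apply Rmin_l]]).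
  assert (Hdc : d <= d3) by (eapply Rle_trans; [exact Hdm | eapply Rle_trans; [apply Rmin_r | apply Rmin_r]]).
  specialize (G2 d (conj Hd Hdb)). specialize (G3 d (conj Hd Hdc)).
  pose proof (Htail d e (conj Hd Hd1') He) as T. pose proof (eventually_ge 1) as N1.
  generalize (filter_and _ _ (filter_and _ _ (filter_and _ _ W G2) (filter_and _ _ G3 T)) N1).
  apply filter_imp. intros n [[[Wn G2n] [G3n Tn]] Nn].
  set (x := INR n) in *. set (w := nat_floor (d * x)) in *.
  assert (Hs : 0 < sqrt x) by (apply sqrt_lt_R0; lra).
  assert (Hw : INR w <= d * x) by (apply nat_floor_spec, Rmult_le_pos; lra).
  assert (Hj : forall j, (j <= w)%nat -> INR j <= d1 * x).
  { intros j Hj. apply le_INR in Hj. assert (d * x <= d1 * x) by (apply Rmult_le_compat_r; lra). lra. }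
  assert (Up : sum_f_R0 (f n) w <= (1 + e) * (gauss_sum ((1 - e) * a / x) w / sqrt x)).
  { unfold Rdiv at 1. rewrite <- Rmult_assoc. unfold gauss_sum. rewrite scal_sum, (Rmult_comm _ (/ sqrt x)), scal_sum.
    apply sum_Rle. intros j Hjw. destruct (Wn j (Hj j Hjw)) as [_ Wj].
    apply Rmult_le_reg_l with (sqrt x); [exact Hs|].
    apply Rle_trans with (1 := Wj). right. field. lra. }
  assert (Lo : (1 - e) * (gauss_sum ((1 + e) * a / x) w / sqrt x) <= sum_f_R0 (f n) w).
  { unfold Rdiv at 1. rewrite <- Rmult_assoc. unfold gauss_sum. rewrite scal_sum, (Rmult_comm _ (/ sqrt x)), scal_sum.
    apply sum_Rle. intros j Hjw. destruct (Wn j (Hj j Hjw)) as [Wj _].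
    apply Rmult_le_reg_l with (sqrt x); [exact Hs|].
    apply Rle_trans with (2 := Wj). right. field. lra. }
  apply Rabs_le_between in Tn.
  assert ((1 + e) * (gauss_sum ((1 - e) * a / x) w / sqrt x) <= (1 + e) * (sqrt (PI / ((1 - e) * a)) / 2 + e))
    by (apply Rmult_le_compat_l; lra).
  assert ((1 - e) * (sqrt (PI / ((1 + e) * a)) / 2 - e) <= (1 - e) * (gauss_sum ((1 + e) * a / x) w / sqrt x))
    by (apply Rmult_le_compat_l; lra).
  apply Rabs_def1; lra.
Qed.

(** * The summand near the saddle point *)

(** Eventually in [n], uniformly in a thin cone around [m = c n]. Being a filter, it allows limits
    in the two indices jointly to be computed by the usual [filterlim] calculus. *)
Definition near_ray (c : R) (P : nat * nat -> Prop) : Prop :=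
  exists d, 0 < d /\ exists N, forall n m, (N <= n)%nat ->
    Rabs (INR m - c * INR n) <= d * INR n -> P (n, m).

Global Instance near_ray_filter (c : R) : Filter (near_ray c).
Proof.
  split.
  - exists 1. split; [lra|]. exists 0%nat. intros; exact I.
  - intros P Q [d1 [Hd1 [N1 H1]]] [d2 [Hd2 [N2 H2]]].
    exists (Rmin d1 d2). split; [apply Rmin_pos; lra|].
    exists (Nat.max N1 N2). intros n m Hn Hm. pose proof (pos_INR n).
    pose proof (Rmin_l d1 d2). pose proof (Rmin_r d1 d2).
    split; [apply H1 | apply H2]; try lia; eapply Rle_trans; try exact Hm;
      apply Rmult_le_compat_r; assumption.
  - intros P Q HPQ [d [Hd [N H]]]. exists d. split; [exact Hd|]. exists N.
    intros n m Hn Hm. apply HPQ, H; assumption.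
Qed.

Lemma near_ray_to_infty (c : R) (g : nat -> nat -> nat) :
  (exists e, 0 < e /\ near_ray c (fun p => e * INR (fst p) <= INR (g (fst p) (snd p)))) ->
  filterlim (fun p => g (fst p) (snd p)) (near_ray c) eventually.
Proof.
  intros [e [He [d [Hd [N H]]]]] P [M HM].
  destruct (eventually_ge (INR M / e)) as [N' HN'].
  exists d. split; [exact Hd|]. exists (Nat.max N N'). intros n m Hn Hm.
  apply HM. apply INR_le.
  apply Rle_trans with (2 := H n m ltac:(lia) Hm). simpl.
  specialize (HN' n ltac:(lia)).
  apply Rle_trans with (e * (INR M / e)); [right; field; lra | apply Rmult_le_compat_l; lra].
Qed.

Lemma near_ray_ratio (c : R) :
  filterlim (fun p => INR (snd p) / INR (fst p)) (near_ray c) (locally c).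
Proof.
  intros P [e He]. exists (e / 2). pose proof (cond_pos e). split; [lra|].
  exists 1%nat. intros n m Hn Hm. apply He. simpl.
  apply le_INR in Hn. change (INR 1) with 1 in Hn.
  change (Rabs (INR m / INR n - c) < e).
  replace (INR m / INR n - c) with ((INR m - c * INR n) / INR n) by (field; lra).
  unfold Rdiv. rewrite Rabs_mult, (Rabs_pos_eq (/ INR n)) by (left; apply Rinv_0_lt_compat; lra).
  apply Rle_lt_trans with (e / 2 * INR n * / INR n).
  - apply Rmult_le_compat_r; [left; apply Rinv_0_lt_compat; lra | exact Hm].
  - rewrite Rmult_assoc, Rinv_r by lra. lra.
Qed.

Lemma near_ray_fst (c : R) : filterlim (fun p : nat * nat => fst p) (near_ray c) eventually.
Proof.
  apply (near_ray_to_infty c (fun n _ => n)). exists 1. split; [lra|].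
  exists 1. split; [lra|]. exists 0%nat. intros n m _ _. simpl. lra.
Qed.

Lemma filterlim_mult_R {T : Type} (F : (T -> Prop) -> Prop) {FF : Filter F} (f g : T -> R) (a b : R) :
  filterlim f F (locally a) -> filterlim g F (locally b) ->
  filterlim (fun t => f t * g t) F (locally (a * b)).
Proof. intros Hf Hg. apply (filterlim_comp_2 f g Rmult Hf Hg (filterlim_mult (K := R_AbsRing) a b)). Qed.

Lemma filterlim_plus_R {T : Type} (F : (T -> Prop) -> Prop) {FF : Filter F} (f g : T -> R) (a b : R) :
  filterlim f F (locally a) -> filterlim g F (locally b) ->
  filterlim (fun t => f t + g t) F (locally (a + b)).
Proof. intros Hf Hg. apply (filterlim_comp_2 f g Rplus Hf Hg (filterlim_plus (V := R_NormedModule) a b)). Qed.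

Lemma filterlim_inv_R {T : Type} (F : (T -> Prop) -> Prop) {FF : Filter F} (f : T -> R) (a : R) :
  a <> 0 -> filterlim f F (locally a) -> filterlim (fun t => / f t) F (locally (/ a)).
Proof.
  intros Ha Hf. apply (filterlim_comp _ _ _ f Rinv _ (locally a) _ Hf).
  apply (ex_derive_continuous Rinv a). auto_derive. exact Ha.
Qed.

(** Taylor's inequality at a critical point. Two mean value steps are applied to [F] minus the
    parabola; the intermediate point lies on the same side of [c] as [y], so the argument covers
    both sides at once. *)
Lemma second_order_le (F F1 F2 : R -> R) (c r U : R) :
  (forall y, Rabs (y - c) <= r -> is_derive F y (F1 y)) ->
  (forall y, Rabs (y - c) <= r -> is_derive F1 y (F2 y)) ->
  F1 c = 0 -> (forall y, Rabs (y - c) <= r -> F2 y <= U) ->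
  forall y, Rabs (y - c) <= r -> F y - F c <= U / 2 * (y - c) ^ 2.
Proof.
  intros D1 D2 H0 HU y Hy.
  assert (Hb : forall x t, Rabs (x - c) <= r -> Rmin c x <= t <= Rmax c x -> Rabs (t - c) <= r).
  { intros x t Hx Ht. apply Rabs_le_between in Hx. apply Rabs_le.
    unfold Rmin, Rmax in Ht. destruct (Rle_dec c x); lra. }
  set (G := fun t => F t - U / 2 * (t - c) ^ 2).
  set (G1 := fun t => F1 t - U * (t - c)).
  assert (DG : forall t, Rabs (t - c) <= r -> is_derive G t (G1 t)).
  { intros t Ht. apply (is_derive_minus (V := R_NormedModule) F (fun t => U / 2 * (t - c) ^ 2));
      [apply D1, Ht | auto_derive; [exact I | field]]. }
  assert (DG1 : forall t, Rabs (t - c) <= r -> is_derive G1 t (F2 t - U)).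
  { intros t Ht. apply (is_derive_minus (V := R_NormedModule) F1 (fun t => U * (t - c)));
      [apply D2, Ht | auto_derive; [exact I | ring]]. }
  destruct (MVT_gen G c y G1) as [xi [Hxi E]].
  - intros t Ht. apply DG, (Hb y t Hy). lra.
  - intros t Ht. apply continuity_pt_filterlim, (ex_derive_continuous G).
    eexists. apply DG, (Hb y t Hy), Ht.
  - pose proof (Hb y xi Hy Hxi) as Hxir.
    destruct (MVT_gen G1 c xi (fun t => F2 t - U)) as [eta [Heta E1]].
    + intros t Ht. apply DG1, (Hb xi t Hxir). lra.
    + intros t Ht. apply continuity_pt_filterlim, (ex_derive_continuous G1).
      eexists. apply DG1, (Hb xi t Hxir), Ht.
    + pose proof (HU eta (Hb xi eta Hxir Heta)).
      assert (Ec : G1 c = 0) by (unfold G1; rewrite H0; ring).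
      rewrite Ec in E1.
      assert (Hs : 0 <= (xi - c) * (y - c)).
      { unfold Rmin, Rmax in Hxi. destruct (Rle_dec c y); nra. }
      assert (G y - G c <= 0).
      { rewrite E. replace (G1 xi) with ((F2 eta - U) * (xi - c)) by lra.
        rewrite Rmult_assoc.
        assert (0 <= (U - F2 eta) * ((xi - c) * (y - c))) by (apply Rmult_le_pos; lra). lra. }
      unfold G in *. replace (U / 2 * (c - c) ^ 2) with 0 in * by ring. lra.
Qed.

(** * The golden ratio and the exponent of the summand *)

Lemma golden_sq : golden ^ 2 = golden + 1.
Proof.
  unfold golden. pose proof (sqrt_sqrt 5 ltac:(lra)). nra.
Qed.

Lemma golden_bounds : 8 / 5 < golden < 9 / 5.
Proof.
  unfold golden.
  assert (11 / 5 < sqrt 5) by (apply Rsqr_incrst_0; [rewrite Rsqr_sqrt by lra; unfold Rsqr; lra | lra | apply sqrt_pos]).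
  assert (sqrt 5 < 13 / 5) by (apply Rsqr_incrst_0; [rewrite Rsqr_sqrt by lra; unfold Rsqr; lra | apply sqrt_pos | lra]).
  lra.
Qed.

(** Exponential rate per [n] of [n! m!^3 / ((m-n)! (n+m)!^2)] at [m = y n], by Stirling; the terms
    in [ln n] cancel. It is stationary where [y^3 = (y - 1) (y + 1)^2], that is [y^2 = y + 1]. *)
Definition phase (y : R) : R := 3 * (y * ln y) - (y - 1) * ln (y - 1) - 2 * ((y + 1) * ln (y + 1)).

(** Minus the second derivative of [phase] at [golden]. *)
Definition curvature : R := sqrt 5 / golden ^ 3.

Lemma curvature_pos : 0 < curvature.
Proof.
  pose proof golden_bounds. apply Rdiv_lt_0_compat; [apply sqrt_lt_R0; lra | apply pow_lt; lra].
Qed.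

Lemma sqrt5_golden : sqrt 5 = 2 * golden - 1.
Proof. unfold golden. field. Qed.

Lemma golden_minus_1 : golden - 1 = / golden.
Proof.
  pose proof golden_bounds. pose proof golden_sq.
  apply Rmult_eq_reg_r with golden; [|lra]. rewrite Rinv_l by lra. nra.
Qed.

Lemma ln_golden_plus_1 : ln (golden + 1) = 2 * ln golden.
Proof.
  pose proof golden_bounds. rewrite <- golden_sq. cbn [pow]. rewrite Rmult_1_r, ln_mult by lra. ring.
Qed.

Lemma ln_golden_minus_1 : ln (golden - 1) = - ln golden.
Proof. pose proof golden_bounds. rewrite golden_minus_1. apply ln_Rinv. lra. Qed.

(** As [golden - 1] and [golden + 1] are powers of [golden], the value is [ln golden] times
    [3 phi + (phi - 1) - 4 (phi + 1) = -5]. *)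
Lemma phase_golden : phase golden = - (5 * ln golden).
Proof.
  unfold phase. rewrite ln_golden_plus_1, ln_golden_minus_1. ring.
Qed.

Lemma phase_near_golden (e : R) : 0 < e -> exists d, 0 < d /\ forall y, Rabs (y - golden) <= d ->
  - ((1 + e) * curvature / 2 * (y - golden) ^ 2) <= phase y + 5 * ln golden
    <= - ((1 - e) * curvature / 2 * (y - golden) ^ 2).
Proof.
  intros He. pose proof golden_bounds as Hg. pose proof curvature_pos as Hk.
  set (F1 := fun y => 3 * ln y - ln (y - 1) - 2 * ln (y + 1)).
  set (F2 := fun y => 3 / y - 1 / (y - 1) - 2 / (y + 1)).
  assert (HF2 : F2 golden = - curvature).
  { unfold F2, curvature. rewrite sqrt5_golden. pose proof golden_sq as Hq.
    assert (Hn : golden - 1 <> 0) by lra.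
    field_simplify_eq; [|repeat split; lra].
    assert (H3 : golden ^ 3 = 2 * golden + 1) by (replace (golden ^ 3) with (golden * golden ^ 2) by ring; rewrite Hq; nra).
    assert (H4 : golden ^ 4 = 3 * golden + 2) by (replace (golden ^ 4) with (golden * golden ^ 3) by ring; rewrite H3; nra).
    assert (H5 : golden ^ 5 = 5 * golden + 3) by (replace (golden ^ 5) with (golden * golden ^ 4) by ring; rewrite H4; nra).
    rewrite ?H5, ?H4, ?H3, ?Hq. nra. }
  assert (Hc : locally golden (fun y => F2 golden - e * curvature < F2 y < F2 golden + e * curvature)).
  { assert (Hcont : continuous F2 golden).
    { apply (ex_derive_continuous F2). unfold F2. auto_derive. repeat split; lra. }
    apply (Hcont (fun v => F2 golden - e * curvature < v < F2 golden + e * curvature)).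
    exists (mkposreal (e * curvature) ltac:(apply Rmult_lt_0_compat; lra)).
    intros y Hy. change (Rabs (y - F2 golden) < e * curvature) in Hy. apply Rabs_def2 in Hy. lra. }
  destruct Hc as [d1 Hd1].
  (* The bound [1 / 2] keeps [y > 1], so that [ln (y - 1)] is differentiable on the whole
     interval. *)
  set (r := Rmin (d1 / 2) (1 / 2)).
  pose proof (cond_pos d1).
  assert (Hr : 0 < r) by (unfold r; apply Rmin_pos; lra).
  assert (Hr1 : r <= d1 / 2) by apply Rmin_l. assert (Hr2 : r <= 1 / 2) by apply Rmin_r.
  assert (HF2b : forall y, Rabs (y - golden) <= r ->
     - ((1 + e) * curvature) <= F2 y <= - ((1 - e) * curvature)).
  { intros y Hy. assert (Hb : ball golden d1 y) by (change (Rabs (y - golden) < d1); lra).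
    specialize (Hd1 y Hb). rewrite HF2 in Hd1. lra. }
  assert (Hy1 : forall y, Rabs (y - golden) <= r -> 1 < y).
  { intros y Hy. apply Rabs_le_between in Hy. lra. }
  assert (DF : forall y, Rabs (y - golden) <= r -> is_derive phase y (F1 y)).
  { intros y Hy. specialize (Hy1 y Hy). unfold phase, F1. auto_derive; [repeat split; lra | unfold Rminus; field; lra]. }
  assert (DF1 : forall y, Rabs (y - golden) <= r -> is_derive F1 y (F2 y)).
  { intros y Hy. specialize (Hy1 y Hy). unfold F1, F2. auto_derive; [repeat split; lra | field; lra]. }
  assert (HF1 : F1 golden = 0).
  { unfold F1. rewrite ln_golden_plus_1, ln_golden_minus_1. ring. }
  exists r. split; [exact Hr|]. intros y Hy. split.
  - pose proof (second_order_le (fun y => - phase y) (fun y => - F1 y) (fun y => - F2 y) golden r ((1 + e) * curvature)) as H1.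
    cbv beta in H1. rewrite phase_golden in H1.
    specialize (H1 (fun t Ht => is_derive_opp (V := R_NormedModule) phase t _ (DF t Ht))
      (fun t Ht => is_derive_opp (V := R_NormedModule) F1 t _ (DF1 t Ht)) ltac:(rewrite HF1; ring)
      (fun t Ht => ltac:(pose proof (HF2b t Ht); lra)) y Hy). lra.
  - pose proof (second_order_le phase F1 F2 golden r (- ((1 - e) * curvature)) DF DF1 HF1
      (fun t Ht => proj2 (HF2b t Ht)) y Hy) as H1. rewrite phase_golden in H1. lra.
Qed.

(** * The scaled summand and its Stirling prefactor *)

Definition scaled_summand (z : R) (n m : nat) : R :=
  INR n * INR (fact n) ^ 2 * golden ^ (5 * n) * cosh (PI * z) * summand (z ^ 2) n m.

(** What remains of [sqrt n * scaled_summand] once the exponential is split off, in three groups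
    that converge separately: the Stirling ratios, the products normalised by factorials, and the
    algebraic factors left by the square roots and by [(n + m + 1)^2], in which the powers of [n]
    cancel. *)
Definition prefactor (z : R) (p : nat * nat) : R :=
  let n := fst p in let m := snd p in let y := INR m / INR n in
  stirling_ratio n * stirling_ratio m ^ 3
    * / (stirling_ratio (m - n) * stirling_ratio (n + m) ^ 2)
  * (cosh (PI * z) * (prod_sq (z ^ 2) m / INR (fact m) ^ 2)
     * / (prod_sq (4 * z ^ 2) (S (n + m)) / INR (fact (S (n + m))) ^ 2))
  * (sqrt (y / (y - 1)) * (y / (y + 1)) * / (y + 1 + 1 / INR n) ^ 2).

Lemma fact_stirling (n : nat) : (0 < n)%nat ->
  INR (fact n) = stirling_ratio n * sqrt (INR n) * exp (INR n * ln (INR n) - INR n).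
Proof.
  intros Hn. apply lt_0_INR in Hn. unfold stirling_ratio.
  pose proof (exp_pos (INR n * ln (INR n) - INR n)). pose proof (sqrt_lt_R0 _ Hn).
  field. lra.
Qed.

Lemma stirling_ratio_pos (n : nat) : (0 < n)%nat -> 0 < stirling_ratio n.
Proof. intros Hn. rewrite stirling_ratio_exp by exact Hn. apply exp_pos. Qed.

Lemma scaled_summand_eq (z : R) (n m : nat) : (0 < n < m)%nat ->
  sqrt (INR n) * scaled_summand z n m
  = prefactor z (n, m) * exp (INR n * (phase (INR m / INR n) + 5 * ln golden)).
Proof.
  intros [Hn Hm]. pose proof golden_bounds as Hg.
  unfold scaled_summand, prefactor, summand. cbn [fst snd].
  assert (Ef : falling n m = INR (fact m) / INR (fact (m - n))).
  { pose proof (falling_fact n (m - n)) as E. replace (n + (m - n))%nat with m in E by lia. exact E. }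
  rewrite Ef, fact_S.
  rewrite (fact_stirling n), (fact_stirling m), (fact_stirling (m - n)), (fact_stirling (n + m)) by lia.
  pose proof (stirling_ratio_pos n ltac:(lia)). pose proof (stirling_ratio_pos m ltac:(lia)).
  pose proof (stirling_ratio_pos (m - n) ltac:(lia)). pose proof (stirling_ratio_pos (n + m) ltac:(lia)).
  rewrite plus_INR, minus_INR by lia.
  apply lt_0_INR in Hn. apply lt_INR in Hm.
  set (s1 := stirling_ratio n) in *. set (s2 := stirling_ratio m) in *.
  set (s3 := stirling_ratio (m - n)) in *. set (s4 := stirling_ratio (n + m)) in *.
  pose proof (prod_sq_pos (z ^ 2) m ltac:(nra)). pose proof (prod_sq_pos (4 * z ^ 2) (S (n + m)) ltac:(nra)).
  set (P := prod_sq (z ^ 2) m) in *. set (Q := prod_sq (4 * z ^ 2) (S (n + m))) in *.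
  set (h := cosh (PI * z)).
  replace (golden ^ (5 * n)) with (exp (5 * INR n * ln golden)).
  2:{ change (Rpower golden (5 * INR n) = golden ^ (5 * n)). rewrite <- Rpower_pow by lra.
      rewrite mult_INR. f_equal. simpl. ring. }
  set (x := INR n) in *. set (y := INR m) in *.
  replace (exp (x * (phase (y / x) + 5 * ln golden)))
    with (exp (5 * x * ln golden) * (exp (x * ln x - x) * exp (y * ln y - y) ^ 3
      / (exp ((y - x) * ln (y - x) - (y - x)) * exp ((x + y) * ln (x + y) - (x + y)) ^ 2))).
  2:{ cbn [pow]. rewrite !Rmult_1_r. unfold Rdiv at 1. rewrite <- !exp_plus, <- exp_Ropp, <- !exp_plus. f_equal.
      unfold phase.
      replace (y / x - 1) with ((y - x) / x) by (field; lra).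
      replace (y / x + 1) with ((x + y) / x) by (field; lra).
      rewrite !ln_div by lra. field. lra. }
  replace (y / x / (y / x - 1)) with (y / (y - x)) by (field; lra).
  rewrite sqrt_div_alt by lra.
  assert (Hsx : sqrt x * sqrt x = x) by (apply sqrt_sqrt; lra).
  assert (Hsy : sqrt y * sqrt y = y) by (apply sqrt_sqrt; lra).
  assert (Hsp : sqrt (x + y) * sqrt (x + y) = x + y) by (apply sqrt_sqrt; lra).
  pose proof (sqrt_lt_R0 x Hn). pose proof (sqrt_lt_R0 y ltac:(lra)).
  pose proof (sqrt_lt_R0 (y - x) ltac:(lra)). pose proof (sqrt_lt_R0 (x + y) ltac:(lra)).
  set (rx := sqrt x) in *. set (ry := sqrt y) in *. set (rd := sqrt (y - x)) in *. set (rp := sqrt (x + y)) in *.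
  pose proof (exp_pos (x * ln x - x)). pose proof (exp_pos (y * ln y - y)).
  pose proof (exp_pos ((y - x) * ln (y - x) - (y - x))). pose proof (exp_pos ((x + y) * ln (x + y) - (x + y))).
  set (e1 := exp (x * ln x - x)) in *. set (e2 := exp (y * ln y - y)) in *.
  set (e3 := exp ((y - x) * ln (y - x) - (y - x))) in *. set (e4 := exp ((x + y) * ln (x + y) - (x + y))) in *.
  set (eg := exp (5 * x * ln golden)).
  transitivity (rx * rx * (x * (s1 * e1) * eg * h * (s2 * ry * e2) / (s3 * rd * e3) * P / Q)).
  (* The square roots are opaque to [field]; both sides are arranged so that they occur as squares,
     which are then replaced. *)
  { field. repeat split; lra. }
  transitivity (s1 * s2 ^ 3 * / (s3 * s4 ^ 2) *
    (h * (P / ((s2 * e2) ^ 2 * (ry * ry))) * / (Q / ((x + y + 1) ^ 2 * ((s4 * e4) ^ 2 * (rp * rp))))) *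
    (ry / rd * (y / (x + y)) * / ((y + x + 1) / x) ^ 2) * (eg * (e1 * e2 ^ 3 / (e3 * e4 ^ 2)))).
  { rewrite Hsx, Hsy, Hsp. field. repeat split; lra. }
  { field. repeat split; lra. }
Qed.

Lemma filterlim_continuous_R {T : Type} (F : (T -> Prop) -> Prop) (h : R -> R) (f : T -> R) (a : R) :
  continuous h a -> filterlim f F (locally a) -> filterlim (fun t => h (f t)) F (locally (h a)).
Proof. intros Hh Hf. apply (filterlim_comp _ _ _ f h _ (locally a) _ Hf Hh). Qed.

Lemma filterlim_pow_R {T : Type} (F : (T -> Prop) -> Prop) (f : T -> R) (a : R) (k : nat) :
  filterlim f F (locally a) -> filterlim (fun t => f t ^ k) F (locally (a ^ k)).
Proof.
  apply (filterlim_continuous_R F (fun x => x ^ k)).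
  apply (ex_derive_continuous (fun x => x ^ k)). auto_derive. exact I.
Qed.

Lemma sinh_neq_0 (x : R) : x <> 0 -> sinh x <> 0.
Proof.
  intros Hx. unfold sinh. intros E.
  assert (E' : exp x = exp (- x)) by lra. apply exp_inv in E'. lra.
Qed.

Lemma sinh_double (x : R) : sinh (2 * x) = 2 * sinh x * cosh x.
Proof.
  unfold sinh, cosh. replace (2 * x) with (x + x) by ring.
  rewrite Ropp_plus_distr, !exp_plus. field.
Qed.

Lemma cosh_pos (x : R) : 0 < cosh x.
Proof. pose proof (cosh_1_le x). lra. Qed.

Lemma PI_mult_neq_0 (z : R) : z <> 0 -> PI * z <> 0.
Proof. intros Hz. apply Rmult_integral_contrapositive. split; [apply PI_neq0 | exact Hz]. Qed.

Lemma sinh_prod_mult (z k : R) : k * z <> 0 ->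
  is_lim_seq (fun m => prod_sq (k ^ 2 * z ^ 2) m / INR (fact m) ^ 2) (sinh (k * PI * z) / (k * PI * z)).
Proof.
  intros Hz. pose proof (sinh_prod (k * z) Hz) as H.
  replace (PI * (k * z)) with (k * PI * z) in H by ring.
  replace ((k * z) ^ 2) with (k ^ 2 * z ^ 2) in H by ring. exact H.
Qed.

Lemma near_golden_order : near_ray golden (fun p => (0 < fst p < snd p)%nat).
Proof.
  exists (1 / 10). split; [lra|]. exists 1%nat. intros n m Hn Hm.
  cbn [fst snd]. split; [lia|]. apply INR_lt. apply le_INR in Hn. change (INR 1) with 1 in Hn.
  pose proof golden_bounds. apply Rabs_le_between in Hm. nra.
Qed.

(** The algebraic factors at [golden] are [sqrt (phi / (phi - 1)) = phi],
    [phi / (phi + 1) = 1 / phi] and [(phi + 1)^(-2) = phi^(-4)]; the Stirling ratios leave one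
    [sqrt (2 * PI)]. *)
Definition amplitude : R := sqrt (2 * PI) / golden ^ 4.

Lemma amplitude_pos : 0 < amplitude.
Proof.
  pose proof golden_bounds. pose proof PI_RGT_0.
  apply Rdiv_lt_0_compat; [apply sqrt_lt_R0; lra | apply pow_lt; lra].
Qed.

Lemma prefactor_lim (z : R) : z <> 0 ->
  filterlim (prefactor z) (near_ray golden) (locally amplitude).
Proof.
  intros Hz. pose proof golden_bounds as Hg. pose proof PI_RGT_0 as HPI.
  assert (Hfst : filterlim (fun p : nat * nat => fst p) (near_ray golden) eventually) by apply near_ray_fst.
  assert (Hsnd : filterlim (fun p : nat * nat => snd p) (near_ray golden) eventually).
  { apply (near_ray_to_infty golden (fun _ m => m)). exists 1. split; [lra|].
    exists (1 / 10). split; [lra|]. exists 0%nat. intros n m _ Hm. cbn [fst snd].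
    pose proof (pos_INR n). apply Rabs_le_between in Hm. nra. }
  assert (Hsub : filterlim (fun p : nat * nat => (snd p - fst p)%nat) (near_ray golden) eventually).
  { apply (near_ray_to_infty golden (fun n m => (m - n)%nat)). exists (1 / 10). split; [lra|].
    exists (1 / 10). split; [lra|]. exists 0%nat. intros n m _ Hm. cbn [fst snd].
    pose proof (pos_INR n). apply Rabs_le_between in Hm.
    assert (INR n <= INR m) by nra. rewrite minus_INR by (apply INR_le; assumption). nra. }
  assert (Hadd : filterlim (fun p : nat * nat => (fst p + snd p)%nat) (near_ray golden) eventually).
  { apply (near_ray_to_infty golden (fun n m => (n + m)%nat)). exists 1. split; [lra|].
    exists 1. split; [lra|]. exists 0%nat. intros n m _ Hm. cbn [fst snd].
    rewrite plus_INR. pose proof (pos_INR m). lra. }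
  assert (HaddS : filterlim (fun p : nat * nat => S (fst p + snd p)) (near_ray golden) eventually).
  { apply (near_ray_to_infty golden (fun n m => S (n + m))). exists 1. split; [lra|].
    exists 1. split; [lra|]. exists 0%nat. intros n m _ Hm. cbn [fst snd].
    rewrite S_INR, plus_INR. pose proof (pos_INR m). lra. }
  pose proof (near_ray_ratio golden) as Hy.
  set (s := sqrt (2 * PI)).
  assert (Hs : 0 < s) by (apply sqrt_lt_R0; lra).
  pose proof (sinh_neq_0 _ (PI_mult_neq_0 z Hz)) as Hsh. pose proof (cosh_pos (PI * z)) as Hch.
  set (A := sinh (1 * PI * z) / (1 * PI * z)). set (B := sinh (2 * PI * z) / (2 * PI * z)).
  (* The duplication formula: because of it the factor [cosh (PI z)] removes all dependence on [z]
     from the limit. *)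
  assert (HB : B = cosh (PI * z) * A).
  { unfold A, B. rewrite (Rmult_assoc 2), sinh_double, (Rmult_assoc 1), Rmult_1_l. field.
    split; [exact Hz | lra]. }
  assert (HA : A <> 0).
  { unfold A. rewrite Rmult_1_l. intros E. apply Hsh.
    replace (sinh (PI * z)) with (sinh (PI * z) / (PI * z) * (PI * z)) by (field; split; [exact Hz | lra]).
    rewrite E. ring. }
  assert (HB0 : B <> 0) by (rewrite HB; apply Rmult_integral_contrapositive; split; [lra | exact HA]).
  assert (EA : amplitude = s * s ^ 3 * / (s * s ^ 2) * (cosh (PI * z) * A * / B)
     * (sqrt (golden / (golden - 1)) * (golden / (golden + 1)) * / (golden + 1 + 0) ^ 2)).
  { rewrite HB. replace (golden / (golden - 1)) with (golden ^ 2)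
      by (rewrite golden_minus_1; field; lra).
    rewrite sqrt_pow2 by lra. rewrite Rplus_0_r, <- golden_sq. unfold amplitude. fold s.
    field. repeat split; try lra; assumption. }
  rewrite EA.
  assert (Sg : forall g : nat * nat -> nat, filterlim g (near_ray golden) eventually ->
     filterlim (fun p => stirling_ratio (g p)) (near_ray golden) (locally s)).
  { intros g Hgl. apply (filterlim_comp _ _ _ g stirling_ratio _ eventually _ Hgl). exact stirling. }
  unfold prefactor. cbv zeta.
  apply filterlim_mult_R; [apply near_ray_filter | |].
  apply filterlim_mult_R; [apply near_ray_filter | |].
  - apply filterlim_mult_R; [apply near_ray_filter | |].
    + apply filterlim_mult_R; [apply near_ray_filter | apply Sg, Hfst | apply filterlim_pow_R, Sg, Hsnd].
    + apply filterlim_inv_R; [apply near_ray_filter | |].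
      * apply Rgt_not_eq. apply Rmult_lt_0_compat; [exact Hs | apply pow_lt, Hs].
      * apply filterlim_mult_R; [apply near_ray_filter | apply (Sg (fun p => (snd p - fst p)%nat)), Hsub |
          apply (filterlim_pow_R _ (fun p => stirling_ratio (fst p + snd p))), (Sg (fun p => (fst p + snd p)%nat)), Hadd].
  - apply filterlim_mult_R; [apply near_ray_filter | |].
    + apply filterlim_mult_R; [apply near_ray_filter | apply filterlim_const |].
      apply (filterlim_comp _ _ _ snd (fun m => prod_sq (z ^ 2) m / INR (fact m) ^ 2) _ eventually _ Hsnd).
      pose proof (sinh_prod_mult z 1 ltac:(lra)) as H.
      replace (1 ^ 2 * z ^ 2) with (z ^ 2) in H by ring. exact H.
    + apply filterlim_inv_R; [apply near_ray_filter | exact HB0 |].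
      apply (filterlim_comp _ _ _ (fun p : nat * nat => S (fst p + snd p))
        (fun m => prod_sq (4 * z ^ 2) m / INR (fact m) ^ 2) _ eventually _ HaddS).
      pose proof (sinh_prod_mult z 2 ltac:(lra)) as H.
      replace (2 ^ 2 * z ^ 2) with (4 * z ^ 2) in H by ring. exact H.
  - apply filterlim_mult_R; [apply near_ray_filter | |].
    + apply filterlim_mult_R; [apply near_ray_filter | |].
      * apply (filterlim_continuous_R _ (fun y => sqrt (y / (y - 1))) (fun p => INR (snd p) / INR (fst p))); [|exact Hy].
        apply (ex_derive_continuous (fun y => sqrt (y / (y - 1)))). auto_derive.
        repeat split; try lra. apply Rmult_lt_0_compat; [lra | apply Rinv_0_lt_compat; lra].
      * apply (filterlim_continuous_R _ (fun y => y / (y + 1)) (fun p => INR (snd p) / INR (fst p))); [|exact Hy].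
        apply (ex_derive_continuous (fun y => y / (y + 1))). auto_derive. lra.
    + apply filterlim_inv_R; [apply near_ray_filter | apply pow_nonzero; lra |].
      apply (filterlim_pow_R _ (fun p => INR (snd p) / INR (fst p) + 1 + 1 / INR (fst p))).
      apply filterlim_plus_R; [apply near_ray_filter | |].
      * apply filterlim_plus_R; [apply near_ray_filter | exact Hy | apply filterlim_const].
      * apply (filterlim_comp _ _ _ fst (fun n => 1 / INR n) _ eventually _ Hfst). apply (is_lim_seq_div_INR 1).
Qed.

(** Gaussian parameter in the variable [m]: [n * (curvature / 2) * (m / n - phi)^2] equals
    [half_curvature * (m - phi n)^2 / n]. *)
Definition half_curvature : R := curvature / 2.

Lemma half_curvature_pos : 0 < half_curvature.
Proof. pose proof curvature_pos. unfold half_curvature. lra. Qed.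

Lemma scaled_summand_window (z e : R) : z <> 0 -> 0 < e < 1 ->
  near_ray golden (fun p => let n := fst p in let m := snd p in
    let s := INR m - golden * INR n in
    (1 - e) * exp (- ((1 + e) * half_curvature / INR n * s ^ 2))
      <= sqrt (INR n) * (scaled_summand z n m / amplitude)
      <= (1 + e) * exp (- ((1 - e) * half_curvature / INR n * s ^ 2))).
Proof.
  intros Hz He. pose proof amplitude_pos as HA.
  assert (Hpre : near_ray golden (fun p => (1 - e) * amplitude <= prefactor z p <= (1 + e) * amplitude)).
  { apply (prefactor_lim z Hz (fun v => (1 - e) * amplitude <= v <= (1 + e) * amplitude)).
    exists (mkposreal (e * amplitude) ltac:(apply Rmult_lt_0_compat; lra)).
    intros v Hv. change (Rabs (v - amplitude) < e * amplitude) in Hv. apply Rabs_def2 in Hv. lra. }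
  destruct (phase_near_golden e (proj1 He)) as [d [Hd Hph]].
  assert (Hy : near_ray golden (fun p => Rabs (INR (snd p) / INR (fst p) - golden) <= d)).
  { apply (near_ray_ratio golden (fun v => Rabs (v - golden) <= d)).
    exists (mkposreal d Hd). intros v Hv. left. exact Hv. }
  generalize (filter_and _ _ (filter_and _ _ Hpre Hy) near_golden_order).
  apply (filter_imp (F := near_ray golden)). intros [n m] [[H1 H2] [Hn Hm]]. cbn [fst snd] in *.
  cbv zeta.
  replace (sqrt (INR n) * (scaled_summand z n m / amplitude))
    with (sqrt (INR n) * scaled_summand z n m / amplitude) by (unfold Rdiv; ring).
  rewrite scaled_summand_eq by lia.
  specialize (Hph _ H2). apply lt_0_INR in Hn as HnR.
  set (x := INR n) in *. set (y := INR m) in *. set (F := phase (y / x) + 5 * ln golden) in *.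
  assert (Es : forall k, k / x * (y - golden * x) ^ 2 = x * (k * (y / x - golden) ^ 2))
    by (intros k; field; lra).
  rewrite !Es.
  assert (Hlow : exp (- (x * ((1 + e) * half_curvature * (y / x - golden) ^ 2))) <= exp (x * F)).
  { apply exp_le. rewrite Ropp_mult_distr_r. apply Rmult_le_compat_l; [lra|]. unfold half_curvature. lra. }
  assert (Hup : exp (x * F) <= exp (- (x * ((1 - e) * half_curvature * (y / x - golden) ^ 2)))).
  { apply exp_le. rewrite Ropp_mult_distr_r. apply Rmult_le_compat_l; [lra|]. unfold half_curvature. lra. }
  set (El := exp (- (x * ((1 + e) * half_curvature * (y / x - golden) ^ 2)))) in *.
  set (Eu := exp (- (x * ((1 - e) * half_curvature * (y / x - golden) ^ 2)))) in *.
  assert (0 < El) by apply exp_pos. pose proof (exp_pos (x * F)).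
  set (p := prefactor z (n, m)) in *.
  assert (Hp : 1 - e <= p / amplitude <= 1 + e).
  { split; apply Rmult_le_reg_r with amplitude; try lra;
      replace (p / amplitude * amplitude) with p by (field; lra); lra. }
  assert (Hpa : 0 < p / amplitude) by lra.
  replace (p * exp (x * F) / amplitude) with (p / amplitude * exp (x * F)) by (field; lra).
  split.
  - apply Rle_trans with (p / amplitude * El); [apply Rmult_le_compat_r; lra | apply Rmult_le_compat_l; lra].
  - apply Rmult_le_compat; lra.
Qed.

Lemma scaled_summand_nonneg (z : R) (n m : nat) : 0 <= scaled_summand z n m.
Proof.
  unfold scaled_summand. pose proof (cosh_pos (PI * z)). pose proof golden_bounds.
  apply Rmult_le_pos; [|apply summand_bounds; nra].
  apply Rmult_le_pos; [|lra]. apply Rmult_le_pos; [|apply pow_le; lra].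
  apply Rmult_le_pos; [apply pos_INR | apply pow_le, pos_INR].
Qed.

(** * Term ratios away from the saddle *)

Lemma summand_S (c : R) (n m : nat) : 0 <= c ->
  summand c n (S m) * ((INR m + 1 - INR n) * ((INR m + INR n + 2) ^ 2 + 4 * c))
  = summand c n m * ((INR m + 1) * ((INR m + 1) ^ 2 + c)).
Proof.
  intros Hc. unfold summand.
  assert (Ef : falling n (S m) * (INR m + 1 - INR n) = (INR m + 1) * falling n m).
  { rewrite <- falling_S_S. cbn [falling]. rewrite S_INR. ring. }
  replace (n + S m)%nat with (S (n + m)) by lia.
  rewrite (prod_sq_S (4 * c) (S (n + m))), (prod_sq_S c m), S_INR, plus_INR.
  pose proof (prod_sq_pos (4 * c) (S (n + m)) ltac:(lra)). pose proof (INR_fact_lt_0 n).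
  pose proof (pos_INR n). pose proof (pos_INR m).
  set (Q := prod_sq (4 * c) (S (n + m))) in *. set (f := INR (fact n)) in *. set (P := prod_sq c m).
  transitivity ((falling n (S m) * (INR m + 1 - INR n)) * (P * ((INR m + 1) ^ 2 + c)) / (f * Q)).
  { field. repeat split; try lra. apply Rgt_not_eq. nra. }
  rewrite Ef. field. split; lra.
Qed.

Lemma scaled_summand_S (z : R) (n m : nat) :
  scaled_summand z n (S m) * ((INR m + 1 - INR n) * ((INR m + INR n + 2) ^ 2 + 4 * z ^ 2))
  = scaled_summand z n m * ((INR m + 1) * ((INR m + 1) ^ 2 + z ^ 2)).
Proof.
  unfold scaled_summand. rewrite !Rmult_assoc, summand_S by nra. reflexivity.
Qed.

(** With [x = m + 1] and [N = n], the leading part of the comparison is [x^3 - (x - N) (x + N)^2 = N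
    (N^2 + N x - x^2)], and the bracket factors as [(phi N - x) (x + (phi - 1) N)]. *)
Lemma scaled_summand_incr (z d : R) : 0 < d ->
  eventually (fun n => forall m, INR m + 1 <= (golden - d) * INR n ->
    scaled_summand z n m <= scaled_summand z n (S m)).
Proof.
  intros Hd. pose proof golden_bounds as Hg. pose proof golden_sq as Hq.
  pose proof (pow2_ge_0 z) as Hz. set (c := z ^ 2) in *.
  (* The lower-order terms amount to at most [7 N^2 + 4 c N]; beyond this threshold the margin
     [d N^3] absorbs them. *)
  assert (0 < (8 + 4 * c) / d) by (apply Rdiv_lt_0_compat; lra).
  apply (filter_imp (fun n => 1 + (8 + 4 * c) / d <= INR n)); [|apply eventually_ge].
  intros n Hn m Hm.
  destruct (Nat.lt_ge_cases m n) as [Hmn|Hmn].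
  { unfold scaled_summand at 1. unfold summand. rewrite falling_0 by exact Hmn.
    apply Rle_trans with 0; [right; unfold Rdiv; ring | apply scaled_summand_nonneg]. }
  apply le_INR in Hmn. pose proof (scaled_summand_S z n m) as E. fold c in E.
  pose proof (scaled_summand_nonneg z n m) as H0.
  set (N := INR n) in *. set (x := INR m + 1) in *.
  replace (INR m + N + 2) with (x + N + 1) in E by (unfold x; ring).
  assert (HxN : N + 1 <= x) by (unfold x; lra).
  assert (Hdn : 8 + 4 * c <= d * N).
  { apply Rle_trans with (d * ((8 + 4 * c) / d)); [right; field; lra | apply Rmult_le_compat_l; lra]. }
  assert (Hpoly : (x - N) * ((x + N + 1) ^ 2 + 4 * c) <= x * (x ^ 2 + c)).
  { assert (Hx2 : x <= 2 * N) by nra.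
    assert (A1 : N ^ 2 + N * x - x ^ 2 = (golden * N - x) * (x + (golden - 1) * N)) by nra.
    assert (A2 : d * N * N <= N ^ 2 + N * x - x ^ 2).
    { rewrite A1. apply Rmult_le_compat; nra. }
    assert (A3 : (x - N) * (2 * x + 2 * N + 1) <= N * (7 * N)) by (apply Rmult_le_compat; lra).
    assert (A4 : c * (x - N) <= c * N) by (apply Rmult_le_compat_l; lra).
    assert (A5 : (8 + 4 * c) * N * N <= d * N * N * N) by (repeat apply Rmult_le_compat_r; nra).
    assert (A6 : N * (d * N * N) <= N * (N ^ 2 + N * x - x ^ 2)) by (apply Rmult_le_compat_l; lra).
    assert (A7 : c * N <= c * N * N) by (assert (0 <= c * N * (N - 1)) by (apply Rmult_le_pos; [apply Rmult_le_pos|]; lra); lra).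
    assert (0 <= c * x) by (apply Rmult_le_pos; lra).
    assert (E2 : x * (x ^ 2 + c) - (x - N) * ((x + N + 1) ^ 2 + 4 * c)
      = N * (N ^ 2 + N * x - x ^ 2) - (x - N) * (2 * x + 2 * N + 1) + c * x - 4 * (c * (x - N))) by ring.
    pose proof (pow2_ge_0 N). lra. }
  assert (Hpos : 0 < (x - N) * ((x + N + 1) ^ 2 + 4 * c)) by (apply Rmult_lt_0_compat; nra).
  apply Rmult_le_reg_r with ((x - N) * ((x + N + 1) ^ 2 + 4 * c)); [exact Hpos|].
  rewrite E. apply Rmult_le_compat_l; [exact H0 | exact Hpoly].
Qed.

(** The weight [m^2] makes the right tail comparable with the series of inverse squares, uniformly
    in [n]. The comparison loses only terms of order [x^4] against a gain of order [N x^4]. *)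
Lemma scaled_summand_decr (z d : R) : 0 < d ->
  eventually (fun n => forall m, (golden + d) * INR n <= INR m ->
    INR (S m) ^ 2 * scaled_summand z n (S m) <= INR m ^ 2 * scaled_summand z n m).
Proof.
  intros Hd. pose proof golden_bounds as Hg. pose proof golden_sq as Hq.
  pose proof (pow2_ge_0 z) as Hz. set (c := z ^ 2) in *.
  (* For [x >= (phi + d) N] this is the constant with [x - phi N >= d' x]. *)
  set (d' := d / (golden + d)).
  assert (Hd' : 0 < d') by (apply Rdiv_lt_0_compat; lra).
  (* For [x >= 1], [(x + 1)^5 <= x^5 + 31 x^4] and [(x + 1)^3 <= 8 x^4]. *)
  assert (0 < (31 + 8 * c) / d') by (apply Rdiv_lt_0_compat; lra).
  apply (filter_imp (fun n => 1 + (31 + 8 * c) / d' <= INR n)); [|apply eventually_ge].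
  intros n Hn m Hm. rewrite S_INR.
  pose proof (scaled_summand_S z n m) as E. fold c in E.
  pose proof (scaled_summand_nonneg z n m) as H0.
  set (N := INR n) in *. set (x := INR m) in *.
  assert (Hdn : 31 + 8 * c <= d' * N).
  { apply Rle_trans with (d' * ((31 + 8 * c) / d')); [right; field; lra | apply Rmult_le_compat_l; lra]. }
  assert (Hx : golden * N + d * N <= x) by lra.
  assert (HdN : 0 < d * N) by (apply Rmult_lt_0_compat; lra).
  assert (HxN : N < x) by nra.
  assert (Hpoly : (x + 1) ^ 2 * ((x + 1) * ((x + 1) ^ 2 + c)) <= x ^ 2 * ((x + 1 - N) * ((x + N + 2) ^ 2 + 4 * c))).
  { assert (A1 : x ^ 2 - N * x - N ^ 2 = (x - golden * N) * (x + (golden - 1) * N)) by nra.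
    assert (A2 : d' * x <= x - golden * N).
    { apply Rmult_le_reg_r with (golden + d); [lra|].
      replace (d' * x * (golden + d)) with (d * x) by (unfold d'; field; lra). nra. }
    assert (A3 : d' * x * x <= x ^ 2 - N * x - N ^ 2).
    { rewrite A1. apply Rmult_le_compat; nra. }
    assert (A4 : x ^ 3 + N * (x ^ 2 - N * x - N ^ 2) <= (x + 1 - N) * ((x + N + 2) ^ 2 + 4 * c)).
    { assert (0 <= (x - N) * (4 * (x + N) + 4)) by (apply Rmult_le_pos; lra).
      assert (0 <= (x + 1 - N) * (4 * c)) by (apply Rmult_le_pos; lra).
      assert (0 <= (x + N + 2) ^ 2) by apply pow2_ge_0. nra. }
    assert (A5 : (31 + 8 * c) * (x * x) <= N * (x ^ 2 - N * x - N ^ 2)).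
    { apply Rle_trans with (N * (d' * x * x)).
      - replace (N * (d' * x * x)) with (d' * N * (x * x)) by ring. apply Rmult_le_compat_r; nra.
      - apply Rmult_le_compat_l; lra. }
    apply Rle_trans with (x ^ 2 * (x ^ 3 + (31 + 8 * c) * (x * x))).
    2:{ apply Rmult_le_compat_l; [apply pow2_ge_0 | lra]. }
    assert (B1 : forall k, x ^ k <= x ^ S k) by (intros k; apply Rle_pow; [lra | lia]).
    pose proof (B1 0%nat) as Q0. pose proof (B1 1%nat) as Q1. pose proof (B1 2%nat) as Q2. pose proof (B1 3%nat) as Q3.
    assert (C1 : (x + 1) ^ 3 <= 8 * x ^ 4) by lra.
    assert (C2 : c * (x + 1) ^ 3 <= c * (8 * x ^ 4)) by (apply Rmult_le_compat_l; lra).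
    replace ((x + 1) ^ 2 * ((x + 1) * ((x + 1) ^ 2 + c)))
      with (x ^ 5 + (5 * x ^ 4 + 10 * x ^ 3 + 10 * x ^ 2 + 5 * x + 1) + c * (x + 1) ^ 3) by ring.
    replace (x ^ 2 * (x ^ 3 + (31 + 8 * c) * (x * x))) with (x ^ 5 + 31 * x ^ 4 + c * (8 * x ^ 4)) by ring.
    lra. }
  assert (Hpos : 0 < (x + 1 - N) * ((x + N + 2) ^ 2 + 4 * c)) by (apply Rmult_lt_0_compat; nra).
  apply Rmult_le_reg_r with ((x + 1 - N) * ((x + N + 2) ^ 2 + 4 * c)); [exact Hpos|].
  rewrite Rmult_assoc, E.
  replace ((x + 1) ^ 2 * (scaled_summand z n m * ((x + 1) * ((x + 1) ^ 2 + c))))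
    with (scaled_summand z n m * ((x + 1) ^ 2 * ((x + 1) * ((x + 1) ^ 2 + c)))) by ring.
  replace (x ^ 2 * scaled_summand z n m * ((x + 1 - N) * ((x + N + 2) ^ 2 + 4 * c)))
    with (scaled_summand z n m * (x ^ 2 * ((x + 1 - N) * ((x + N + 2) ^ 2 + 4 * c)))) by ring.
  apply Rmult_le_compat_l; [exact H0 | exact Hpoly].
Qed.

(** * Asymptotics of the series *)

(** At distance of order [n] from the peak, but still inside the cone where the Gaussian bound
    holds, the terms are exponentially small. This strip is the starting point from which
    monotonicity controls everything further out. *)
Lemma scaled_summand_edge (z : R) : z <> 0 ->
  exists d0, 0 < d0 /\ forall d e, 0 < d -> 2 * d <= d0 -> 0 < e ->
    eventually (fun n => forall m, d * INR n <= Rabs (INR m - golden * INR n) <= 2 * d * INR n ->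
      INR n ^ 2 * scaled_summand z n m <= e).
Proof.
  intros Hz. pose proof amplitude_pos as HA. pose proof half_curvature_pos as Hk.
  destruct (scaled_summand_window z (1 / 2) Hz ltac:(lra)) as [d0 [Hd0 [N0 W]]].
  exists d0. split; [exact Hd0|]. intros d e Hd Hd2 He.
  (* Half of the available exponent: the bound is then [exp (- c n) ^ 2], and its product with [n^2]
     is the square of the sequence in [n_exp_lim]. *)
  set (c := half_curvature / 2 * d ^ 2 / 2).
  assert (Hc : 0 < c).
  { unfold c. assert (0 < d ^ 2) by (apply pow_lt; lra).
    assert (0 < half_curvature / 2 * d ^ 2) by (apply Rmult_lt_0_compat; lra). lra. }
  set (b := Rmin 1 (e / (3 / 2 * amplitude))).
  assert (Hb0 : 0 < e / (3 / 2 * amplitude)) by (apply Rdiv_lt_0_compat; lra).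
  assert (Hb : 0 < b) by (unfold b; apply Rmin_pos; lra).
  assert (Hb1 : b <= 1) by apply Rmin_l. assert (Hb2 : b <= e / (3 / 2 * amplitude)) by apply Rmin_r.
  pose proof (is_lim_seq_lt _ _ b (n_exp_lim c Hc) Hb) as Hexp.
  assert (HN : eventually (fun n => (N0 <= n)%nat)) by (exists N0; intros; assumption).
  generalize (filter_and _ _ (filter_and _ _ Hexp HN) (eventually_ge 1)).
  apply filter_imp. intros n [[Hn1 Hn2] Hn3] m [Hm1 Hm2].
  assert (Hm3 : Rabs (INR m - golden * INR n) <= d0 * INR n).
  { apply Rle_trans with (1 := Hm2). apply Rmult_le_compat_r; lra. }
  specialize (W n m Hn2 Hm3). cbn [fst snd] in W. cbv zeta in W. destruct W as [_ W].
  pose proof (scaled_summand_nonneg z n m) as HT0.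
  set (T := scaled_summand z n m) in *. set (x := INR n) in *. set (s := INR m - golden * x) in *.
  assert (Hs2 : d ^ 2 * x ^ 2 <= s ^ 2).
  { rewrite <- (pow2_abs s). replace (d ^ 2 * x ^ 2) with ((d * x) ^ 2) by ring.
    apply pow_incr. split; [apply Rmult_le_pos; lra | exact Hm1]. }
  assert (HE : exp (- ((1 - 1 / 2) * half_curvature / x * s ^ 2)) <= exp (- (c * x)) ^ 2).
  { replace (exp (- (c * x)) ^ 2) with (exp (- (c * x)) * exp (- (c * x))) by ring.
    rewrite <- exp_plus. apply exp_le.
    replace (- (c * x) + - (c * x)) with (- (half_curvature / 2 / x * (d ^ 2 * x ^ 2))) by (unfold c; field; lra).
    apply Ropp_le_contravar.
    replace ((1 - 1 / 2) * half_curvature / x * s ^ 2) with (half_curvature / 2 / x * s ^ 2) by (field; lra).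
    apply Rmult_le_compat_l; [|exact Hs2]. left. apply Rdiv_lt_0_compat; lra. }
  assert (Hsx : 1 <= sqrt x) by (rewrite <- sqrt_1; apply sqrt_le_1_alt; lra).
  assert (HT : T / amplitude <= 3 / 2 * exp (- (c * x)) ^ 2).
  { assert (0 <= T / amplitude) by (apply Rmult_le_pos; [exact HT0 | left; apply Rinv_0_lt_compat, HA]).
    apply Rle_trans with (sqrt x * (T / amplitude)).
    - replace (T / amplitude) with (1 * (T / amplitude)) at 1 by ring. apply Rmult_le_compat_r; lra.
    - apply Rle_trans with (1 := W). replace (1 + 1 / 2) with (3 / 2) by field.
      apply Rmult_le_compat_l; lra. }
  assert (HT' : T <= 3 / 2 * amplitude * exp (- (c * x)) ^ 2).
  { replace T with (T / amplitude * amplitude) by (field; lra).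
    replace (3 / 2 * amplitude * exp (- (c * x)) ^ 2) with (3 / 2 * exp (- (c * x)) ^ 2 * amplitude) by ring.
    apply Rmult_le_compat_r; lra. }
  assert (Hu : 0 <= x * exp (- (c * x))) by (apply Rmult_le_pos; [lra | left; apply exp_pos]).
  apply Rle_trans with (3 / 2 * amplitude * (x * exp (- (c * x))) ^ 2).
  - replace (3 / 2 * amplitude * (x * exp (- (c * x))) ^ 2) with (x ^ 2 * (3 / 2 * amplitude * exp (- (c * x)) ^ 2)) by ring.
    apply Rmult_le_compat_l; [apply pow2_ge_0 | exact HT'].
  - apply Rle_trans with (3 / 2 * amplitude * (e / (3 / 2 * amplitude))); [|right; field; lra].
    apply Rmult_le_compat_l; [lra|].
    apply Rle_trans with (b ^ 2); [apply pow_incr; lra|].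
    apply Rle_trans with (2 := Hb2). assert (0 <= b * (1 - b)) by (apply Rmult_le_pos; lra). lra.
Qed.

(** Terms increase up to an index inside the edge strip. The factor [n] is there because of order
    [n] terms lie on this side. *)
Lemma scaled_summand_left (z d e : R) : z <> 0 -> 0 < d -> 0 < e ->
  eventually (fun n => forall m, INR m <= (golden - d) * INR n -> INR n * scaled_summand z n m <= e).
Proof.
  intros Hz Hd He. pose proof golden_bounds as Hg.
  destruct (scaled_summand_edge z Hz) as [d0 [Hd0 Edge]].
  set (r := Rmin 1 (Rmin d d0) / 2).
  assert (Hr : 0 < r) by (unfold r; assert (0 < Rmin 1 (Rmin d d0)) by (repeat apply Rmin_pos; lra); lra).
  assert (Hr1 : 2 * r <= 1) by (unfold r; pose proof (Rmin_l 1 (Rmin d d0)); lra).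
  assert (Hrm : 2 * r <= Rmin d d0) by (unfold r; pose proof (Rmin_r 1 (Rmin d d0)); lra).
  pose proof (Rmin_l d d0). pose proof (Rmin_r d d0).
  assert (H2r : 2 * r <= d0) by lra.
  generalize (filter_and _ _ (filter_and _ _ (Edge r e Hr H2r He) (scaled_summand_incr z r Hr))
    (eventually_ge (1 + 1 / r))).
  apply filter_imp. intros n [[Hedge Hincr] Hn] m Hm.
  assert (0 < 1 / r) by (apply Rdiv_lt_0_compat; lra).
  set (x := INR n) in *.
  assert (Hrx : 1 <= r * x).
  { apply Rle_trans with (r * (1 / r)); [right; field; lra | apply Rmult_le_compat_l; lra]. }
  assert (Hpos : 0 <= (golden - r) * x) by (apply Rmult_le_pos; lra).
  pose proof (nat_floor_spec _ Hpos) as Hf. set (m1 := nat_floor ((golden - r) * x)) in *.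
  assert (Hdx : 2 * r * x <= d * x) by (apply Rmult_le_compat_r; lra).
  assert (Hmm1 : (m <= m1)%nat) by (apply INR_le; lra).
  assert (Hmono : scaled_summand z n m <= scaled_summand z n m1).
  { assert (Hle : forall k, (k <= m1)%nat -> scaled_summand z n (m1 - k) <= scaled_summand z n m1).
    { induction k as [|k IH]; intros Hk; [rewrite Nat.sub_0_r; lra|].
      apply Rle_trans with (2 := IH ltac:(lia)).
      replace (m1 - k)%nat with (S (m1 - S k)) by lia. apply Hincr.
      rewrite minus_INR, S_INR by lia. pose proof (pos_INR k). lra. }
    replace m with (m1 - (m1 - m))%nat by lia. apply Hle. lia. }
  pose proof (scaled_summand_nonneg z n m1).
  apply Rle_trans with (x ^ 2 * scaled_summand z n m1).
  - apply Rmult_le_compat; [lra | apply scaled_summand_nonneg | | exact Hmono].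
    assert (0 <= x * (x - 1)) by (apply Rmult_le_pos; lra). lra.
  - apply Hedge. rewrite Rabs_left by lra. lra.
Qed.

(** The weighted terms [m^2 * scaled_summand] decrease from an index inside the edge strip on. *)
Lemma scaled_summand_right (z d e : R) : z <> 0 -> 0 < d -> 0 < e ->
  eventually (fun n => forall m, (golden + d) * INR n <= INR m -> INR m ^ 2 * scaled_summand z n m <= e).
Proof.
  intros Hz Hd He. pose proof golden_bounds as Hg.
  destruct (scaled_summand_edge z Hz) as [d0 [Hd0 Edge]].
  set (r := Rmin 1 (Rmin d d0) / 2).
  assert (Hr : 0 < r) by (unfold r; assert (0 < Rmin 1 (Rmin d d0)) by (repeat apply Rmin_pos; lra); lra).
  assert (Hr1 : 2 * r <= 1) by (unfold r; pose proof (Rmin_l 1 (Rmin d d0)); lra).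
  assert (Hrm : 2 * r <= Rmin d d0) by (unfold r; pose proof (Rmin_r 1 (Rmin d d0)); lra).
  pose proof (Rmin_l d d0). pose proof (Rmin_r d d0).
  assert (H2r : 2 * r <= d0) by lra. assert (He' : 0 < e / 16) by lra.
  generalize (filter_and _ _ (filter_and _ _ (Edge r (e / 16) Hr H2r He') (scaled_summand_decr z r Hr))
    (eventually_ge (1 + 1 / r))).
  apply filter_imp. intros n [[Hedge Hdecr] Hn] m Hm.
  assert (0 < 1 / r) by (apply Rdiv_lt_0_compat; lra).
  set (x := INR n) in *.
  assert (Hrx : 1 <= r * x).
  { apply Rle_trans with (r * (1 / r)); [right; field; lra | apply Rmult_le_compat_l; lra]. }
  assert (Hpos : 0 <= (golden + 2 * r) * x) by (apply Rmult_le_pos; lra).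
  pose proof (nat_floor_spec _ Hpos) as Hf. set (m2 := nat_floor ((golden + 2 * r) * x)) in *.
  assert (Hdx : 2 * r * x <= d * x) by (apply Rmult_le_compat_r; lra).
  assert (Hmm2 : (m2 <= m)%nat) by (apply INR_le; lra).
  assert (Hmono : INR m ^ 2 * scaled_summand z n m <= INR m2 ^ 2 * scaled_summand z n m2).
  { clear Hm. induction Hmm2 as [|m Hmm2 IH]; [lra|].
    apply Rle_trans with (2 := IH). apply Hdecr. apply le_INR in Hmm2. lra. }
  apply Rle_trans with (1 := Hmono).
  pose proof (scaled_summand_nonneg z n m2) as HT.
  (* [m2 <= (phi + 2 r) n <= 4 n], so [m2^2 <= 16 n^2]. *)
  apply Rle_trans with (16 * (x ^ 2 * scaled_summand z n m2)).
  - replace (16 * (x ^ 2 * scaled_summand z n m2)) with ((4 * x) ^ 2 * scaled_summand z n m2) by ring.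
    apply Rmult_le_compat_r; [exact HT|]. apply pow_incr. split; [apply pos_INR|].
    assert (2 * r * x <= 1 * x) by (apply Rmult_le_compat_r; lra).
    assert (golden * x <= 9 / 5 * x) by (apply Rmult_le_compat_r; lra). lra.
  - apply Rle_trans with (16 * (e / 16)); [|right; field].
    apply Rmult_le_compat_l; [lra|]. apply Hedge. rewrite Rabs_pos_eq by lra. lra.
Qed.

Definition peak (n : nat) : nat := nat_floor (golden * INR n).

Lemma peak_spec (n : nat) : INR (peak n) <= golden * INR n < INR (peak n) + 1.
Proof.
  apply nat_floor_spec, Rmult_le_pos; [pose proof golden_bounds; lra | apply pos_INR].
Qed.

(* Moving the centre of the Gaussian from [golden * n] to a neighbouring integer costs a factor
   [exp (O(j / n))], which is absorbed by halving the tolerance [e]. *)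
Lemma scaled_summand_peak_window (z e : R) : z <> 0 -> 0 < e <= / 2 ->
  exists d, 0 < d /\ eventually (fun n => forall j m, INR j <= d * INR n ->
    (m = peak n + j \/ (m + j = peak n))%nat ->
    (1 - e) * exp (- ((1 + e) * half_curvature / INR n * INR j ^ 2))
      <= sqrt (INR n) * (scaled_summand z n m / amplitude)
      <= (1 + e) * exp (- ((1 - e) * half_curvature / INR n * INR j ^ 2))).
Proof.
  intros Hz [He He2]. pose proof half_curvature_pos as Ha. set (a := half_curvature) in *.
  destruct (scaled_summand_window z (e / 2) Hz ltac:(lra)) as [d0 [Hd0 [N0 W]]].
  set (d := Rmin (d0 / 2) (e / (16 * a))).
  assert (Hd1 : d <= d0 / 2) by apply Rmin_l. assert (Hd2 : d <= e / (16 * a)) by apply Rmin_r.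
  assert (Hea : 0 < e / (16 * a)) by (apply Rdiv_lt_0_compat; lra).
  assert (Hd : 0 < d) by (unfold d; apply Rmin_pos; lra).
  exists d. split; [exact Hd|].
  assert (HN : eventually (fun n => (N0 <= n)%nat)) by (exists N0; intros; assumption).
  generalize (filter_and _ _ HN (eventually_ge (1 + 2 / d0 + 16 * a / e))).
  apply filter_imp. intros n [HnN Hn] j m Hj Hm.
  assert (0 < 2 / d0) by (apply Rdiv_lt_0_compat; lra).
  assert (0 < 16 * a / e) by (apply Rdiv_lt_0_compat; lra).
  pose proof (peak_spec n) as Hp. pose proof (pos_INR j) as Hj0.
  set (s := INR m - golden * INR n).
  assert (Hs : Rabs s <= INR j + 1).
  { unfold s. apply Rabs_le. destruct Hm as [Hm|Hm].
    - rewrite Hm, plus_INR. lra.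
    - rewrite <- Hm, plus_INR in Hp. lra. }
  assert (Hs' : INR j - 1 <= Rabs s).
  { destruct Hm as [Hm|Hm].
    - apply Rle_trans with (2 := Rle_abs s). unfold s. rewrite Hm, plus_INR. lra.
    - rewrite <- Rabs_Ropp. apply Rle_trans with (2 := Rle_abs (- s)). unfold s.
      rewrite <- Hm, plus_INR in Hp. lra. }
  set (x := INR n) in *.
  assert (Hdx : 2 <= d0 * x).
  { apply Rle_trans with (d0 * (2 / d0)); [right; field; lra | apply Rmult_le_compat_l; lra]. }
  assert (Hdd : d * x <= d0 / 2 * x) by (apply Rmult_le_compat_r; lra).
  specialize (W n m HnN ltac:(fold x; fold s; lra)). cbn [fst snd] in W. cbv zeta in W. fold x in W. fold s a in W.
  destruct W as [W1 W2].
  set (T := sqrt x * (scaled_summand z n m / amplitude)) in *.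
  assert (Hsq1 : s ^ 2 <= INR j ^ 2 + (2 * INR j + 1)).
  { rewrite <- (pow2_abs s). replace (INR j ^ 2 + (2 * INR j + 1)) with ((INR j + 1) ^ 2) by ring.
    apply pow_incr. split; [apply Rabs_pos | exact Hs]. }
  assert (Hsq2 : INR j ^ 2 - 2 * INR j <= s ^ 2).
  { rewrite <- (pow2_abs s). pose proof (pow2_ge_0 (Rabs s)).
    destruct (Rle_dec 1 (INR j)) as [Hj1|Hj1].
    - apply Rle_trans with ((INR j - 1) ^ 2); [lra|]. apply pow_incr. lra.
    - assert (0 <= INR j * (1 - INR j)) by (apply Rmult_le_pos; lra). lra. }
  assert (Hax : 0 < a / x) by (apply Rdiv_lt_0_compat; lra).
  assert (Haj : a / x * INR j <= e / 16).
  { apply Rle_trans with (a / x * (d * x)); [apply Rmult_le_compat_l; lra|].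
    replace (a / x * (d * x)) with (a * d) by (field; lra).
    apply Rle_trans with (a * (e / (16 * a))); [apply Rmult_le_compat_l; lra | right; field; lra]. }
  assert (Ha1 : a / x <= e / 16).
  { apply Rmult_le_reg_r with x; [lra|]. replace (a / x * x) with a by (field; lra).
    apply Rle_trans with (e / 16 * (16 * a / e)); [right; field; lra | apply Rmult_le_compat_l; lra]. }
  assert (Haj0 : 0 <= a / x * INR j) by (apply Rmult_le_pos; lra).
  assert (Haj2 : 0 <= a / x * INR j ^ 2) by (apply Rmult_le_pos; [lra | apply pow2_ge_0]).
  split.
  - apply Rle_trans with (2 := W1).
    assert (HE : exp (- ((1 + e) * a / x * INR j ^ 2)) * (1 - 3 * e / 8)
                 <= exp (- ((1 + e / 2) * a / x * s ^ 2))).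
    { apply Rle_trans with (exp (- ((1 + e) * a / x * INR j ^ 2)) * exp (- (3 * e / 8))).
      - apply Rmult_le_compat_l; [left; apply exp_pos|]. pose proof (exp_ineq1_le (- (3 * e / 8))). lra.
      - rewrite <- exp_plus. apply exp_le.
        replace ((1 + e / 2) * a / x * s ^ 2) with ((1 + e / 2) * (a / x * s ^ 2)) by (field; lra).
        replace ((1 + e) * a / x * INR j ^ 2) with ((1 + e) * (a / x * INR j ^ 2)) by (field; lra).
        assert (A1 : a / x * s ^ 2 <= a / x * (INR j ^ 2 + (2 * INR j + 1))) by (apply Rmult_le_compat_l; lra).
        assert (A2 : (1 + e / 2) * (a / x * s ^ 2) <= (1 + e / 2) * (a / x * (INR j ^ 2 + (2 * INR j + 1))))
          by (apply Rmult_le_compat_l; lra).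
        assert (A3 : (1 + e / 2) * (a / x * (2 * INR j + 1)) <= 2 * (3 * e / 16))
          by (apply Rmult_le_compat; lra).
        assert (A4 : 0 <= e / 2 * (a / x * INR j ^ 2)) by (apply Rmult_le_pos; lra).
        lra. }
    apply Rle_trans with ((1 - e / 2) * (exp (- ((1 + e) * a / x * INR j ^ 2)) * (1 - 3 * e / 8)));
      [|apply Rmult_le_compat_l; lra].
    pose proof (exp_pos (- ((1 + e) * a / x * INR j ^ 2))).
    replace ((1 - e / 2) * (exp (- ((1 + e) * a / x * INR j ^ 2)) * (1 - 3 * e / 8)))
      with ((1 - e / 2) * (1 - 3 * e / 8) * exp (- ((1 + e) * a / x * INR j ^ 2))) by ring.
    apply Rmult_le_compat_r; [lra|]. pose proof (pow2_ge_0 e). lra.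
  - apply Rle_trans with (1 := W2).
    assert (HE : exp (- ((1 - e / 2) * a / x * s ^ 2)) * (1 - e / 8)
                 <= exp (- ((1 - e) * a / x * INR j ^ 2))).
    { apply Rle_trans with (exp (- ((1 - e / 2) * a / x * s ^ 2)) * exp (- (e / 8))).
      - apply Rmult_le_compat_l; [left; apply exp_pos|]. pose proof (exp_ineq1_le (- (e / 8))). lra.
      - rewrite <- exp_plus. apply exp_le.
        replace ((1 - e / 2) * a / x * s ^ 2) with ((1 - e / 2) * (a / x * s ^ 2)) by (field; lra).
        replace ((1 - e) * a / x * INR j ^ 2) with ((1 - e) * (a / x * INR j ^ 2)) by (field; lra).
        assert (A1 : a / x * (INR j ^ 2 - 2 * INR j) <= a / x * s ^ 2) by (apply Rmult_le_compat_l; lra).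
        assert (A2 : (1 - e / 2) * (a / x * (INR j ^ 2 - 2 * INR j)) <= (1 - e / 2) * (a / x * s ^ 2))
          by (apply Rmult_le_compat_l; lra).
        assert (A3 : (1 - e / 2) * (a / x * (2 * INR j)) <= 1 * (e / 8)) by (apply Rmult_le_compat; lra).
        assert (A4 : 0 <= e / 2 * (a / x * INR j ^ 2)) by (apply Rmult_le_pos; lra).
        lra. }
    set (E := exp (- ((1 - e / 2) * a / x * s ^ 2))) in *. assert (0 < E) by apply exp_pos.
    apply Rle_trans with ((1 + e) * (E * (1 - e / 8))); [|apply Rmult_le_compat_l; lra].
    replace ((1 + e) * (E * (1 - e / 8))) with ((1 + e) * (1 - e / 8) * E) by ring.
    apply Rmult_le_compat_r; [lra|]. assert (0 <= e * (1 - e)) by (apply Rmult_le_pos; lra). lra.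
Qed.

Lemma ex_series_scaled_summand (z : R) (n : nat) : ex_series (scaled_summand z n).
Proof.
  apply (ex_series_scal (V := R_NormedModule)), ex_series_summand. nra.
Qed.

Lemma Series_nonneg (u : nat -> R) : (forall k, 0 <= u k) -> ex_series u -> 0 <= Series u.
Proof.
  intros Hu Hex. replace 0 with (Series (fun k => 0 * u k)) by (rewrite Series_scal_l; ring).
  apply Series_le; [|exact Hex]. intros k. pose proof (Hu k). lra.
Qed.

Lemma half_gauss_const : sqrt (PI / half_curvature) / 2 + sqrt (PI / half_curvature) / 2 = sqrt (PI / half_curvature).
Proof. field. Qed.

Lemma right_half_lim (z : R) : z <> 0 ->
  is_lim_seq (fun n => Series (fun j => scaled_summand z n (peak n + j) / amplitude))
    (sqrt (PI / half_curvature) / 2).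
Proof.
  intros Hz. pose proof amplitude_pos as HA.
  apply (half_laplace half_curvature (fun n j => scaled_summand z n (peak n + j) / amplitude)).
  - apply half_curvature_pos.
  - intros e He. destruct (scaled_summand_peak_window z e Hz He) as [d [Hd W]].
    exists d. split; [exact Hd|]. revert W. apply filter_imp. intros n W j Hj. apply W; [exact Hj | left; reflexivity].
  - intros d e [Hd _] He.
    set (Z := Series (fun m => / (INR m + 1) ^ 2)).
    assert (HZ : 0 <= Z).
    { apply Series_nonneg; [|apply ex_series_inv_sq]. intros m. pose proof (pos_INR m).
      left; apply Rinv_0_lt_compat, pow_lt; lra. }
    (* The tail is at most [b / amplitude] times the sum [Z] of inverse squares; [Z + 1] only avoids
       showing that [Z] is positive. *)
    set (b := e * amplitude / (Z + 1)).
    assert (Hb : 0 < b) by (apply Rdiv_lt_0_compat; [apply Rmult_lt_0_compat; lra | lra]).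
    (* Halving [d] pays for the integer parts in [peak n] and [w], as soon as [d n >= 2]. *)
    assert (Hd2 : 0 < d / 2) by lra.
    generalize (filter_and _ _ (scaled_summand_right z (d / 2) b Hz Hd2 Hb) (eventually_ge (1 + 2 / d))).
    apply filter_imp. intros n [Hr Hn].
    assert (0 < 2 / d) by (apply Rdiv_lt_0_compat; lra).
    set (x := INR n) in *.
    assert (Hdx : 2 <= d * x).
    { apply Rle_trans with (d * (2 / d)); [right; field; lra | apply Rmult_le_compat_l; lra]. }
    pose proof (nat_floor_spec (d * x) ltac:(lra)) as Hw. set (w := nat_floor (d * x)) in *.
    pose proof (peak_spec n) as Hp. fold x in Hp.
    assert (Hex : ex_series (fun j => scaled_summand z n (peak n + j) / amplitude)).
    { apply (ex_series_scal_r (/ amplitude) (fun j => scaled_summand z n (peak n + j))).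
      apply (ex_series_incr_n (scaled_summand z n) (peak n)), ex_series_scaled_summand. }
    rewrite (Series_incr_n _ (S w)) by (lia || exact Hex). change (pred (S w)) with w.
    match goal with |- Rabs (?s + ?t - ?s') <= _ => replace (s + t - s') with t by ring end.
    assert (Hterm : forall k, 0 <= scaled_summand z n (peak n + (S w + k)) / amplitude
              <= / (INR k + 1) ^ 2 * (b / amplitude)).
    { intros k. pose proof (scaled_summand_nonneg z n (peak n + (S w + k))) as H0.
      pose proof (pos_INR k). pose proof (pos_INR (peak n)).
      assert (Hm : INR (peak n + (S w + k)) = INR (peak n) + (INR w + 1 + INR k))
        by (rewrite !plus_INR, S_INR; reflexivity).
      specialize (Hr (peak n + (S w + k))%nat ltac:(rewrite Hm; lra)). rewrite Hm in Hr.
      set (T := scaled_summand z n (peak n + (S w + k))) in *.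
      split; [apply Rmult_le_pos; [exact H0 | left; apply Rinv_0_lt_compat, HA]|].
      replace (/ (INR k + 1) ^ 2 * (b / amplitude)) with (/ (INR k + 1) ^ 2 * b / amplitude) by (unfold Rdiv; ring).
      apply Rmult_le_compat_r; [left; apply Rinv_0_lt_compat, HA|].
      assert (Hk2 : 0 < (INR k + 1) ^ 2) by (apply pow_lt; lra).
      apply Rmult_le_reg_l with ((INR k + 1) ^ 2); [exact Hk2|].
      rewrite <- Rmult_assoc, Rinv_r, Rmult_1_l by lra.
      apply Rle_trans with (2 := Hr). apply Rmult_le_compat_r; [exact H0|].
      apply pow_incr. split; [lra|]. pose proof (pos_INR w). lra. }
    assert (Hex2 : ex_series (fun k => / (INR k + 1) ^ 2 * (b / amplitude)))
      by (apply ex_series_scal_r, ex_series_inv_sq).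
    rewrite Rabs_pos_eq.
    + apply Rle_trans with (Series (fun k => / (INR k + 1) ^ 2 * (b / amplitude))).
      * apply Series_le; [exact Hterm | exact Hex2].
      * rewrite Series_scal_r. fold Z. unfold b.
        replace (Z * (e * amplitude / (Z + 1) / amplitude)) with (e * (Z / (Z + 1))) by (field; lra).
        replace e with (e * 1) at 2 by ring. apply Rmult_le_compat_l; [lra|].
        apply Rmult_le_reg_r with (Z + 1); [lra|]. field_simplify; lra.
    + apply Series_nonneg; [intros k; apply Hterm|].
      apply (ex_series_incr_n (fun j => scaled_summand z n (peak n + j) / amplitude) (S w)), Hex.
Qed.

Lemma left_half_lim (z : R) : z <> 0 ->
  is_lim_seq (fun n => sum_f_R0 (fun j => scaled_summand z n (peak n - j) / amplitude) (peak n))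
    (sqrt (PI / half_curvature) / 2).
Proof.
  intros Hz. pose proof amplitude_pos as HA. pose proof golden_bounds as Hg.
  apply (half_laplace half_curvature (fun n j => scaled_summand z n (peak n - j) / amplitude)).
  - apply half_curvature_pos.
  - intros e He. destruct (scaled_summand_peak_window z e Hz He) as [d [Hd W]].
    (* The cap at 1 gives [j <= n <= peak n], so the natural subtraction [peak n - j] is exact. *)
    exists (Rmin d 1). split; [apply Rmin_pos; lra|].
    generalize (filter_and _ _ W (eventually_ge 2)). apply filter_imp. intros n [Wn Hn] j Hj.
    pose proof (Rmin_l d 1). pose proof (Rmin_r d 1). pose proof (peak_spec n).
    assert (Rmin d 1 * INR n <= d * INR n) by (apply Rmult_le_compat_r; lra).
    assert (Rmin d 1 * INR n <= 1 * INR n) by (apply Rmult_le_compat_r; lra).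
    assert (8 / 5 * INR n <= golden * INR n) by (apply Rmult_le_compat_r; lra).
    assert (j <= peak n)%nat by (apply INR_le; lra).
    apply Wn; [lra | right; lia].
  - intros d e [Hd Hd1] He.
    set (b := e * amplitude / 2).
    assert (Hb : 0 < b) by (unfold b; assert (0 < e * amplitude) by (apply Rmult_lt_0_compat; lra); lra).
    assert (Hd2 : 0 < d / 2) by lra.
    generalize (filter_and _ _ (scaled_summand_left z (d / 2) b Hz Hd2 Hb) (eventually_ge (2 + 2 / d))).
    apply filter_imp. intros n [Hl Hn].
    assert (0 < 2 / d) by (apply Rdiv_lt_0_compat; lra).
    set (x := INR n) in *.
    assert (Hdx : 2 <= d * x).
    { apply Rle_trans with (d * (2 / d)); [right; field; lra | apply Rmult_le_compat_l; lra]. }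
    pose proof (nat_floor_spec (d * x) ltac:(lra)) as Hw. set (w := nat_floor (d * x)) in *.
    pose proof (peak_spec n) as Hp. fold x in Hp.
    assert (8 / 5 * x <= golden * x <= 9 / 5 * x) by (split; apply Rmult_le_compat_r; lra).
    assert (d * x <= 1 * x) by (apply Rmult_le_compat_r; lra).
    assert (Hwp : (w <= peak n)%nat) by (apply INR_le; lra).
    set (g := fun j => scaled_summand z n (peak n - j) / amplitude).
    assert (Hg0 : forall j, 0 <= g j).
    { intros j. apply Rmult_le_pos; [apply scaled_summand_nonneg | left; apply Rinv_0_lt_compat, HA]. }
    pose proof (sum_f_R0_le_extend g w (peak n) Hg0 Hwp) as Hlow.
    assert (Hup : sum_f_R0 g (peak n) <= sum_f_R0 g w + (INR (peak n) - INR w) * (b / x / amplitude)).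
    { apply sum_f_R0_extend_le; [|exact Hwp]. intros j [Hj1 Hj2]. unfold g.
      apply Rmult_le_compat_r; [left; apply Rinv_0_lt_compat, HA|].
      apply Rmult_le_reg_l with x; [lra|]. replace (x * (b / x)) with b by (field; lra).
      apply Hl. rewrite minus_INR by exact Hj2. apply le_INR in Hj1. rewrite S_INR in Hj1.
      fold x. lra. }
    change (Rabs (sum_f_R0 g (peak n) - sum_f_R0 g w) <= e).
    rewrite Rabs_pos_eq by lra.
    apply Rle_trans with ((INR (peak n) - INR w) * (b / x / amplitude)); [lra|].
    apply Rle_trans with (2 * x * (b / x / amplitude)).
    + apply Rmult_le_compat_r; [|pose proof (pos_INR w); lra].
      left. apply Rdiv_lt_0_compat; [apply Rdiv_lt_0_compat; lra | exact HA].
    + right. unfold b. field. lra.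
Qed.

(** Both halves contain the term at the peak, which is therefore subtracted once; it is of order
    [1 / sqrt n] and disappears in the limit. *)
Lemma series_scaled_summand_lim (z : R) : z <> 0 ->
  is_lim_seq (fun n => Series (scaled_summand z n)) (amplitude * sqrt (PI / half_curvature)).
Proof.
  intros Hz. pose proof amplitude_pos as HA.
  assert (Hpk : is_lim_seq (fun n => scaled_summand z n (peak n) / amplitude) 0).
  { destruct (scaled_summand_peak_window z (/ 2) Hz ltac:(lra)) as [d [Hd W]].
    pose proof (is_lim_seq_sqrt _ _ (Rle_refl 0) (is_lim_seq_div_INR 4)) as Hlim. rewrite sqrt_0 in Hlim.
    apply is_lim_seq_le_le_loc with (fun _ => 0) (fun n => sqrt (4 / INR n));
      [|apply is_lim_seq_const | exact Hlim].
    generalize (filter_and _ _ W (eventually_ge 1)). apply filter_imp. intros n [Wn Hn].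
    split; [apply Rmult_le_pos; [apply scaled_summand_nonneg | left; apply Rinv_0_lt_compat, HA]|].
    specialize (Wn 0%nat (peak n) ltac:(apply Rmult_le_pos; lra) (or_introl (plus_n_O _))).
    destruct Wn as [_ Wn]. change (INR 0) with 0 in Wn.
    replace (- ((1 - / 2) * half_curvature / INR n * 0 ^ 2)) with 0 in Wn by ring.
    rewrite exp_0 in Wn.
    assert (Hs : 0 < sqrt (INR n)) by (apply sqrt_lt_R0; lra).
    rewrite sqrt_div_alt by lra. replace 4 with (2 ^ 2) by ring. rewrite sqrt_pow2 by lra.
    apply Rmult_le_reg_l with (sqrt (INR n)); [exact Hs|].
    apply Rle_trans with (1 := Wn). replace (sqrt (INR n) * (2 / sqrt (INR n))) with 2 by (field; lra). lra. }
  assert (H := is_lim_seq_mult' _ _ _ _ (is_lim_seq_const amplitude)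
    (is_lim_seq_minus' _ _ _ _ (is_lim_seq_plus' _ _ _ _ (left_half_lim z Hz) (right_half_lim z Hz)) Hpk)).
  rewrite half_gauss_const, Rminus_0_r in H.
  apply is_lim_seq_ext with (2 := H). intros n.
  assert (Hex := ex_series_scaled_summand z n).
  rewrite (Series_incr_n (scaled_summand z n) (S (peak n))) by (lia || exact Hex).
  change (pred (S (peak n))) with (peak n).
  rewrite (Series_incr_n (fun j => scaled_summand z n (peak n + j) / amplitude) 1).
  2: lia.
  2:{ apply (ex_series_scal_r (/ amplitude) (fun j => scaled_summand z n (peak n + j))).
      apply (ex_series_incr_n (scaled_summand z n) (peak n)), Hex. }
  change (pred 1) with 0%nat. cbn [sum_f_R0]. rewrite Nat.add_0_r.
  rewrite (sum_f_R0_rev (fun j => scaled_summand z n j / amplitude)).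
  rewrite (sum_eq (fun j => scaled_summand z n j / amplitude) (fun j => scaled_summand z n j * / amplitude))
    by reflexivity.
  rewrite <- scal_sum.
  rewrite (Series_ext (fun k => scaled_summand z n (peak n + (1 + k)) / amplitude)
    (fun k => scaled_summand z n (S (peak n) + k) * / amplitude))
    by (intros k; replace (peak n + (1 + k))%nat with (S (peak n) + k)%nat by lia; reflexivity).
  rewrite Series_scal_r. field. lra.
Qed.

(** * The error of the convergents *)

(** The distance to the fixed point [g / (1 + r)] contracts by [r < 1] at each step, up to a
    vanishing perturbation. This recovers a single term from the sum of two that the Casoratian
    provides. *)
Lemma is_lim_seq_two_term (w : nat -> R) (r g : R) : 0 <= r < 1 ->
  is_lim_seq (fun n => w (S n) + r * w n) g -> is_lim_seq w (g / (1 + r)).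
Proof.
  intros Hr H. set (l := g / (1 + r)).
  assert (Hl : l + r * l = g) by (unfold l; field; lra).
  apply is_lim_seq_spec. intros eps. pose proof (cond_pos eps) as He.
  apply is_lim_seq_spec in H.
  (* A perturbation of size [(1 - r) eps / 2] keeps the accumulated error below [eps / 2], since
     [r eps / 2 + (1 - r) eps / 2 = eps / 2]. *)
  destruct (H (mkposreal ((1 - r) * (eps / 2)) ltac:(apply Rmult_lt_0_compat; lra))) as [N HN]. simpl in HN.
  assert (Hk : forall k, Rabs (w (N + k)%nat - l) <= r ^ k * Rabs (w N - l) + eps / 2).
  { induction k as [|k IH].
    - rewrite Nat.add_0_r. simpl. lra.
    - rewrite <- plus_n_Sm. specialize (HN (N + k)%nat ltac:(lia)).
      replace (w (S (N + k)) - l) with ((w (S (N + k)) + r * w (N + k)%nat - g) + - r * (w (N + k)%nat - l))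
        by (rewrite <- Hl; ring).
      apply Rle_trans with (1 := Rabs_triang _ _). rewrite Rabs_mult, Rabs_Ropp, (Rabs_pos_eq r) by lra.
      assert (r * Rabs (w (N + k)%nat - l) <= r * (r ^ k * Rabs (w N - l) + eps / 2))
        by (apply Rmult_le_compat_l; lra).
      simpl pow. lra. }
  assert (Hg : is_lim_seq (fun k => r ^ k * Rabs (w N - l)) 0).
  { replace 0 with (0 * Rabs (w N - l)) by ring.
    apply is_lim_seq_mult'; [|apply is_lim_seq_const].
    apply is_lim_seq_geom. rewrite Rabs_pos_eq; lra. }
  destruct (is_lim_seq_lt _ _ (eps / 4) Hg ltac:(lra)) as [M HM].
  exists (N + M)%nat. intros n Hn. replace n with (N + (n - N))%nat by lia.
  specialize (Hk (n - N)%nat). specialize (HM (n - N)%nat ltac:(lia)). lra.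
Qed.

Definition weight (z : R) (n : nat) : R := prod_sq (4 * z ^ 2) n * prod_sq (9 * z ^ 2) n.

Definition error_num (z : R) (n : nat) : R := weight z n * (cosh (PI * z) * remainder (z ^ 2) n).

Lemma b7_S (z : R) (n : nat) :
  b7 z (S n) = ((INR n + 1) ^ 2 + 4 * z ^ 2) * ((INR n + 1) ^ 2 + 9 * z ^ 2).
Proof. unfold b7. rewrite S_INR. reflexivity. Qed.

Lemma a7_S_S (z : R) (n : nat) :
  a7 z (S (S n)) = 11 * (INR n + 2) ^ 2 - 11 * (INR n + 2) + 3 + 9 * z ^ 2.
Proof.
  change (a7 z (S (S n))) with (11 * INR (S (S n)) ^ 2 - 11 * INR (S (S n)) + 3 + 9 * z ^ 2).
  rewrite !S_INR. ring.
Qed.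

Lemma weight_S (z : R) (n : nat) : weight z (S n) = weight z n * b7 z (S n).
Proof. unfold weight. rewrite b7_S, !prod_sq_S. ring. Qed.

Lemma weight_pos (z : R) (n : nat) : 0 < weight z n.
Proof. apply Rmult_lt_0_compat; apply prod_sq_pos; nra. Qed.

(** The recurrence of [remainder] multiplied by [weight]; inserting the signs [(-1)^n] turns it into
    the one satisfied by [cf_p] and [cf_q]. *)
Lemma error_num_rec (z : R) (n : nat) :
  error_num z (S (S n)) = b7 z (S n) * error_num z n - a7 z (S (S n)) * error_num z (S n).
Proof.
  pose proof (remainder_rec (z ^ 2) n (pow2_ge_0 z)) as E. cbv zeta in E.
  unfold error_num. rewrite !weight_S, a7_S_S, (b7_S z (S n)), S_INR.
  replace (INR n + 1 + 1) with (INR n + 2) by ring.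
  replace (remainder (z ^ 2) n) with
    (((INR n + 2) ^ 2 + 4 * z ^ 2) * ((INR n + 2) ^ 2 + 9 * z ^ 2) * remainder (z ^ 2) (S (S n))
    + (11 * (INR n + 2) ^ 2 - 11 * (INR n + 2) + 3 + 9 * z ^ 2) * remainder (z ^ 2) (S n)) by lra.
  ring.
Qed.

Lemma cosh_ratio_lim (z : R) : z <> 0 ->
  is_lim_seq (fun m => prod_sq (z ^ 2) m / prod_sq (4 * z ^ 2) m) (/ cosh (PI * z)).
Proof.
  intros Hz. pose proof (sinh_neq_0 _ (PI_mult_neq_0 z Hz)) as Hs. pose proof (cosh_pos (PI * z)) as Hc.
  pose proof PI_RGT_0.
  pose proof (sinh_prod_mult z 1 ltac:(lra)) as H1. pose proof (sinh_prod_mult z 2 ltac:(lra)) as H2.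
  replace (1 ^ 2 * z ^ 2) with (z ^ 2) in H1 by ring. replace (2 ^ 2 * z ^ 2) with (4 * z ^ 2) in H2 by ring.
  rewrite Rmult_1_l in H1. rewrite (Rmult_assoc 2), sinh_double in H2.
  replace (2 * sinh (PI * z) * cosh (PI * z) / (2 * (PI * z))) with (cosh (PI * z) * (sinh (PI * z) / (PI * z))) in H2
    by (field; split; [exact Hz | lra]).
  assert (HA : sinh (PI * z) / (PI * z) <> 0).
  { apply Rmult_integral_contrapositive. split; [exact Hs | apply Rinv_neq_0_compat, PI_mult_neq_0, Hz]. }
  assert (HB : cosh (PI * z) * (sinh (PI * z) / (PI * z)) <> 0)
    by (apply Rmult_integral_contrapositive; split; [lra | exact HA]).
  assert (H3 := is_lim_seq_mult' _ _ _ _ H1 (is_lim_seq_inv_R _ _ HB H2)).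
  replace (/ cosh (PI * z)) with (sinh (PI * z) / (PI * z) * / (cosh (PI * z) * (sinh (PI * z) / (PI * z))))
    by (field; repeat split; try lra; assumption).
  apply is_lim_seq_ext with (2 := H3). intros m.
  pose proof (INR_fact_lt_0 m). pose proof (prod_sq_pos (4 * z ^ 2) m ltac:(nra)). field. split; lra.
Qed.

Lemma error_num_0 (z : R) : z <> 0 -> error_num z 0 = (cosh (PI * z) - 1) / (3 * z ^ 2).
Proof.
  intros Hz. pose proof (remainder_0 _ _ (pow2_ge_0 z) (cosh_ratio_lim z Hz)) as E.
  pose proof (cosh_pos (PI * z)).
  assert (E' : remainder (z ^ 2) 0 = (1 - / cosh (PI * z)) / (3 * z ^ 2)) by (rewrite <- E; field; exact Hz).
  unfold error_num, weight. cbn [prod_sq]. rewrite E'. field. split; [exact Hz | lra].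
Qed.

Lemma error_num_1 (z : R) : z <> 0 -> error_num z 1 = 5 - 3 * (1 - z ^ 2) * error_num z 0.
Proof.
  intros Hz. pose proof (remainder_rec_1 _ _ (pow2_ge_0 z) (cosh_ratio_lim z Hz)) as E.
  pose proof (cosh_pos (PI * z)).
  assert (E' : cosh (PI * z) * ((1 + 4 * z ^ 2) * (1 + 9 * z ^ 2) * remainder (z ^ 2) 1
     + 3 * (1 - z ^ 2) * remainder (z ^ 2) 0) = 5) by (rewrite E; field; lra).
  rewrite <- E' at 1. unfold error_num, weight. cbn [prod_sq]. change (INR 1) with 1. ring.
Qed.

Lemma error_num_spec (z : R) (n : nat) : z <> 0 ->
  (cosh (PI * z) - 1) / (3 * z ^ 2) * cf_q (a7 z) (b7 z) n - cf_p (a7 z) (b7 z) n = (-1) ^ n * error_num z n.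
Proof.
  intros Hz. rewrite <- error_num_0 by exact Hz.
  assert (H : forall k,
    error_num z 0 * cf_q (a7 z) (b7 z) k - cf_p (a7 z) (b7 z) k = (-1) ^ k * error_num z k /\
    error_num z 0 * cf_q (a7 z) (b7 z) (S k) - cf_p (a7 z) (b7 z) (S k) = (-1) ^ S k * error_num z (S k)).
  { induction k as [|k [IH1 IH2]].
    - split; [simpl; ring|]. rewrite error_num_1 by exact Hz. simpl. ring.
    - split; [exact IH2|].
      change (cf_q (a7 z) (b7 z) (S (S k)))
        with (a7 z (S (S k)) * cf_q (a7 z) (b7 z) (S k) + b7 z (S k) * cf_q (a7 z) (b7 z) k).
      change (cf_p (a7 z) (b7 z) (S (S k)))
        with (a7 z (S (S k)) * cf_p (a7 z) (b7 z) (S k) + b7 z (S k) * cf_p (a7 z) (b7 z) k).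
      rewrite error_num_rec.
      transitivity (a7 z (S (S k)) * ((-1) ^ S k * error_num z (S k)) + b7 z (S k) * ((-1) ^ k * error_num z k)).
      + rewrite <- IH1, <- IH2. ring.
      + cbn [pow]. ring. }
  apply H.
Qed.

(* The Casoratian of the two solutions [q] and [(-1)^n error_num] of the recurrence. *)
Lemma casoratian (z : R) (n : nat) : z <> 0 ->
  error_num z (S n) * cf_q (a7 z) (b7 z) n + error_num z n * cf_q (a7 z) (b7 z) (S n) = 5 * weight z n.
Proof.
  intros Hz. induction n as [|n IH].
  - rewrite error_num_1 by exact Hz. unfold weight. simpl. ring.
  - change (cf_q (a7 z) (b7 z) (S (S n)))
      with (a7 z (S (S n)) * cf_q (a7 z) (b7 z) (S n) + b7 z (S n) * cf_q (a7 z) (b7 z) n).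
    rewrite error_num_rec, weight_S, <- Rmult_assoc, <- IH. ring.
Qed.

(** All terms are nonnegative and the one at [m = n], the first index where the binomial coefficient
    is nonzero, is positive. *)
Lemma remainder_pos (c : R) (n : nat) : 0 <= c -> 0 < remainder c n.
Proof.
  intros Hc. unfold remainder.
  rewrite (Series_incr_n _ (S n)) by (lia || apply ex_series_summand, Hc).
  change (pred (S n)) with n.
  assert (H1 : 0 <= Series (fun k => summand c n (S n + k))).
  { apply Series_nonneg; [intros k; apply summand_bounds, Hc|].
    apply (ex_series_incr_n (summand c n) (S n)), ex_series_summand, Hc. }
  assert (H2 : 0 < summand c n n).
  { unfold summand. pose proof (falling_pos n n (Nat.le_refl n)). pose proof (INR_fact_lt_0 n).
    pose proof (prod_sq_pos c n Hc). pose proof (prod_sq_pos (4 * c) (S (n + n)) ltac:(lra)).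
    apply Rdiv_lt_0_compat; [|assumption]. apply Rmult_lt_0_compat; [|assumption].
    apply Rdiv_lt_0_compat; assumption. }
  assert (H3 : summand c n n <= sum_f_R0 (summand c n) n).
  { rewrite <- (sum_f_R0_rev (summand c n)).
    pose proof (sum_f_R0_le_extend (fun j => summand c n (n - j)) 0 n
      (fun j => proj1 (summand_bounds c n (n - j) Hc)) ltac:(lia)) as Hle.
    cbn [sum_f_R0] in Hle. rewrite Nat.sub_0_r in Hle. exact Hle. }
  lra.
Qed.

Lemma error_num_pos (z : R) (n : nat) : 0 < error_num z n.
Proof.
  apply Rmult_lt_0_compat; [apply weight_pos|].
  apply Rmult_lt_0_compat; [apply cosh_pos | apply remainder_pos, pow2_ge_0].
Qed.

(** * Limits of the normalising factors *)

Lemma series_scaled_summand (z : R) (n : nat) :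
  Series (scaled_summand z n)
  = INR n * INR (fact n) ^ 2 * golden ^ (5 * n) * cosh (PI * z) * remainder (z ^ 2) n.
Proof. unfold scaled_summand. rewrite Series_scal_l. reflexivity. Qed.

Lemma weight_lim (z : R) : z <> 0 ->
  is_lim_seq (fun n => weight z n / INR (fact n) ^ 4)
    (sinh (2 * PI * z) * sinh (3 * PI * z) / (6 * PI ^ 2 * z ^ 2)).
Proof.
  intros Hz. pose proof PI_RGT_0 as HPI.
  assert (H := is_lim_seq_mult' _ _ _ _ (sinh_prod_mult z 2 ltac:(lra)) (sinh_prod_mult z 3 ltac:(lra))).
  replace (sinh (2 * PI * z) * sinh (3 * PI * z) / (6 * PI ^ 2 * z ^ 2))
    with (sinh (2 * PI * z) / (2 * PI * z) * (sinh (3 * PI * z) / (3 * PI * z)))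
    by (field; split; [exact Hz | lra]).
  apply is_lim_seq_ext with (2 := H). intros n. unfold weight.
  replace (2 ^ 2 * z ^ 2) with (4 * z ^ 2) by ring. replace (3 ^ 2 * z ^ 2) with (9 * z ^ 2) by ring.
  pose proof (INR_fact_lt_0 n). field. lra.
Qed.

(** Binet's formula for the fifth Fibonacci number, [phi^5 + phi^(-5) = 5 sqrt 5]. It evaluates the
    factor [1 + phi^(-10)] produced by [is_lim_seq_two_term]. *)
Lemma golden_pow_5_10 : golden ^ 10 + 1 = 5 * sqrt 5 * golden ^ 5.
Proof.
  pose proof golden_sq as Hq. rewrite sqrt5_golden.
  assert (H4 : golden ^ 4 = 3 * golden + 2) by (replace (golden ^ 4) with ((golden ^ 2) ^ 2) by ring; rewrite Hq; lra).
  assert (H5 : golden ^ 5 = 5 * golden + 3)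
    by (replace (golden ^ 5) with (golden * golden ^ 4) by ring; rewrite H4; lra).
  replace (golden ^ 10) with (golden ^ 5 * golden ^ 5) by ring. rewrite H5. lra.
Qed.

Lemma series_limit_sq : (amplitude * sqrt (PI / half_curvature)) ^ 2 = 4 * PI ^ 2 / (golden ^ 5 * sqrt 5).
Proof.
  pose proof golden_bounds. pose proof PI_RGT_0. pose proof half_curvature_pos.
  assert (H5 : 0 < sqrt 5) by (apply sqrt_lt_R0; lra).
  replace ((amplitude * sqrt (PI / half_curvature)) ^ 2)
    with ((sqrt (2 * PI) * sqrt (2 * PI)) / golden ^ 8 * (sqrt (PI / half_curvature) * sqrt (PI / half_curvature)))
    by (unfold amplitude; field; lra).
  rewrite !sqrt_sqrt by (try lra; left; apply Rdiv_lt_0_compat; lra).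
  unfold half_curvature, curvature. field. lra.
Qed.

(** The inverse of the error, stripped of its sign and of its growth [phi^(10 n)]. Unlike the error
    it obeys a linear two-term relation: the Casoratian divided by [D_n D_{n+1} phi^(10 (n+1))]. *)
Definition scaled_ratio (z : R) (n : nat) : R :=
  cf_q (a7 z) (b7 z) n / (error_num z n * golden ^ (10 * n)).

Definition target_const (z : R) : R := 2 / (3 * z ^ 2) * sinh (2 * PI * z) * sinh (3 * PI * z).

Lemma target_const_neq_0 (z : R) : z <> 0 -> target_const z <> 0.
Proof.
  intros Hz. pose proof PI_RGT_0.
  assert (Hsinh : forall k, k <> 0 -> sinh (k * PI * z) <> 0).
  { intros k Hk. apply sinh_neq_0. rewrite Rmult_assoc.
    apply Rmult_integral_contrapositive_currified; [exact Hk | apply PI_mult_neq_0, Hz]. }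
  unfold target_const.
  apply Rmult_integral_contrapositive_currified; [|apply Hsinh; lra].
  apply Rmult_integral_contrapositive_currified; [|apply Hsinh; lra].
  apply Rmult_integral_contrapositive_currified; [lra|].
  apply Rinv_neq_0_compat, Rmult_integral_contrapositive_currified; [lra | apply pow_nonzero, Hz].
Qed.

(** With [r = phi^(-10)], the Casoratian gives [w(n+1) + r w(n) = 5 / (weight(n+1) E_n E_{n+1}
    phi^(10 n + 10))]. In the resulting constant the [sqrt 5] of the curvature cancels against
    [5 sqrt 5] from [golden_pow_5_10]. *)
Lemma scaled_ratio_lim (z : R) : z <> 0 -> is_lim_seq (scaled_ratio z) (golden ^ 5 / target_const z).
Proof.
  intros Hz. pose proof golden_bounds as Hg. pose proof PI_RGT_0 as HPI.
  assert (H5 : 0 < sqrt 5) by (apply sqrt_lt_R0; lra).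
  assert (Hg5 : 0 < golden ^ 5) by (apply pow_lt; lra).
  pose proof (target_const_neq_0 z Hz) as HK.
  set (kap := amplitude * sqrt (PI / half_curvature)).
  assert (Hkap : kap <> 0).
  { apply Rmult_integral_contrapositive_currified; [apply Rgt_not_eq, amplitude_pos|].
    apply Rgt_not_eq, sqrt_lt_R0, Rdiv_lt_0_compat; [lra | apply half_curvature_pos]. }
  set (w' := sinh (2 * PI * z) * sinh (3 * PI * z) / (6 * PI ^ 2 * z ^ 2)).
  assert (EK : target_const z = 4 * PI ^ 2 * w').
  { unfold target_const, w'. field. split; [exact Hz | lra]. }
  assert (Hw' : w' <> 0) by (intros E; apply HK; rewrite EK, E; ring).
  assert (Hr : 0 <= / golden ^ 10 < 1).
  { assert (1 < golden ^ 10) by (apply Rlt_pow_R1; [lra | lia]).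
    split; [left; apply Rinv_0_lt_compat; lra | rewrite <- Rinv_1; apply Rinv_lt_contravar; lra]. }
  replace (golden ^ 5 / target_const z)
    with (5 / golden ^ 5 * (1 * (/ w' * (/ kap * / kap))) / (1 + / golden ^ 10)).
  2:{ rewrite EK.
      replace (/ kap * / kap) with (/ kap ^ 2) by (field; exact Hkap).
      unfold kap. rewrite series_limit_sq.
      replace (1 + / golden ^ 10) with ((golden ^ 10 + 1) / golden ^ 10) by (field; lra).
      rewrite golden_pow_5_10. field. repeat split; try lra; assumption. }
  apply is_lim_seq_two_term; [exact Hr|].
  assert (He := series_scaled_summand_lim z Hz). fold kap in He.
  assert (He1 : is_lim_seq (fun n => Series (scaled_summand z (S n))) kap)
    by (apply -> (is_lim_seq_incr_1 (fun n => Series (scaled_summand z n))); exact He).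
  assert (Hw := weight_lim z Hz). fold w' in Hw. apply is_lim_seq_incr_1 in Hw.
  (* The normalisations of [E_n] and [E_{n+1}] multiply to [n (n+1) n!^2 (n+1)!^2 = n / (n+1) *
     (n+1)!^4], and the fourth power is the one that [weight_lim] expects. *)
  assert (Hn : is_lim_seq (fun n => INR n / (INR n + 1)) 1).
  { apply is_lim_seq_O_inv with 1. intros m. pose proof (pos_INR m).
    replace (INR m / (INR m + 1) - 1) with (- (1 / (INR m + 1))) by (field; lra).
    rewrite Rabs_Ropp, Rabs_pos_eq; [lra|]. left. apply Rdiv_lt_0_compat; lra. }
  assert (H := is_lim_seq_mult' _ _ _ _ (is_lim_seq_const (5 / golden ^ 5))
    (is_lim_seq_mult' _ _ _ _ Hn (is_lim_seq_mult' _ _ _ _ (is_lim_seq_inv_R _ _ Hw' Hw)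
      (is_lim_seq_mult' _ _ _ _ (is_lim_seq_inv_R _ _ Hkap He) (is_lim_seq_inv_R _ _ Hkap He1))))).
  apply is_lim_seq_ext_loc with (2 := H). exists 1%nat. intros n Hn1.
  apply le_INR in Hn1. change (INR 1) with 1 in Hn1.
  pose proof (casoratian z n Hz) as Ec.
  rewrite !series_scaled_summand, S_INR, fact_S.
  pose proof (error_num_pos z n) as P1. pose proof (error_num_pos z (S n)) as P2.
  pose proof (INR_fact_lt_0 n). pose proof (weight_pos z n). pose proof (weight_pos z (S n)).
  pose proof (cosh_pos (PI * z)). pose proof (remainder_pos (z ^ 2) n (pow2_ge_0 z)).
  pose proof (remainder_pos (z ^ 2) (S n) (pow2_ge_0 z)).
  assert (Hgn : 0 < golden ^ n) by (apply pow_lt; lra).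
  replace (golden ^ (5 * n)) with ((golden ^ n) ^ 5) by (rewrite <- pow_mult; f_equal; lia).
  replace (golden ^ (5 * S n)) with ((golden ^ n) ^ 5 * golden ^ 5)
    by (rewrite <- pow_mult, <- pow_add; f_equal; lia).
  transitivity (5 * weight z n / (error_num z n * error_num z (S n) * ((golden ^ n) ^ 10 * golden ^ 10))).
  - unfold error_num. field. repeat split; try lra.
  - rewrite <- Ec. unfold scaled_ratio.
    replace (golden ^ (10 * n)) with ((golden ^ n) ^ 10) by (rewrite <- pow_mult; f_equal; lia).
    replace (golden ^ (10 * S n)) with ((golden ^ n) ^ 10 * golden ^ 10)
      by (rewrite <- pow_mult, <- pow_add; f_equal; lia).
    field. repeat split; lra.
Qed.

Lemma error_eq (z : R) (n : nat) : z <> 0 -> scaled_ratio z n <> 0 ->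
  (cosh (PI * z) - 1) / (3 * z ^ 2) - cf_p (a7 z) (b7 z) n / cf_q (a7 z) (b7 z) n
  = (-1) ^ n * / golden ^ (10 * n) * / scaled_ratio z n.
Proof.
  intros Hz Hn. pose proof (error_num_spec z n Hz) as E. pose proof (error_num_pos z n).
  assert (Hg : 0 < golden ^ (10 * n)) by (apply pow_lt; pose proof golden_bounds; lra).
  assert (Hq : cf_q (a7 z) (b7 z) n <> 0).
  { intros E0. apply Hn. unfold scaled_ratio. rewrite E0. unfold Rdiv. ring. }
  set (L := (cosh (PI * z) - 1) / (3 * z ^ 2)) in *.
  replace (L - cf_p (a7 z) (b7 z) n / cf_q (a7 z) (b7 z) n)
    with ((L * cf_q (a7 z) (b7 z) n - cf_p (a7 z) (b7 z) n) / cf_q (a7 z) (b7 z) n) by (field; exact Hq).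
  rewrite E. unfold scaled_ratio. field. repeat split; try lra; exact Hq.
Qed.

Theorem theorem7p3 (z : R) (hz : z <> 0) :
  Un_cv (fun n => cf_p (a7 z) (b7 z) n / cf_q (a7 z) (b7 z) n)
        ((cosh (PI * z) - 1) / (3 * z ^ 2)) /\
  Un_cv (fun n =>
           ((cosh (PI * z) - 1) / (3 * z ^ 2)
              - cf_p (a7 z) (b7 z) n / cf_q (a7 z) (b7 z) n)
           / ((-1) ^ n * (2 / (3 * z ^ 2) * sinh (2 * PI * z) * sinh (3 * PI * z))
              / golden ^ (10 * n + 5)))
        1.
Proof.
  pose proof golden_bounds as Hg. pose proof (target_const_neq_0 z hz) as HK.
  pose proof (scaled_ratio_lim z hz) as Hl.
  assert (Hg5 : 0 < golden ^ 5) by (apply pow_lt; lra).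
  assert (Hl0 : golden ^ 5 / target_const z <> 0).
  { apply Rmult_integral_contrapositive_currified; [lra | apply Rinv_neq_0_compat, HK]. }
  (* Some denominators may vanish: [q(1) = 3 (1 - z^2)] is 0 at [z = 1] and [z = -1]. A nonzero
     limit excludes this for large [n], which suffices for both claims. *)
  assert (Hev : eventually (fun n => scaled_ratio z n <> 0)).
  { apply (Hl (fun v => v <> 0)). exists (mkposreal _ (Rabs_pos_lt _ Hl0)). intros v Hv E0.
    change (Rabs (v - golden ^ 5 / target_const z) < Rabs (golden ^ 5 / target_const z)) in Hv.
    rewrite E0, Rminus_0_l, Rabs_Ropp in Hv. lra. }
  pose proof (is_lim_seq_inv_R _ _ Hl0 Hl) as Hi.
  set (L := (cosh (PI * z) - 1) / (3 * z ^ 2)).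
  split; apply is_lim_seq_Reals.
  (* Convergence itself: the error is this geometric sequence times the convergent sequence
     [/ scaled_ratio z n]. *)
  - assert (Hgeo : is_lim_seq (fun n => (- / golden ^ 10) ^ n) 0).
    { apply is_lim_seq_geom. rewrite Rabs_Ropp, Rabs_pos_eq.
      - assert (1 < golden ^ 10) by (apply Rlt_pow_R1; [lra | lia]).
        rewrite <- Rinv_1. apply Rinv_lt_contravar; lra.
      - left. apply Rinv_0_lt_compat, pow_lt. lra. }
    assert (H := is_lim_seq_minus' _ _ _ _ (is_lim_seq_const L) (is_lim_seq_mult' _ _ _ _ Hgeo Hi)).
    rewrite Rmult_0_l, Rminus_0_r in H.
    apply is_lim_seq_ext_loc with (2 := H). revert Hev. apply filter_imp. intros n Hn.
    pose proof (error_eq z n hz Hn) as E. fold L in E.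
    replace ((- / golden ^ 10) ^ n) with ((-1) ^ n * / golden ^ (10 * n)); [lra|].
    replace (- / golden ^ 10) with (-1 * / golden ^ 10) by ring.
    rewrite Rpow_mult_distr, pow_inv, <- pow_mult. reflexivity.
  - assert (H := is_lim_seq_mult' _ _ _ _ (is_lim_seq_const (golden ^ 5 / target_const z)) Hi).
    rewrite Rinv_r in H by exact Hl0.
    apply is_lim_seq_ext_loc with (2 := H). revert Hev. apply filter_imp. intros n Hn.
    unfold L. rewrite (error_eq z n hz Hn). fold (target_const z).
    assert (H10 : 0 < golden ^ (10 * n)) by (apply pow_lt; lra).
    assert (Hs : (-1) ^ n <> 0) by (apply pow_nonzero; lra).
    rewrite pow_add. field. repeat split; try lra; assumption.
Qed.
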